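(* Let $(a_n)_n$ be a sequence in $\mathbb R$ such that $\lim_{n\to\infty}\frac{a_n}{\sqrt n}=\infty$ and $\lim_{n\to\infty}\frac{a_n}{n}=0$, and put $c_n=n/a_n$. For $\mathbb P$-a.e. $\omega\in\Omega$ and any $\theta\in\mathbb R^d$, $$\lim_{n\to\infty}\frac{1}{a_n^2/n}\log\int_X e^{\theta\cdot S_ng(\omega,\cdot)/c_n}\,d\mu_\omega=\frac12\theta^T\Sigma^2\theta .$$ Consequently, when $\Sigma^2$ is positive definite (with inverse $\Sigma^{-2}$), for $\mathbb P$-a.e. $\omega$: (i) for any closed set $A\subset\mathbb R^d$, $$\limsup_{n\to\infty}\frac{1}{a_n^2/n}\log\mu_\omega(\{S_ng(\omega,\cdot)/a_n\in A\})\le-\frac12\inf_{x\in A}x^T\Sigma^{-2}x;$$ (ii) for any open set $A\subset\mathbb R^d$, $$\liminf_{n\to\infty}\frac{1}{a_n^2/n}\log\mu_\omega(\{S_ng(\omega,\cdot)/a_n\in A\})\ge-\frac12\inf_{x\in A}x^T\Sigma^{-2}x.$$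
   Context: Base: $(\Omega,\mathcal F,\mathbb P)$ is a probability space, $\Omega$ a Borel subset of a separable complete metric space, and $\sigma:\Omega\to\Omega$ is a homeomorphism that is an invertible ergodic $\mathbb P$-preserving transformation. Variation: $(X,\mathcal G)$ is a measurable space with a probability measure $m$ and a functional $\mathrm{var}:L^1(X,m)\to[0,\infty]$ such that: (V1) $\mathrm{var}(th)=|t|\mathrm{var}(h)$; (V2) $\mathrm{var}(g+h)\le\mathrm{var}(g)+\mathrm{var}(h)$; (V3) $\|h\|_{L^\infty}\le C_{\mathrm{var}}(\|h\|_1+\mathrm{var}(h))$ for a constant $1\le C_{\mathrm{var}}<\infty$; (V4) for any $C>0$ the set $\{h:X\to\mathbb R:\|h\|_1+\mathrm{var}(h)\le C\}$ is $L^1(m)$-compact; (V5) $\mathrm{var}(1_X)<\infty$; (V6) $\{h:X\to\mathbb R_+:\|h\|_1=1,\ \mathrm{var}(h)<\infty\}$ is $L^1(m)$-dense in $\{h:X\to\mathbb R_+:\|h\|_1=1\}$; (V7) if $\mathrm{ess\,inf} f>0$ then $\mathrm{var}(1/f)\le\mathrm{var}(f)/(\mathrm{ess\,inf} f)^2$; (V8) $\mathrm{var}(fg)\le\|f\|_{L^\infty}\mathrm{var}(g)+\|g\|_{L^\infty}\mathrm{var}(f)$; (V9) for $M>0$, measurable $f:X\to\overline B_{\mathbb R^d}(0,M)$ and $C^1$ $h:\overline B_{\mathbb R^d}(0,M)\to\mathbb C$, $\mathrm{var}(h\circ f)\le\sup\{\|Dh(P)\|:P\in\overline B_{\mathbb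 R^d}(0,M)\}\,\mathrm{var}(f)$, where for vector-valued $f$, $\mathrm{var}(f)=\max_i\mathrm{var}(f^i)$. $\mathcal B=\{h\in L^1(X,m):\mathrm{var}(h)<\infty\}$ (complex-valued functions) is a Banach space with norm $\|h\|_{\mathcal B}=\|h\|_1+\mathrm{var}(h)$. Cocycle: $T_\omega:X\to X$, $\omega\in\Omega$, are nonsingular ($m\circ T_\omega^{-1}\ll m$), $T_\omega^{(n)}=T_{\sigma^{n-1}\omega}\circ\cdots\circ T_\omega$. The transfer operator $\mathcal L_\omega$ is defined by $\int(\mathcal L_\omega\phi)\psi\,dm=\int\phi\,(\psi\circ T_\omega)\,dm$ ($\phi\in L^1,\psi\in L^\infty$), and $\mathcal L_\omega^{(n)}=\mathcal L_{\sigma^{n-1}\omega}\circ\cdots\circ\mathcal L_\omega$. The cocycle is assumed admissible: (C1) $\omega\mapsto\mathcal L_\omega\in L(\mathcal B)$ is continuous on each of countably many Borel sets whose union is $\Omega$; (C2) there is $K>0$ with $\|\mathcal L_\omega f\|_{\mathcal B}\le K\|f\|_{\mathcal B}$ for all $f\in\mathcal B$ and a.e. $\omega$; (C3) there are $N\in\mathbb N$ and measurable $\alpha^N,\beta^N:\Omega\to(0,\infty)$ with $\int\log\alpha^N\,d\mathbb P<0$ and $\|\mathcal L_\omega^{(N)}f\|_{\mathcal B}\le\alpha^N(\omega)\|f\|_{\mathcal B}+\beta^N(\omega)\|f\|_1$ for all $f\in\mathcal B$, a.e. $\omega$; (C4) there are $K',\lambda>0$ with $\|\mathcal L_\omega^{(n)}f\|_{\mathcal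 B}\le K'e^{-\lambda n}\|f\|_{\mathcal B}$ for all $n\ge0$, $f\in\mathcal B$ with $\int f\,dm=0$, a.e. $\omega$; (C5) there are $N\in\mathbb N$, $c>0$ such that for each $a>0$ and all sufficiently large $n$, $\mathrm{ess\,inf}\,\mathcal L_\omega^{(Nn)}f\ge c\|f\|_1$ for a.e. $\omega$ and all $f\in\mathcal B$ with $f\ge0$, $\mathrm{var}(f)\le a\int f\,dm$. Invariant measure: $v^0:\Omega\times X\to\mathbb R^+$ is the unique measurable map with $v_\omega^0=v^0(\omega,\cdot)\in\mathcal B$, $\int v_\omega^0dm=1$, $\mathcal L_\omega v_\omega^0=v_{\sigma\omega}^0$ for a.e. $\omega$; $d\mu_\omega=v_\omega^0\,dm$. Observable: $g=(g^1,\dots,g^d):\Omega\times X\to\mathbb R^d$ is measurable, $\|g\|_{L^\infty(\Omega\times X)}<\infty$, $\mathrm{ess\,sup}_\omega\max_i\mathrm{var}(g^i(\omega,\cdot))<\infty$, and $\int g^i(\omega,\cdot)\,d\mu_\omega=0$ for a.e. $\omega$ and all $i$. $S_ng(\omega,x)=\sum_{i=0}^{n-1}g(\sigma^i\omega,T_\omega^{(i)}x)$. Covariance: $\Sigma^2$ is the positive semi-definite $d\times d$ matrix with $\Sigma^2=\lim_{n\to\infty}\frac1n\mathrm{Cov}_{\mu_\omega}(S_ng(\omega,\cdot))$ for a.e. $\omega$ (this limit exists). *)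

(* Defs.v *)
From HB Require Import structures.
From mathcomp Require Import all_boot all_order all_algebra.
From mathcomp Require Import all_classical all_reals all_analysis.
From mathcomp Require Import ess_sup_inf.
From mathcomp.real_closed Require Import complex.

Set Implicit Arguments.
Unset Strict Implicit.
Unset Printing Implicit Defensive.

Import Order.TTheory GRing.Theory Num.Theory.
Import numFieldNormedType.Exports.

Local Open Scope classical_set_scope.
Local Open Scope complex_scope.
Local Open Scope ring_scope.

(* The L^p pseudometric on the library's type of p-integrable real functions.
   Functions that agree a.e. are at distance 0, so topological notions of this
   space are those of the quotient L^p. *)
Section Lfun_pseudometric.
Context d (T : measurableType d) (R : realType).
Variables (mu : {measure set T -> \bar R}) (p : \bar R) (p1 : (1 <= p)%E).
Implicit Types f g h : LfunType mu p1.

Definition Lfun_ball f (e : R) : set (LfunType mu p1) :=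
  [set g | ('N[mu]_p[EFin \o (f - g : LfunType mu p1)%R] < e%:E)%E].

Definition Lfun_nbhs f : set_system (LfunType mu p1) :=
  nbhs_ (entourage_ Lfun_ball) f.

HB.instance Definition _ := hasNbhs.Build (LfunType mu p1) Lfun_nbhs.

Lemma Lfun_nbhsE :
  (@nbhs _ (LfunType mu p1)) = nbhs_ (entourage_ Lfun_ball).
Proof. by []. Qed.

Let nm (f : LfunType mu p1) : R := fine ('N[mu]_p[EFin \o f])%E.

Let Lfun_ballE f (e : R) g : Lfun_ball f e g <-> nm (f - g) < e.
Proof. by rewrite -lte_fin /nm (finite_norm_fine (f - g)). Qed.

Lemma Lfun_ball_center f (e : R) : 0 < e -> Lfun_ball f e f.
Proof.
move=> e0; apply/Lfun_ballE; rewrite subrr.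
suff -> : nm 0 = 0 by [].
by rewrite /nm (@Lnorm0 _ _ _ mu p)// gt_eqF// (lt_le_trans _ p1).
Qed.

Lemma Lfun_ball_sym f g (e : R) : Lfun_ball f e g -> Lfun_ball g e f.
Proof.
move/Lfun_ballE => fg; apply/Lfun_ballE; move: fg.
rewrite -(opprB g f) /nm -(oppe_Lnorm mu (EFin \o (g - f : LfunType mu p1))).
by congr (fine _ < _); apply: eq_Lnorm.
Qed.

Lemma Lfun_ball_triangle f g h (e1 e2 : R) :
  Lfun_ball f e1 g -> Lfun_ball g e2 h -> Lfun_ball f (e1 + e2) h.
Proof.
move=> /Lfun_ballE fg /Lfun_ballE gh; apply/Lfun_ballE.
have -> : f - h = (f - g) + (g - h) by rewrite addrA subrK.
exact: le_lt_trans (ler_LnormD (f - g) (g - h)) (ltrD fg gh).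
Qed.

HB.instance Definition _ := @Nbhs_isPseudoMetric.Build R (LfunType mu p1)
  (entourage_ Lfun_ball) Lfun_nbhsE Lfun_ball
  Lfun_ball_center Lfun_ball_sym Lfun_ball_triangle erefl.

End Lfun_pseudometric.

Definition rowdot (R : realType) d (x y : 'rV[R]_d) : R := (x *m y^T) 0 0.

Definition quad (R : realType) d (A : 'M[R]_d) (x : 'rV[R]_d) : R :=
  (x *m A *m x^T) 0 0.

Definition psd (R : realType) d (A : 'M[R]_d) : Prop :=
  A^T = A /\ forall x, 0 <= quad A x.

Definition posdef (R : realType) d (A : 'M[R]_d) : Prop :=
  A^T = A /\ forall x, x != 0 -> 0 < quad A x.

Section base.
Context (R : realType) d (Omega : measurableType d).

(* Omega is identified through emb with a Borel subset of the complete
   separable metric space E; its topology is then the one induced by emb.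
   The sigma-algebra of Omega contains the Borel sets, and may be larger, such
   as a completion. *)
Definition borel_subset_of_polish (E : metricType R) (emb : Omega -> E) : Prop :=
  [/\ forall F : set_system E, ProperFilter F -> cauchy F -> exists x : E, F --> x,
      exists2 D : set E, countable D & dense D,
      injective emb,
      <<s @open E >> (range emb) &
      forall U : set E, open U -> measurable (emb @^-1` U)].

Definition homeomorphism (T : topologicalType) (s : T -> T) : Prop :=
  exists t, [/\ cancel s t, cancel t s, continuous s & continuous t].

Definition invertible_ergodic (P : probability Omega R) (s : Omega -> Omega) :=
  [/\ exists t, [/\ cancel s t, cancel t s, measurable_fun setT s &
                    measurable_fun setT t],
      forall A, measurable A -> P (s @^-1` A) = P A &
      forall A, measurable A -> s @^-1` A = A -> P A = 0%E \/ P A = 1%E].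

(* cocycle s F n w is F (s^(n-1) w) \o ... \o F (s w) \o F w *)
Fixpoint cocycle (A : Type) (s : Omega -> Omega) (F : Omega -> A -> A)
    (n : nat) (w : Omega) (a : A) : A :=
  if n is k.+1 then F (iter k s w) (cocycle s F k w a) else a.

End base.

Section variation.
Context (R : realType) d (X : measurableType d) (m : probability X R).
Implicit Types (f g h : X -> R[i]) (var : (X -> R[i]) -> \bar R).
Local Notation normc := ComplexField.Normc.normc.

Definition toC (f : X -> R) : X -> R[i] := fun x => (f x)%:C.

Definition cmeasurable f : Prop :=
  measurable_fun setT (fun x => complex.Re (f x)) /\
  measurable_fun setT (fun x => complex.Im (f x)).

Definition norm1 f : \bar R := Lnorm m 1%E (fun x => (normc (f x))%:E).
Definition normoo f : \bar R := Lnorm m +oo%E (fun x => (normc (f x))%:E).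

Definition L1 f : Prop := cmeasurable f /\ (norm1 f < +oo)%E.
Definition Loo f : Prop := cmeasurable f /\ (normoo f < +oo)%E.

Definition cintegral f : R[i] :=
  (\int[m]_x complex.Re (f x)) +i* (\int[m]_x complex.Im (f x)).

Definition normB var f : \bar R := (norm1 f + var f)%E.

Definition inB var f : Prop := L1 f /\ (var f < +oo)%E.

Definition opnormB var (A : (X -> R[i]) -> (X -> R[i])) : \bar R :=
  ereal_sup [set normB var (A f) | f in
              [set f | inB var f /\ (normB var f <= 1)%E]].

(* max_i var(f^i) *)
Definition rvar var n (f : X -> 'rV[R]_n) : \bar R :=
  \big[maxe/0%E]_(i < n) var (toC (fun x => f x 0 i)).

(* Here |y| is the max norm of R^n (the library's norm on 'rV[R]_n), in line
   with the maximum in rvar; rball and Dnorm both refer to it. *)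
Definition rball n (M : R) : set 'rV[R]_n := [set y | `|y| <= M].
Arguments rball : clear implicits.

(* A C^1 function on a closed ball is the restriction of a function that is
   C^1 (in the real sense) on an open set containing the ball. *)
Definition C1_on_rball n (M : R) (h : 'rV[R]_n -> R[i]) : Prop :=
  exists U : set 'rV[R]_n, [/\ open U, rball n M `<=` U &
    forall y, U y ->
      [/\ differentiable (fun z => complex.Re (h z)) y,
          differentiable (fun z => complex.Im (h z)) y,
          forall v, {for y, continuous
            (fun z => 'd (fun u => complex.Re (h u)) z v : R)} &
          forall v, {for y, continuous
            (fun z => 'd (fun u => complex.Im (h u)) z v : R)}]].

(* The operator norm of the real derivative Dh(y) : R^n -> C. *)
Definition Dnorm n (h : 'rV[R]_n -> R[i]) (y : 'rV[R]_n) : \bar R :=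
  ereal_sup [set (normc (('d (fun u => complex.Re (h u)) y v : R) +i*
                         ('d (fun u => complex.Im (h u)) y v : R)))%:E
            | v in rball n 1].

(* Elements of L^1 are represented by functions, hence var_ae; var_compact and
   var_dense concern real functions and use the topology of L^1 defined above;
   var_complete says that B is complete for normB. *)
Record is_variation n var : Prop := IsVariation {
  var_ge0 : forall f, L1 f -> (0 <= var f)%E;
  var_ae : forall f g, L1 f -> L1 g ->
    {ae m, forall x, f x = g x} -> var f = var g;
  var_scale : forall (t : R[i]) f, L1 f ->
    var (fun x => t * f x) = ((normc t)%:E * var f)%E;
  var_add : forall f g, L1 f -> L1 g ->
    (var (fun x => f x + g x)%R <= var f + var g)%E;
  var_sup : exists2 C : R, 1 <= C & forall f, L1 f ->
    (normoo f <= C%:E * (norm1 f + var f))%E;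
  var_compact : forall C : R, 0 < C ->
    compact [set h : LfunType m (@lexx _ (\bar R) 1%E) |
      (norm1 (toC h) + var (toC h) <= C%:E)%E];
  var_one : (var (fun=> 1%R) < +oo)%E;
  var_dense :
    [set h : LfunType m (@lexx _ (\bar R) 1%E) |
      (forall x, 0 <= h x) /\ norm1 (toC h) = 1%E] `<=`
    closure [set h : LfunType m (@lexx _ (\bar R) 1%E) |
      [/\ forall x, 0 <= h x, norm1 (toC h) = 1%E & (var (toC h) < +oo)%E]];
  var_inv : forall f : X -> R, L1 (toC f) ->
    (0 < ess_inf m (EFin \o f))%E ->
    (var (toC (fun x => (f x)^-1)%R) <=
       var (toC f) * ((fine (ess_inf m (EFin \o f)) ^+ 2)^-1)%R%:E)%E;
  var_mul : forall f g, L1 f -> L1 g -> L1 (fun x => f x * g x) ->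
    (var (fun x => f x * g x)%R <= normoo f * var g + normoo g * var f)%E;
  var_comp : forall (M : R) (f : X -> 'rV[R]_n) (h : 'rV[R]_n -> R[i]),
    0 < M -> (forall i, measurable_fun setT (fun x => f x 0 i)) ->
    (forall x, rball n M (f x)) -> C1_on_rball M h ->
    (var (h \o f) <= ereal_sup (Dnorm h @` rball n M) * rvar var f)%E;
  var_complete : forall u : nat -> X -> R[i], (forall k, inB var (u k)) ->
    (forall e : R, 0 < e -> exists N, forall k l, (N <= k)%N -> (N <= l)%N ->
       (normB var (fun x => u k x - u l x)%R <= e%:E)%E) ->
    exists2 f, inB var f &
      normB var (fun x => u k x - f x)%R @[k --> \oo] --> 0%E
}.

Definition nonsingular (T : X -> X) : Prop :=
  measurable_fun setT T /\ pushforward m T `<< m.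

Definition is_transfer (T : X -> X) (L : (X -> R[i]) -> (X -> R[i])) : Prop :=
  forall phi, L1 phi -> L1 (L phi) /\
    forall psi, Loo psi ->
      cintegral (fun x => L phi x * psi x) =
      cintegral (fun x => phi x * psi (T x)).

Record admissible dO (Omega : measurableType dO) (P : probability Omega R)
    (E : metricType R) (emb : Omega -> E) (s : Omega -> Omega) var
    (L : Omega -> (X -> R[i]) -> (X -> R[i])) : Prop := Admissible {
  adm_bounded : forall w, (forall f, inB var f -> inB var (L w f)) /\
    (opnormB var (L w) < +oo)%E;
  adm_continuous : exists D : nat -> set Omega,
    [/\ forall k, <<s @open (initial_topology emb) >> (D k),
        \bigcup_k D k = setT &
        forall k w, D k w -> forall e : R, 0 < e ->
          \forall w' \near within (D k) (nbhs (w : initial_topology emb)),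
            (opnormB var (fun f x => L w' f x - L w f x)%R < e%:E)%E];
  adm_uniform : exists2 K : R, 0 < K & {ae P, forall w, forall f, inB var f ->
    (normB var (L w f) <= K%:E * normB var f)%E};
  adm_lasota_yorke : exists (N : nat) (alpha beta : Omega -> R),
    [/\ (0 < N)%N,
        measurable_fun setT alpha /\ measurable_fun setT beta,
        forall w, 0 < alpha w /\ 0 < beta w,
        (* the integral of log alpha exists in [-oo, +oo) and is negative;
           the library sets +oo - +oo = -oo *)
        (\int[P]_w (maxe (ln (alpha w))%:E 0) < +oo)%E /\
          (\int[P]_w (ln (alpha w))%:E < 0)%E &
        {ae P, forall w, forall f, inB var f ->
          (normB var (cocycle s L N w f) <=
             (alpha w)%:E * normB var f + (beta w)%:E * norm1 f)%E}];
  adm_decay : exists K lambda : R, [/\ 0 < K, 0 < lambda &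
    {ae P, forall w, forall n f, inB var f -> cintegral f = 0 ->
      (normB var (cocycle s L n w f) <=
         (K * expR (- lambda * n%:R))%:E * normB var f)%E}];
  adm_lower : exists (N : nat) (c : R), [/\ (0 < N)%N, 0 < c &
    forall a : R, 0 < a -> \forall n \near \oo,
      {ae P, forall w, forall f : X -> R, inB var (toC f) ->
        (forall x, 0 <= f x) ->
        (var (toC f) <= a%:E * \int[m]_x (f x)%:E)%E ->
        (c%:E * norm1 (toC f) <=
           ess_inf m
             (fun x => (complex.Re (cocycle s L (N * n) w (toC f) x))%:E))%E}]
}.

End variation.

Definition birkhoff (R : realType) dO (Omega : measurableType dO) (X : Type)
    d (s : Omega -> Omega) (T : Omega -> X -> X) (g : Omega * X -> 'rV[R]_d)
    (n : nat) (w : Omega) (x : X) : 'rV[R]_d :=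
  \sum_(i < n) g (iter i s w, cocycle s T i w x).

(* Main.v *)
Require Import Defs.
From HB Require Import structures.
From mathcomp Require Import all_boot all_order all_algebra.
From mathcomp Require Import all_classical all_reals all_analysis.
From mathcomp Require Import measurable_realfun ess_sup_inf.
From mathcomp.real_closed Require Import complex.
From mathcomp Require Import ring lra.

(** Fix a base point and follow its forward orbit. Write $A_j$ for the transfer
    operator at time $j$, $v_j$ for the equivariant density, $S_n$ for the Birkhoff
    sum of a scalar observable $\phi_j$, and $E$ for the expectation under the
    measure with density $v_0$. The heart of the proof is
    $$ \log E e^{t S_n} = \frac{t^2}{2} E S_n^2 + O(n |t|^3) $$
    for all $n$ and all real $t$ near zero ([ln_mgf_expansion]). With $t = a_n/n$,
    and after division by $n t^2 = a_n^2/n$, the error is $O(|t|)$ and tends to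
    zero, while $E S_n^2 / n$ tends to the covariance form. The dynamics enters
    through the exponential contraction of the transfer operators on mean-zero
    functions.

    The expansion comes from following the normalised density $h_j$ of the image of
    $e^{t S_j} v_0 dm$. The ratio of consecutive moment generating functions is
    $\int e^{t\phi_j} h_j$, and $h_j$ obeys a recursion in which each step multiplies
    by $e^{t\phi_j}$, renormalises, and transports by $A_j$. The difference
    $h_j - v_j$ has mean zero and is forced by kicks of size $O(t)$, so contraction
    keeps it of size $O(t)$ ([forced_decay], [density_shift_bd]); subtracting its
    linear response, it is of size $O(t^2)$ ([shift_rem_bd]). Since $\phi_j$ is
    centred, the increment of the logarithm is $t^2$ times a sum of a variance and a
    response term, up to $O(|t|^3)$ ([mgf_incr_expansion]), and these are exactly the
    increments of $E S_n^2 / 2$. The same forcing argument, started from the constant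
    function 1, bounds all $v_j$ along the orbit ([density_bounded]). That the tilts
    $e^{t\phi_j}$ and their Taylor remainders act on functions of bounded variation
    with norms of the right order follows from the chain and product rules for the
    variation ([tilt_multipliers]).

    The large deviation bounds follow because the limiting cumulants are a positive
    definite quadratic form. For the upper bound, the outside of an ellipsoid is
    covered by finitely many half-spaces, a compactness argument on directions
    ([halfspace_cover]), and each of them is estimated by the exponential Markov
    inequality ([upper_bound]). For the lower bound, an exponential tilt moves the
    mean to the target point, and the Markov inequality for the tilted measure shows
    that a small ball around it keeps half of the mass ([lower_bound]).

    The assumptions hold simultaneously at all points of the forward orbit of almost
    every base point, as the base map preserves null sets ([ae_forward_orbit]). *)

Set Implicit Arguments.
Unset Strict Implicit.
Unset Printing Implicit Defensive.

Import Order.TTheory GRing.Theory Num.Theory.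
Import numFieldNormedType.Exports.

Local Open Scope classical_set_scope.
Local Open Scope complex_scope.
Local Open Scope ring_scope.

(** * Real functions and their integrals *)

Local Ltac nonneg := repeat first [assumption | exact: ler0n | exact: sqr_ge0 |
  exact: normr_ge0 | apply: exprn_ge0 | apply: mulr_ge0 | apply: addr_ge0].

Section real_functions.
Context (R : realType) dX (X : measurableType dX) (m : probability X R).
Implicit Types f g h psi : X -> R.
Local Notation normc := ComplexField.Normc.normc.

Definition bounded_mfun (b : R) psi : Prop :=
  measurable_fun setT psi /\ forall x, `|psi x| <= b.

Definition rintegrable f : Prop := m.-integrable setT (EFin \o f).

Lemma bounded_mfun_ge0 (b : R) psi : bounded_mfun b psi -> 0 <= b.
Proof. by move=> [_ /(_ point)]; exact: le_trans. Qed.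

Lemma bounded_mfun_cst (c : R) : bounded_mfun `|c| (fun=> c).
Proof. by split => //; exact: measurable_cst. Qed.

Lemma bounded_mfun_comp b psi T : measurable_fun setT T ->
  bounded_mfun b psi -> bounded_mfun b (psi \o T).
Proof. by move=> mT [mpsi bpsi]; split => [|x]; [exact: measurableT_comp|exact: bpsi]. Qed.

Lemma bounded_mfunD b c f g : bounded_mfun b f -> bounded_mfun c g ->
  bounded_mfun (b + c) (fun x => f x + g x).
Proof.
move=> [mf bf] [mg bg]; split; first exact: measurable_funD.
by move=> x; rewrite (le_trans (ler_normD _ _))// lerD.
Qed.

Lemma bounded_mfunM b c f g : bounded_mfun b f -> bounded_mfun c g ->
  bounded_mfun (b * c) (fun x => f x * g x).
Proof.
move=> [mf bf] [mg bg]; split; first exact: measurable_funM.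
by move=> x; rewrite normrM ler_pM.
Qed.

Lemma bounded_mfunZ b (c : R) f : bounded_mfun b f ->
  bounded_mfun (`|c| * b) (fun x => c * f x).
Proof. by move=> bf; exact: bounded_mfunM (bounded_mfun_cst c) bf. Qed.

Lemma bounded_mfun_expR b f : bounded_mfun b f ->
  bounded_mfun (expR b) (fun x => expR (f x)).
Proof.
move=> [mf bf]; split; first exact: measurableT_comp.
move=> x; rewrite ger0_norm ?expR_ge0// ler_expR.
exact: le_trans (ler_norm _) (bf x).
Qed.

Lemma bounded_mfun_sum (I : Type) (r : seq I) (b : I -> R) (h : I -> X -> R) :
  (forall i, bounded_mfun (b i) (h i)) ->
  bounded_mfun (\sum_(i <- r) b i) (fun x => \sum_(i <- r) h i x).
Proof.
move=> bh; elim: r => [|i s IH].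
  have -> : (fun x => \sum_(i <- [::]) h i x) = cst 0.
    by apply/funext => x; rewrite big_nil.
  by split => [|x]; [exact: measurable_cst|rewrite big_nil normr0].
have -> : (fun x => \sum_(i <- i :: s) h i x) = (fun x => h i x + \sum_(i <- s) h i x).
  by apply/funext => x; rewrite big_cons.
by rewrite big_cons; exact: bounded_mfunD.
Qed.

Lemma bounded_mfun_indic (E : set X) : measurable E -> bounded_mfun 1 (\1_E : X -> R).
Proof.
move=> mE; split; first exact: measurable_indic.
by move=> x; rewrite indicE; case: (x \in E); rewrite ?normr1 ?normr0.
Qed.

Lemma bounded_mfun_le (b b' : R) (psi : X -> R) : b <= b' -> bounded_mfun b psi -> bounded_mfun b' psi.
Proof. by move=> bb [mpsi H]; split => // x; exact: le_trans (H x) bb. Qed.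

Lemma normc_toC f x : normc (toC f x) = `|f x|.
Proof. by rewrite /toC /= expr0n addr0 sqrtr_sqr. Qed.

Lemma norm1_toC f : norm1 m (toC f) = (\int[m]_x `|f x|%:E)%E.
Proof.
rewrite /norm1 Lnorm1; apply: eq_integral => x _.
by rewrite normc_toC /= normr_id.
Qed.

Lemma L1_toCP f : L1 m (toC f) <-> rintegrable f.
Proof.
rewrite /L1 norm1_toC /rintegrable; split.
  move=> [[mf _] fi]; apply/integrableP; split; first exact/measurable_EFinP.
  by rewrite (eq_integral (fun x => `|f x|%:E)).
move=> /integrableP[/measurable_EFinP mf fi]; split.
  by split => //=; exact: measurable_cst.
by rewrite (eq_integral (fun x => `|(EFin \o f) x|)%E).
Qed.

Lemma rintegrable_bounded b psi : bounded_mfun b psi -> rintegrable psi.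
Proof.
move=> [mpsi bpsi]; apply: measurable_bounded_integrable => //.
  by rewrite (le_lt_trans (probability_le1 _ _)) ?ltry.
exists b; split; first exact: num_real.
by move=> c bc x _; exact: le_trans (bpsi x) (ltW bc).
Qed.

Lemma rintegrableM b f psi : rintegrable f -> bounded_mfun b psi ->
  rintegrable (fun x => f x * psi x).
Proof.
move=> fi [mpsi bpsi].
apply: (@le_integrable _ _ _ m _ measurableT _ (EFin \o (fun x => `|b| * f x))).
- apply/measurable_EFinP/measurable_funM => //.
  by move/integrableP: fi => [/measurable_EFinP].
- move=> x _ /=; rewrite lee_fin !normrM mulrC ler_wpM2r// normr_id.
  exact: le_trans (bpsi x) (ler_norm _).
- rewrite (_ : _ \o _ = (fun x => `|b|%:E * (EFin \o f) x)%E); last first.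
    by apply/funext => x /=.
  exact: integrableZl.
Qed.

Lemma rintegrableD f g : rintegrable f -> rintegrable g ->
  rintegrable (fun x => f x + g x).
Proof. by move=> fi gi; exact: (integrableD measurableT fi gi). Qed.

Lemma rintegrableZ c f : rintegrable f -> rintegrable (fun x => c * f x).
Proof.
move=> fi; rewrite /rintegrable.
by have := integrableZl measurableT c fi.
Qed.

Lemma rintegrable_measurable f : rintegrable f -> measurable_fun setT f.
Proof. by move=> /integrableP[/measurable_EFinP]. Qed.

Lemma ae_eq_Rintegral f g : rintegrable f -> measurable_fun setT g ->
  {ae m, forall x, f x = g x} -> \int[m]_x f x = \int[m]_x g x.
Proof.
move=> /rintegrable_measurable mf mg fg; rewrite /Rintegral; congr fine.
apply: ae_eq_integral => //; [exact/measurable_EFinP|exact/measurable_EFinP|].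
by apply: filterS fg => x /= -> _.
Qed.

Lemma ae_eq_rintegrable f g : rintegrable f -> measurable_fun setT g ->
  {ae m, forall x, f x = g x} -> rintegrable g.
Proof.
move=> fi mg fg; apply/integrableP; split; first exact/measurable_EFinP.
move/integrableP: (fi) => [mf]; apply: le_lt_trans.
rewrite le_eqVlt; apply/orP; left; apply/eqP; apply: ae_eq_integral => //.
- by apply/measurableT_comp => //; exact/measurable_EFinP.
- exact/measurableT_comp.
- by apply: filterS fg => x /= -> _.
Qed.

Lemma Rintegral_mulDl f g b psi : rintegrable f -> rintegrable g -> bounded_mfun b psi ->
  \int[m]_x ((f x + g x) * psi x) = \int[m]_x (f x * psi x) + \int[m]_x (g x * psi x).
Proof.
move=> fi gi bpsi; rewrite -RintegralD//; last 2 first.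
- exact: rintegrableM fi bpsi.
- exact: rintegrableM gi bpsi.
by apply: eq_Rintegral => x _; rewrite mulrDl.
Qed.

Lemma Rintegral_mulZl f c b psi : rintegrable f -> bounded_mfun b psi ->
  \int[m]_x ((c * f x) * psi x) = c * \int[m]_x (f x * psi x).
Proof.
move=> fi bpsi; rewrite -RintegralZl//; last exact: rintegrableM fi bpsi.
by apply: eq_Rintegral => x _; rewrite mulrA.
Qed.

Lemma rintegrable1 : rintegrable (fun=> 1).
Proof. exact: (rintegrable_bounded (bounded_mfun_cst 1)). Qed.

Lemma Rintegral1 (c : R) : \int[m]_x (fun=> c) x = c.
Proof. by rewrite Rintegral_cst//= (probability_setT m) mulr1. Qed.

Lemma rintegrable0 : rintegrable (fun=> 0).
Proof. exact: (rintegrable_bounded (bounded_mfun_cst 0)). Qed.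

Lemma weighted_expR_gt0 b v f : rintegrable v -> (forall x, 0 <= v x) ->
  \int[m]_x v x = 1 -> bounded_mfun b f -> 0 < \int[m]_x (v x * expR (f x)).
Proof.
move=> vi v0 v1 bf; apply: (@lt_le_trans _ _ (expR (- b))); first exact: expR_gt0.
have -> : expR (- b) = \int[m]_x (v x * expR (- b)).
  by rewrite RintegralZr// v1 mul1r.
apply: le_Rintegral => //.
- exact: rintegrableM vi (bounded_mfun_cst _).
- exact: rintegrableM vi (bounded_mfun_expR bf).
- move=> x _; rewrite ler_wpM2l// ler_expR lerNl (le_trans (ler_norm _))//.
  by rewrite normrN bf.2.
Qed.

(** Testing against bounded functions, in particular indicators, separates
    the points of $L^1$. *)
Lemma ae_eq_of_pairing f g : rintegrable f -> rintegrable g ->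
  (forall b psi, bounded_mfun b psi ->
     \int[m]_x (f x * psi x) = \int[m]_x (g x * psi x)) ->
  {ae m, forall x, f x = g x}.
Proof.
move=> fi gi fg.
have : ae_eq m setT (EFin \o f) (EFin \o g).
  apply: integral_ae_eq => //.
    by apply/measurable_EFinP; exact: rintegrable_measurable.
  move=> A _ mA.
  have bA := bounded_mfun_indic mA.
  have E h : rintegrable h ->
      (\int[m]_(x in A) (EFin \o h) x)%E = (\int[m]_x (h x * \1_A x))%:E.
    move=> hi; rewrite /Rintegral fineK; last first.
      by apply: integrable_fin_num => //; exact: (rintegrableM hi bA).
    rewrite [LHS]integral_mkcond; apply: eq_integral => x _.
    by rewrite patchE indicE /=; case: ifPn => _; rewrite ?mulr1 ?mulr0.
  by rewrite !E// (fg _ _ bA).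
by apply: filterS => x /= /(_ I)[].
Qed.

End real_functions.

(** * Functions of bounded variation *)

Section bounded_variation.
Context (R : realType) dX (X : measurableType dX) (m : probability X R).
Context (n : nat) (var : (X -> R[i]) -> \bar R) (hvar : is_variation m n var).
Implicit Types f g h psi : X -> R.
Local Notation normc := ComplexField.Normc.normc.

(** A single judgement for membership in the space of functions of bounded
    variation and a bound on the norm: estimates then compose without separate
    finiteness conditions on extended reals. *)
Definition bdB f (c : R) : Prop :=
  rintegrable m f /\ (normB m var (toC f) <= c%:E)%E.

Lemma norm1_ge0 (f : X -> R[i]) : (0 <= norm1 m f)%E.
Proof. exact: Lnorm_ge0. Qed.

Lemma bdB_var_ge0 f : rintegrable m f -> (0 <= var (toC f))%E.
Proof. by move=> fi; apply: (var_ge0 hvar); exact/L1_toCP. Qed.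

Lemma bdB_ge0 f c : bdB f c -> 0 <= c.
Proof.
move=> [fi]; rewrite -lee_fin; apply: le_trans.
by rewrite /normB adde_ge0// ?norm1_ge0// bdB_var_ge0.
Qed.

Lemma bdB_le f c c' : c <= c' -> bdB f c -> bdB f c'.
Proof. by move=> cc' [fi fc]; split=> //; rewrite (le_trans fc)// lee_fin. Qed.

Lemma bdB_inB f c : bdB f c -> inB m var (toC f).
Proof.
move=> [fi fc]; split; first exact/L1_toCP.
apply: le_lt_trans (ltry c); apply: le_trans fc.
by rewrite /normB leeDr// norm1_ge0.
Qed.

Lemma inB_bdB f : inB m var (toC f) -> exists c, bdB f c.
Proof.
move=> [f1 fv]; have fi : rintegrable m f by exact/L1_toCP.
exists (fine (normB m var (toC f))); split => //; rewrite fineK//.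
rewrite ge0_fin_numE; last by rewrite adde_ge0// ?norm1_ge0// bdB_var_ge0.
by rewrite /normB lte_add_pinfty//; case: f1.
Qed.

Lemma bdB_norm1 f c : bdB f c -> \int[m]_x `|f x| <= c.
Proof.
move=> [fi fc]; rewrite -lee_fin /Rintegral fineK; last first.
  by apply: integrable_fin_num => //; exact: (integrable_abse fi).
apply: le_trans fc; rewrite -norm1_toC /normB.
by rewrite leeDl// bdB_var_ge0.
Qed.

Lemma bdB_pairing f psi b c : bounded_mfun b psi -> bdB f c ->
  `|\int[m]_x (f x * psi x)| <= b * c.
Proof.
move=> bpsi bf; have fi := bf.1.
have fpi := rintegrableM fi bpsi.
have b0 := bounded_mfun_ge0 bpsi.
rewrite (le_trans (le_normr_Rintegral _ _))//.
apply: (@le_trans _ _ (\int[m]_x (b * `|f x|))).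
  apply: le_Rintegral => //.
  - exact: (integrable_abse fpi).
  - by apply: (@rintegrableZ _ _ _ m b (fun x => `|f x|)); exact: (integrable_abse fi).
  - by move=> x _; rewrite normrM mulrC ler_wpM2r// bpsi.2.
rewrite RintegralZl//; last exact: (integrable_abse fi).
by rewrite ler_wpM2l// bdB_norm1.
Qed.

Lemma bdB_ae f g c : measurable_fun setT g -> {ae m, forall x, f x = g x} ->
  bdB f c -> bdB g c.
Proof.
move=> mg fg [fi fc]; have gi := ae_eq_rintegrable fi mg fg.
split => //; apply: le_trans fc; rewrite /normB le_eqVlt; apply/orP; left.
apply/eqP; congr (_ + _)%E.
  rewrite !norm1_toC; apply: ae_eq_integral => //.
  - by apply/measurable_EFinP/measurableT_comp.
  - by apply/measurable_EFinP/measurableT_comp => //; exact: rintegrable_measurable fi.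
  - by apply: filterS fg => x /= -> _.
apply: (var_ae hvar); [exact/L1_toCP|exact/L1_toCP|].
by apply: filterS fg => x; rewrite /toC => ->.
Qed.

Lemma bdBZ a f c : bdB f c -> bdB (fun x => a * f x) (`|a| * c).
Proof.
move=> [fi fc]; split; first exact: rintegrableZ.
have -> : toC (fun x => a * f x) = (fun x => a%:C * toC f x).
  by apply/funext => x; rewrite /toC rmorphM.
rewrite /normB (var_scale hvar)//; last exact/L1_toCP.
have -> : norm1 m (fun x => a%:C * toC f x) = (`|a|%:E * norm1 m (toC f))%E.
  have -> : (fun x => a%:C * toC f x) = toC (fun x => a * f x).
    by apply/funext => x; rewrite /toC rmorphM.
  rewrite !norm1_toC -ge0_integralZl//.
  - by apply: eq_integral => x _; rewrite normrM EFinM.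
  - by apply/measurable_EFinP/measurableT_comp => //; exact: rintegrable_measurable fi.
have -> : normc a%:C = `|a| by exact: (normc_toC (fun=> a) point).
rewrite -ge0_muleDr ?norm1_ge0 ?bdB_var_ge0//.
by rewrite EFinM lee_wpmul2l.
Qed.

Lemma bdBD f g c c' : bdB f c -> bdB g c' -> bdB (fun x => f x + g x) (c + c').
Proof.
move=> [fi fc] [gi gc]; have fgi := rintegrableD fi gi.
split => //.
have E : toC (fun x => f x + g x) = (fun x => toC f x + toC g x).
  by apply/funext => x; rewrite /toC rmorphD.
apply: (@le_trans _ _ (normB m var (toC f) + normB m var (toC g))%E); last first.
  by rewrite EFinD leeD.
rewrite /normB addeACA leeD//; last first.
  by rewrite E (var_add hvar)//; exact/L1_toCP.
rewrite !norm1_toC -ge0_integralD//.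
- apply: ge0_le_integral => //.
  + by apply/measurable_EFinP/measurableT_comp => //; exact: rintegrable_measurable fgi.
  + apply: emeasurable_funD; apply/measurable_EFinP/measurableT_comp => //; 
     [exact: rintegrable_measurable fi|exact: rintegrable_measurable gi].
  + by move=> x _; rewrite -EFinD lee_fin ler_normD.
- by apply/measurable_EFinP/measurableT_comp => //; exact: rintegrable_measurable fi.
- by apply/measurable_EFinP/measurableT_comp => //; exact: rintegrable_measurable gi.
Qed.

Lemma bdBN f c : bdB f c -> bdB (fun x => - f x) c.
Proof.
move=> /(bdBZ (-1)); rewrite normrN1 mul1r.
by rewrite (_ : (fun x => -1 * f x) = (fun x => - f x))//; apply/funext => x; rewrite mulN1r.
Qed.

Lemma bdBB f g c c' : bdB f c -> bdB g c' -> bdB (fun x => f x - g x) (c + c').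
Proof. by move=> bf /bdBN bg; exact: bdBD. Qed.

Lemma bdB0 : bdB (fun=> 0) 0.
Proof.
have : exists c, bdB (fun=> 1) c.
  apply: inB_bdB; split; last exact: (var_one hvar).
  by apply/L1_toCP/(@rintegrable_bounded _ _ _ _ 1); split => // x; rewrite normr1.
by move=> [c /(bdBZ 0)]; rewrite normr0 !mul0r.
Qed.

Lemma bdB1 : exists c, bdB (fun=> 1) c.
Proof.
apply: inB_bdB; split; last exact: (var_one hvar).
by apply/L1_toCP/(@rintegrable_bounded _ _ _ _ 1); split => // x; rewrite normr1.
Qed.

(** The functions [psi] by which one may multiply, with a bound on the
    norm of the multiplication operator. *)
Definition multiplier (q : R) psi : Prop :=
  [/\ 0 <= q, (exists b, bounded_mfun b psi) &
      forall f c, bdB f c -> bdB (fun x => f x * psi x) (q * c)].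

Lemma normoo_le b psi : bounded_mfun b psi -> (normoo m (toC psi) <= b%:E)%E.
Proof.
move=> [mpsi bpsi]; rewrite /normoo unlock /Lnorm; case: ifP => _; last first.
  by rewrite lee_fin (le_trans _ (bpsi point)).
apply/ess_supP; apply: nearW => x /=.
by rewrite lee_fin expr0n addr0 sqrtr_sqr normr_id.
Qed.

Lemma Loo_toC b psi : bounded_mfun b psi -> Loo m (toC psi).
Proof.
move=> bpsi; split; last exact: le_lt_trans (normoo_le bpsi) (ltry _).
by split => /=; [exact: bpsi.1|exact: measurable_cst].
Qed.

(** The product rule for the variation bounds [var (f * psi)] through the
    sup norm of [f]; the embedding into bounded functions turns that sup norm
    back into the norm of [f]. *)
Lemma multiplier_of_var : exists2 C : R, 1 <= C & forall b v psi,
  bounded_mfun b psi -> (var (toC psi) <= v%:E)%E -> 0 <= v ->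
  multiplier (b + C * v) psi.
Proof.
have [C C1 hC] := var_sup hvar; exists C => // b v psi bpsi vpsi v0.
have b0 := bounded_mfun_ge0 bpsi.
have C0 : 0 <= C by exact: le_trans C1.
split; [by rewrite addr_ge0// mulr_ge0|by exists b|].
move=> f c bf; have [fi fc] := bf; have c0 := bdB_ge0 bf.
have fpi := rintegrableM fi bpsi.
have E : toC (fun x => f x * psi x) = (fun x => toC f x * toC psi x).
  by apply/funext => x; rewrite /toC rmorphM.
have Lf : L1 m (toC f) by exact/L1_toCP.
have Lp : L1 m (toC psi) by exact/L1_toCP/(rintegrable_bounded m bpsi).
split => //.
set fp := toC (fun x => f x * psi x) in E *.
have n1 : (norm1 m fp <= b%:E * norm1 m (toC f))%E.
  rewrite /fp !norm1_toC -ge0_integralZl//; last first.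
    by apply/measurable_EFinP/measurableT_comp => //; exact: rintegrable_measurable fi.
  apply: ge0_le_integral => //.
  - by apply/measurable_EFinP/measurableT_comp => //; exact: rintegrable_measurable fpi.
  - apply: emeasurable_funM; first exact: measurable_cst.
    by apply/measurable_EFinP/measurableT_comp => //; exact: rintegrable_measurable fi.
  - by move=> x _; rewrite -EFinM lee_fin normrM mulrC ler_wpM2r// bpsi.2.
have n2 : (var fp <=
    (C * c)%:E * v%:E + b%:E * var (toC f))%E.
  rewrite E; apply: le_trans (var_mul hvar Lf Lp _) _; first by rewrite -E /fp; exact/L1_toCP.
  apply: leeD; last by apply: lee_wpmul2r; [exact: bdB_var_ge0|exact: normoo_le].
  apply: lee_pmul => //; [exact: Lnorm_ge0|exact/bdB_var_ge0/L1_toCP|].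
  by apply: le_trans (hC _ Lf) _; rewrite EFinM lee_wpmul2l// lee_fin.
apply: le_trans (leeD n1 n2) _.
rewrite addeCA -ge0_muleDr ?norm1_ge0 ?bdB_var_ge0//.
rewrite mulrDl EFinD [leRHS]addeC; apply: leeD; last by rewrite EFinM lee_wpmul2l ?lee_fin.
by rewrite -EFinM lee_fin mulrAC.
Qed.

End bounded_variation.

(** * Transfer operators on real functions *)

Section real_transfer.
Context (R : realType) dX (X : measurableType dX) (m : probability X R).
Implicit Types (f g h psi : X -> R) (T : X -> X).
Local Notation normc := ComplexField.Normc.normc.

(** Duality with composition by [T] determines [A f] up to a null set only,
    so all algebraic rules for [A] below hold almost everywhere. *)
Definition rtransfer T (A : (X -> R) -> X -> R) : Prop :=
  measurable_fun setT T /\ forall f, rintegrable m f -> rintegrable m (A f) /\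
    forall b psi, bounded_mfun b psi ->
      \int[m]_x (A f x * psi x) = \int[m]_x (f x * psi (T x)).

Section theory.
Context (T : X -> X) (A : (X -> R) -> X -> R) (hA : rtransfer T A).

Let pairing_ae f g : rintegrable m f -> measurable_fun setT g ->
  {ae m, forall x, f x = g x} ->
  forall b psi, bounded_mfun b psi ->
   \int[m]_x (f x * psi x) = \int[m]_x (g x * psi x).
Proof.
move=> fi mg fg b psi bpsi; apply: ae_eq_Rintegral; first exact: rintegrableM bpsi.
  by apply: measurable_funM => //; exact: bpsi.1.
by apply: filterS fg => x ->.
Qed.

Lemma rtransfer_int f : rintegrable m f -> rintegrable m (A f).
Proof. by move=> fi; exact: (hA.2 _ fi).1. Qed.

Lemma rtransfer_dual f b psi : rintegrable m f -> bounded_mfun b psi ->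
  \int[m]_x (A f x * psi x) = \int[m]_x (f x * psi (T x)).
Proof. by move=> fi; exact: (hA.2 _ fi).2. Qed.

Lemma rtransfer_ae f g : rintegrable m f -> rintegrable m g ->
  {ae m, forall x, f x = g x} -> {ae m, forall x, A f x = A g x}.
Proof.
move=> fi gi fg; apply: ae_eq_of_pairing; [exact: rtransfer_int fi|exact: (hA.2 _ gi).1|].
move=> b psi bpsi; rewrite (rtransfer_dual fi bpsi) (rtransfer_dual gi bpsi).
apply: (pairing_ae fi (rintegrable_measurable gi) fg).
exact: (bounded_mfun_comp hA.1 bpsi).
Qed.

Lemma rtransferD f g : rintegrable m f -> rintegrable m g ->
  {ae m, forall x, A (fun y => f y + g y) x = A f x + A g x}.
Proof.
move=> fi gi; have fgi := rintegrableD fi gi.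
apply: ae_eq_of_pairing; first exact: rtransfer_int fgi.
  by apply: rintegrableD; [exact: rtransfer_int fi|exact: rtransfer_int gi].
move=> b psi bpsi; have bT := bounded_mfun_comp hA.1 bpsi.
rewrite (Rintegral_mulDl (rtransfer_int fi) (rtransfer_int gi) bpsi).
rewrite (rtransfer_dual fgi bpsi) (rtransfer_dual fi bpsi) (rtransfer_dual gi bpsi).
exact: Rintegral_mulDl fi gi bT.
Qed.

Lemma rtransferZ c f : rintegrable m f ->
  {ae m, forall x, A (fun y => c * f y) x = c * A f x}.
Proof.
move=> fi; have cfi := rintegrableZ c fi.
apply: ae_eq_of_pairing; first exact: rtransfer_int cfi.
  by apply: rintegrableZ; exact: rtransfer_int fi.
move=> b psi bpsi; have bT := bounded_mfun_comp hA.1 bpsi.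
rewrite (Rintegral_mulZl _ (rtransfer_int fi) bpsi).
rewrite (rtransfer_dual cfi bpsi) (rtransfer_dual fi bpsi).
exact: Rintegral_mulZl fi bT.
Qed.

Lemma rtransfer_mean f : rintegrable m f -> \int[m]_x A f x = \int[m]_x f x.
Proof.
move=> fi; have := rtransfer_dual fi (bounded_mfun_cst X 1).
by under eq_Rintegral do rewrite mulr1; under [RHS]eq_Rintegral do rewrite mulr1.
Qed.

End theory.

(** The transfer operator acts on complex functions; its real part is a
    transfer operator for real functions and carries the same information. *)
Definition real_part_op (L : (X -> R[i]) -> X -> R[i]) (f : X -> R) : X -> R :=
  fun x => complex.Re (L (toC f) x).

Lemma measurable_normc (f : X -> R[i]) :
  cmeasurable f -> measurable_fun setT (fun x => normc (f x)).
Proof.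
move=> [mRe mIm].
have -> : (fun x => normc (f x)) =
    (fun x => Num.sqrt ((complex.Re (f x)) ^+ 2 + (complex.Im (f x)) ^+ 2)).
  by apply/funext => x; case: (f x).
apply: (measurableT_comp (f := @Num.sqrt R)).
  by apply: continuous_measurable_fun; exact: sqrt_continuous.
by apply: measurable_funD; apply: measurable_funX.
Qed.

Lemma L1_Re (f : X -> R[i]) : L1 m f ->
  rintegrable m (fun x => complex.Re (f x)) /\
  rintegrable m (fun x => complex.Im (f x)).
Proof.
move=> [cf f1]; have [mRe mIm] := cf.
have mn := measurable_normc cf.
have ni : m.-integrable setT (fun x => (normc (f x))%:E).
  apply/integrableP; split; first exact/measurable_EFinP.
  by move: f1; rewrite /norm1 Lnorm1.
split; apply: le_integrable ni => //; try exact/measurable_EFinP.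
- move=> x _ /=; rewrite lee_fin; case: (f x) => a b /=.
  rewrite [leRHS]ger0_norm ?sqrtr_ge0// -sqrtr_sqr ler_wsqrtr// lerDl sqr_ge0//.
- move=> x _ /=; rewrite lee_fin; case: (f x) => a b /=.
  rewrite [leRHS]ger0_norm ?sqrtr_ge0// -sqrtr_sqr ler_wsqrtr// lerDr sqr_ge0//.
Qed.

Section real_part.
Context (T : X -> X) (L : (X -> R[i]) -> X -> R[i]).
Hypotheses (hT : nonsingular m T) (hL : is_transfer m T L).

Let pairing phi b psi : L1 m phi -> bounded_mfun b psi ->
  \int[m]_x (complex.Re (L phi x) * psi x) =
    \int[m]_x (complex.Re (phi x) * psi (T x)) /\
  \int[m]_x (complex.Im (L phi x) * psi x) =
    \int[m]_x (complex.Im (phi x) * psi (T x)).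
Proof.
move=> phi1 bpsi; have := (hL phi1).2 _ (Loo_toC m bpsi); rewrite /cintegral.
have E1 (z : R[i]) (a : R) : complex.Re (z * a%:C) = complex.Re z * a.
  by case: z => u w /=; rewrite mulr0 subr0.
have E2 (z : R[i]) (a : R) : complex.Im (z * a%:C) = complex.Im z * a.
  by case: z => u w /=; rewrite mulr0 add0r.
move=> [H1 H2]; split.
- rewrite (eq_Rintegral _ (g := fun x => complex.Re (L phi x * toC psi x))).
    by rewrite H1; apply: eq_Rintegral => x _; rewrite E1.
  by move=> x _; rewrite E1.
- rewrite (eq_Rintegral _ (g := fun x => complex.Im (L phi x * toC psi x))).
    by rewrite H2; apply: eq_Rintegral => x _; rewrite E2.
  by move=> x _; rewrite E2.
Qed.

Lemma real_part_transfer : rtransfer T (real_part_op L).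
Proof.
split; first exact: hT.1.
move=> f fi; have f1 : L1 m (toC f) by exact/L1_toCP.
split; first exact: (L1_Re (hL f1).1).1.
by move=> b psi bpsi; exact: (pairing f1 bpsi).1.
Qed.

(** Representatives matter here: [L] is defined on functions, and the duality
    alone has to show that it respects equality almost everywhere. *)
Lemma transfer_ae phi1 phi2 : L1 m phi1 -> L1 m phi2 ->
  {ae m, forall x, phi1 x = phi2 x} -> {ae m, forall x, L phi1 x = L phi2 x}.
Proof.
move=> h1 h2 h12.
have [r1 i1] := L1_Re (hL h1).1; have [r2 i2] := L1_Re (hL h2).1.
have [r1' i1'] := L1_Re h1; have [r2' i2'] := L1_Re h2.
have hR : {ae m, forall x, complex.Re (L phi1 x) = complex.Re (L phi2 x)}.
  apply: ae_eq_of_pairing => // b psi bpsi.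
  rewrite (pairing h1 bpsi).1 (pairing h2 bpsi).1.
  have bT := bounded_mfun_comp hT.1 bpsi.
  apply: ae_eq_Rintegral; first exact: rintegrableM r1' bT.
    by apply: measurable_funM; [exact: h2.1.1|exact: bT.1].
  by apply: filterS h12 => x ->.
have hI : {ae m, forall x, complex.Im (L phi1 x) = complex.Im (L phi2 x)}.
  apply: ae_eq_of_pairing => // b psi bpsi.
  rewrite (pairing h1 bpsi).2 (pairing h2 bpsi).2.
  have bT := bounded_mfun_comp hT.1 bpsi.
  apply: ae_eq_Rintegral; first exact: rintegrableM i1' bT.
    by apply: measurable_funM; [exact: h2.1.2|exact: bT.1].
  by apply: filterS h12 => x ->.
apply: filterS2 hR hI => x.
by case: (L phi1 x) => a b; case: (L phi2 x) => a' b' /= -> ->.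
Qed.

Lemma transfer_real f : rintegrable m f ->
  {ae m, forall x, toC (real_part_op L f) x = L (toC f) x}.
Proof.
move=> fi; have f1 : L1 m (toC f) by exact/L1_toCP.
have hI : {ae m, forall x, complex.Im (L (toC f) x) = 0}.
  apply: ae_eq_of_pairing; first exact: (L1_Re (hL f1).1).2.
    exact: (rintegrable_bounded m (bounded_mfun_cst X 0)).
  move=> b psi bpsi; rewrite (pairing f1 bpsi).2.
  by apply: eq_Rintegral => x _ /=; rewrite !mul0r.
apply: filterS hI => x; rewrite /toC /real_part_op.
by case: (L _ x) => a b /= ->.
Qed.

End real_part.
End real_transfer.

(** * Sequential systems with a spectral gap *)

Section orbit_op.
Context (R : realType) (X : Type) (A : nat -> (X -> R) -> X -> R).

Fixpoint orbit_op n j f := if n is k.+1 then orbit_op k j.+1 (A j f) else f.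

End orbit_op.

Lemma orbit_op_int (R : realType) dX (X : measurableType dX) (m : probability X R)
    (T : nat -> X -> X) (A : nat -> (X -> R) -> X -> R) n j f :
  (forall j, rtransfer m (T j) (A j)) ->
  rintegrable m f -> rintegrable m (orbit_op A n j f).
Proof.
move=> hA; elim: n j f => //= n IH j f fi; apply: IH.
exact: (rtransfer_int (hA j) fi).
Qed.

(** The time-dependent transfer operators [A j] along one orbit of the base;
    [K'] and [rho] quantify the contraction on mean-zero functions, and [K] the
    norm of a single step. *)
Record spectral_gap (R : realType) dX (X : measurableType dX)
    (m : probability X R) (var : (X -> R[i]) -> \bar R)
    (T : nat -> X -> X) (A : nat -> (X -> R) -> X -> R) (K' rho K : R) : Prop :=
  SpectralGap {
  gap_transfer : forall j, rtransfer m (T j) (A j);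
  gap_cst : 0 <= K';
  gap_rho0 : 0 < rho;
  gap_rho1 : rho < 1;
  gap_bound0 : 0 <= K;
  gap_decay : forall n j f c, bdB m var f c -> \int[m]_x f x = 0 ->
    bdB m var (orbit_op A n j f) (K' * rho ^+ n * c);
  gap_bound : forall j f c, bdB m var f c -> bdB m var (A j f) (K * c)
}.

Record equivariant_density (R : realType) dX (X : measurableType dX)
    (m : probability X R) (var : (X -> R[i]) -> \bar R)
    (A : nat -> (X -> R) -> X -> R) (v : nat -> X -> R) : Prop :=
  EquivariantDensity {
  density_bd : exists c, bdB m var (v 0) c;
  density_int : forall j, rintegrable m (v j);
  density_step : forall j, {ae m, forall x, v j.+1 x = A j (v j) x};
  density_mass : \int[m]_x v 0 x = 1
}.

Section sequential.
Context (R : realType) dX (X : measurableType dX) (m : probability X R).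
Context (d : nat) (var : (X -> R[i]) -> \bar R) (hvar : is_variation m d var).
Implicit Types (f g h psi : X -> R).
Local Notation bdB := (bdB m var).

Context (T : nat -> X -> X) (A : nat -> (X -> R) -> X -> R) (K' rho K : R).
Hypothesis gap : spectral_gap m var T A K' rho K.
Local Notation orbit_op := (orbit_op A).
Let hA := gap_transfer gap.
Let K'0 := gap_cst gap.
Let rho0 := gap_rho0 gap.
Let rho1 := gap_rho1 gap.
Let K0 := gap_bound0 gap.
Let decay := gap_decay gap.
Let bdA := gap_bound gap.

Lemma orbit_op_ae n j f g : rintegrable m f -> rintegrable m g ->
  {ae m, forall x, f x = g x} ->
  {ae m, forall x, orbit_op n j f x = orbit_op n j g x}.
Proof.
elim: n j f g => //= n IH j f g fi gi fg.
apply: IH; [exact: (rtransfer_int (hA j) fi)|exact: (rtransfer_int (hA j) gi)|].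
exact: (rtransfer_ae (hA j)).
Qed.

Lemma orbit_opD n j f g : rintegrable m f -> rintegrable m g ->
  {ae m, forall x, orbit_op n j (fun y => f y + g y) x =
     orbit_op n j f x + orbit_op n j g x}.
Proof.
elim: n j f g => [|n IH] j f g fi gi /=; first exact: nearW.
have afi := rtransfer_int (hA j) fi; have agi := rtransfer_int (hA j) gi.
have H := orbit_op_ae n j.+1 (rtransfer_int (hA j) (rintegrableD fi gi))
  (rintegrableD afi agi) (rtransferD (hA j) fi gi).
by apply: filterS2 H (IH j.+1 _ _ afi agi) => x ->.
Qed.

(** The induction carries the bound on all future images of $u_j$ rather than
    on $u_j$ alone: these contract by the factor [rho] at each step, although a
    single [A j] need not contract. The steps may assume the bound that is being
    proved, which allows forcing terms that depend on $u_j$. *)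
Lemma forced_decay (u r : nat -> X -> R) a b :
  let C := K' * (a + b / (1 - rho)) in
  0 <= b -> bdB (u 0) a -> \int[m]_x u 0 x = 0 ->
  (forall j, bdB (u j) C -> [/\ bdB (r j) b, \int[m]_x r j x = 0,
     rintegrable m (u j.+1) &
     {ae m, forall x, u j.+1 x = A j (u j) x + r j x}]) ->
  forall j, bdB (u j) C.
Proof.
move=> C b0 u0 mu0 step.
have r1 : 0 < 1 - rho by rewrite subr_gt0.
suff H : forall j n, bdB (orbit_op n j (u j)) (rho ^+ n * C).
  by move=> j; have := H j 0; rewrite /= expr0 mul1r.
elim=> [|j IH] n.
  apply: (bdB_le _ (decay n 0 u0 mu0)).
  have -> : K' * rho ^+ n * a = rho ^+ n * (K' * a) by ring.
  rewrite ler_wpM2l ?exprn_ge0 ?(ltW rho0)// /C ler_wpM2l//.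
  by rewrite lerDl divr_ge0// ltW.
have uj : bdB (u j) C by have := IH 0; rewrite /= expr0 mul1r.
have [br mr ui ue] := step j uj.
have aui := rtransfer_int (hA j) uj.1.
have ae1 := orbit_op_ae n j.+1 ui (rintegrableD aui br.1) ue.
have ae2 := orbit_opD n j.+1 aui br.1.
have bn : bdB (fun x => orbit_op n j.+1 (A j (u j)) x + orbit_op n j.+1 (r j) x)
    (rho ^+ n.+1 * C + K' * rho ^+ n * b).
  exact: (bdBD hvar (IH n.+1) (decay n j.+1 br mr)).
apply: (bdB_ae hvar (f := fun x => orbit_op n j.+1 (A j (u j)) x + orbit_op n j.+1 (r j) x)).
- exact: rintegrable_measurable (orbit_op_int n j.+1 hA ui).
- by apply: filterS2 ae1 ae2 => x -> ->.
apply: bdB_le bn.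
have -> : rho ^+ n.+1 * C + K' * rho ^+ n * b = rho ^+ n * (rho * C + K' * b).
  by rewrite exprS; ring.
rewrite ler_wpM2l ?exprn_ge0 ?(ltW rho0)// /C.
have -> : rho * (K' * (a + b / (1 - rho))) + K' * b = K' * (rho * a + b / (1 - rho)).
  by field; rewrite gt_eqF.
rewrite ler_wpM2l// lerD2r; apply: ler_piMl; last exact: ltW.
exact: (bdB_ge0 hvar u0).
Qed.

Lemma forced_decay0 (u r : nat -> X -> R) b :
  let C := K' * (b / (1 - rho)) in
  0 <= b -> u 0 = (fun=> 0) ->
  (forall j, bdB (u j) C -> [/\ bdB (r j) b, \int[m]_x r j x = 0,
     rintegrable m (u j.+1) &
     {ae m, forall x, u j.+1 x = A j (u j) x + r j x}]) ->
  forall j, bdB (u j) C.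
Proof.
move=> C b0 u0 step.
have E : C = K' * (0 + b / (1 - rho)) by rewrite add0r.
rewrite E; apply: (forced_decay (r := r)) => //.
- by rewrite u0; exact: bdB0 hvar.
- by rewrite u0 /Rintegral integral0.
- by rewrite -E.
Qed.

Context (v : nat -> X -> R) (dens : equivariant_density m var A v).
Let v0B := density_bd dens.
Let v_int := density_int dens.
Let v_step := density_step dens.
Let v_mass := density_mass dens.

(** Compare with the orbit of the constant function 1: the difference is forced
    by $A_j 1 - 1$, which has mean zero and bounded norm, and it starts from
    $v_0 - 1$, which has finite norm. *)
Lemma density_bounded : exists2 V, 1 <= V & forall j, bdB (v j) V.
Proof.
have [c1 b1] := bdB1 hvar.
have [c bv] := v0B.
pose u j := fun x => v j x - 1; pose r j := fun x => A j (fun=> 1) x - 1.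
have ri j : bdB (r j) (K * c1 + c1) by exact: (bdBB hvar (bdA j b1) b1).
pose C := K' * ((c + c1) + (K * c1 + c1) / (1 - rho)).
have ui j : rintegrable m (u j).
  by have := rintegrableD (v_int j) (rintegrableZ (-1) (rintegrable1 m)); under eq_fun do rewrite mulr1.
have B j : bdB (u j) C.
  apply: (forced_decay (r := r)) => //.
  - exact: (bdB_ge0 hvar (ri 0%N)).
  - exact: (bdBB hvar bv b1).
  - by rewrite /u RintegralB//; [rewrite v_mass (Rintegral1 m 1) subrr|exact: v_int|exact: (rintegrable1 m)].
  - move=> k bk; split; [exact: ri| |exact: ui|].
      rewrite RintegralB//; [|exact: (rtransfer_int (hA k) (rintegrable1 m))|exact: (rintegrable1 m)].
      by rewrite (rtransfer_mean (hA k)) ?subrr//; exact: (rintegrable1 m).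
    have H := rtransferD (hA k) (ui k) (rintegrable1 m).
    have H2 : {ae m, forall x, A k (fun y => u k y + 1) x = A k (v k) x}.
      apply: (rtransfer_ae (hA k)) => //; first exact: rintegrableD (ui k) (rintegrable1 m).
      by apply: nearW => x; rewrite /u subrK.
    apply: filterS3 H H2 (v_step k) => x h1 h2 h3.
    by rewrite {1}/u h3 -h2 h1 /r addrA.
exists (1 + (C + c1)).
  by rewrite lerDl addr_ge0//; [exact: (bdB_ge0 hvar (B 0%N))|exact: (bdB_ge0 hvar b1)].
move=> j; apply: (bdB_le (c := C + c1)); first by rewrite lerDr.
apply: (bdB_ae hvar _ _ (bdBD hvar (B j) b1)).
  exact: rintegrable_measurable (v_int j).
by apply: nearW => x; rewrite /u subrK.
Qed.

End sequential.

(** * Cumulants of Birkhoff sums along an orbit *)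

Lemma ln_1D_approx (R : realType) (x : R) : `|x| <= 2^-1 ->
  `|ln (1 + x) - x| <= 2 * x ^+ 2.
Proof.
rewrite ler_norml => /andP[x1 x2].
have p : 0 < 1 + x by lra.
have u : ln (1 + x) <= x by apply: le_ln1Dx; lra.
have l : - ln (1 + x) <= (1 + x)^-1 - 1.
  rewrite -lnV ?posrE//; set y := (1 + x)^-1.
  have y0 : 0 < y by rewrite invr_gt0.
  have -> : ln y = ln (1 + (y - 1)) by congr ln; ring.
  by apply: le_ln1Dx; lra.
have l2 : (1 + x)^-1 - 1 <= - x + 2 * x ^+ 2.
  have -> : (1 + x)^-1 - 1 = - x + (1 + x)^-1 * x ^+ 2 by field; rewrite gt_eqF.
  rewrite lerD2l ler_wpM2r ?sqr_ge0// -[leRHS]invrK lef_pV2 ?posrE ?invr_gt0//; lra.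
by rewrite ler_norml; apply/andP; split; [lra|]; have := sqr_ge0 x; lra.
Qed.

Section expansion.
Context (R : realType) dX (X : measurableType dX) (m : probability X R).
Context (d : nat) (var : (X -> R[i]) -> \bar R) (hvar : is_variation m d var).
Implicit Types (f g psi : X -> R) (t : R).
Local Notation bdB := (bdB m var).
Context (T : nat -> X -> X) (A : nat -> (X -> R) -> X -> R) (K' rho K : R).
Hypothesis gap : spectral_gap m var T A K' rho K.
Context (v : nat -> X -> R) (dens : equivariant_density m var A v).
Hypothesis v_ge0 : forall x, 0 <= v 0 x.
Let hA := gap_transfer gap.
Let v_int := density_int dens.

Fixpoint orbit_map j x := if j is k.+1 then T k (orbit_map k x) else x.

Lemma measurable_orbit j : measurable_fun setT (orbit_map j).
Proof.
elim: j => [|j IH] /=; first exact: measurable_id.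
exact: measurableT_comp (hA j).1 IH.
Qed.

(** The expectation under the initial measure, whose density is [v 0]. *)
Definition initial_mean psi := \int[m]_x (v 0 x * psi x).

Lemma density_pairing j b psi : bounded_mfun b psi ->
  \int[m]_x (v j x * psi x) = initial_mean (psi \o orbit_map j).
Proof.
elim: j psi => // j IH psi bpsi.
have bT := bounded_mfun_comp (hA j).1 bpsi.
have ai := rtransfer_int (hA j) (v_int j).
rewrite -[RHS](IH _ bT) -(rtransfer_dual (hA j) (v_int j) bpsi).
apply: ae_eq_Rintegral; first exact: rintegrableM (v_int j.+1) bpsi.
  by apply: measurable_funM; [exact: rintegrable_measurable ai|exact: bpsi.1].
by apply: filterS (density_step dens j) => x ->.
Qed.

Lemma initial_meanD b c f g : bounded_mfun b f -> bounded_mfun c g ->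
  initial_mean (fun x => f x + g x) = initial_mean f + initial_mean g.
Proof.
move=> bf bg; rewrite /initial_mean -RintegralD//; last 2 first.
- exact: rintegrableM (v_int 0) bf.
- exact: rintegrableM (v_int 0) bg.
by apply: eq_Rintegral => x _; rewrite mulrDr.
Qed.

Lemma initial_meanZ b c f : bounded_mfun b f -> initial_mean (fun x => c * f x) = c * initial_mean f.
Proof.
move=> bf; rewrite /initial_mean -RintegralZl//; last exact: rintegrableM (v_int 0) bf.
by apply: eq_Rintegral => x _; rewrite mulrCA.
Qed.

Context (phi : nat -> X -> R) (Q : R).
Hypothesis phi_bd : forall j, bounded_mfun Q (phi j).
Hypothesis phi_centered : forall j, \int[m]_x (v j x * phi j x) = 0.

Definition birkhoff_sum j x := \sum_(i < j) phi i (orbit_map i x).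

Lemma birkhoff_sumS j x : birkhoff_sum j.+1 x = birkhoff_sum j x + phi j (orbit_map j x).
Proof. by rewrite /birkhoff_sum big_ord_recr. Qed.

Lemma birkhoff_sum_bd j : bounded_mfun (j%:R * Q) (birkhoff_sum j).
Proof.
elim: j => [|j IH].
  split; first by rewrite (_ : birkhoff_sum 0 = cst 0) //; apply/funext => x; rewrite /birkhoff_sum big_ord0.
  by move=> x; rewrite /birkhoff_sum big_ord0 normr0 mul0r.
rewrite (_ : birkhoff_sum j.+1 = fun x => birkhoff_sum j x + (phi j \o orbit_map j) x); last first.
  by apply/funext => x; rewrite birkhoff_sumS.
rewrite -natr1 mulrDl mul1r; apply: bounded_mfunD => //.
exact: bounded_mfun_comp (measurable_orbit j) (phi_bd j).
Qed.

Lemma phi_orbit_bd j : bounded_mfun Q (phi j \o orbit_map j).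
Proof. exact: bounded_mfun_comp (measurable_orbit j) (phi_bd j). Qed.

Lemma initial_mean_birkhoff_sum j : initial_mean (birkhoff_sum j) = 0.
Proof.
elim: j => [|j IH].
  rewrite /initial_mean (eq_Rintegral _ (g := fun=> 0)); first by rewrite /Rintegral integral0.
  by move=> x _; rewrite /birkhoff_sum big_ord0 mulr0.
rewrite (_ : birkhoff_sum j.+1 = fun x => birkhoff_sum j x + (phi j \o orbit_map j) x); last first.
  by apply/funext => x; rewrite birkhoff_sumS.
rewrite (initial_meanD (birkhoff_sum_bd j) (phi_orbit_bd j)) IH add0r.
by rewrite -(density_pairing j (phi_bd j)).
Qed.

(** The linear response of the density to a tilt: the density of the signed
    measure $B \mapsto E[S_j 1_B(T^j)]$. *)
Fixpoint response j : X -> R :=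
  if j is k.+1 then A k (fun x => response k x + v k x * phi k x) else fun=> 0.

Lemma density_phi_int j : rintegrable m (fun x => v j x * phi j x).
Proof. exact: rintegrableM (v_int j) (phi_bd j). Qed.

Lemma response_int j : rintegrable m (response j).
Proof.
elim: j => [|j IH]; first exact: (rintegrable0 m).
by apply: (rtransfer_int (hA j)); apply: rintegrableD => //; exact: density_phi_int.
Qed.

Lemma response_pairing j b psi : bounded_mfun b psi ->
  \int[m]_x (response j x * psi x) = initial_mean (fun x => birkhoff_sum j x * psi (orbit_map j x)).
Proof.
elim: j psi => [|j IH] psi bpsi.
  rewrite /initial_mean; apply: eq_Rintegral => x _.
  by rewrite /birkhoff_sum big_ord0 !mul0r mulr0.
have bT := bounded_mfun_comp (hA j).1 bpsi.
rewrite (rtransfer_dual (hA j) (rintegrableD (response_int j) (density_phi_int j)) bpsi).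
rewrite (Rintegral_mulDl (response_int j) (density_phi_int j) bT) (IH _ bT).
have -> : \int[m]_x (v j x * phi j x * (psi \o T j) x) =
   \int[m]_x (v j x * (phi j x * (psi \o T j) x)).
  by apply: eq_Rintegral => x _; rewrite mulrA.
rewrite (density_pairing j (bounded_mfunM (phi_bd j) bT)).
have b1 := bounded_mfunM (birkhoff_sum_bd j) (bounded_mfun_comp (measurable_orbit j) bT).
have b2 := bounded_mfunM (phi_orbit_bd j) (bounded_mfun_comp (measurable_orbit j) bT).
rewrite -(initial_meanD b1 b2) /initial_mean; apply: eq_Rintegral => x _ /=.
by rewrite birkhoff_sumS mulrDl.
Qed.

(** The second moment grows by a variance and twice a covariance with the past;
    the latter is exactly what the linear response measures. *)
Lemma initial_mean_birkhoff_sum_sqr j : initial_mean (fun x => birkhoff_sum j.+1 x ^+ 2) =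
  initial_mean (fun x => birkhoff_sum j x ^+ 2) + 2 * \int[m]_x (response j x * phi j x)
   + \int[m]_x (v j x * phi j x ^+ 2).
Proof.
have b1 := bounded_mfunM (birkhoff_sum_bd j) (birkhoff_sum_bd j).
have b2 := bounded_mfunM (birkhoff_sum_bd j) (phi_orbit_bd j).
have b3 := bounded_mfunM (phi_bd j) (phi_bd j).
have b3' := bounded_mfunM (phi_orbit_bd j) (phi_orbit_bd j).
rewrite (response_pairing j (phi_bd j)).
have := density_pairing j b3; under eq_Rintegral do rewrite -expr2.
move=> ->; rewrite -(initial_meanZ _ b2).
have b2' := bounded_mfunZ 2 b2.
rewrite (_ : (fun x => birkhoff_sum j x ^+ 2) = (fun x => birkhoff_sum j x * birkhoff_sum j x))//.
rewrite -(initial_meanD b1 b2') -(initial_meanD (bounded_mfunD b1 b2') b3') /initial_mean.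
by apply: eq_Rintegral => x _ /=; rewrite birkhoff_sumS; ring.
Qed.

Definition mgf t j := initial_mean (fun x => expR (t * birkhoff_sum j x)).

Lemma mgf_gt0 t j : 0 < mgf t j.
Proof.
exact: weighted_expR_gt0 (v_int 0) v_ge0 (density_mass dens)
  (bounded_mfunZ t (birkhoff_sum_bd j)).
Qed.

(** The normalised density of the image, under $j$ steps, of the tilted measure
    $e^{t S_j} v_0 dm$. *)
Fixpoint tilted t j : X -> R :=
  if j is k.+1 then
    A k (fun x => mgf t k / mgf t k.+1 * (tilted t k x * expR (t * phi k x)))
  else v 0.

Lemma exp_phi_bd t j :
  bounded_mfun (expR (`|t| * Q)) (fun x => expR (t * phi j x)).
Proof. by apply: bounded_mfun_expR; apply: bounded_mfunZ. Qed.

Lemma tilted_int t j : rintegrable m (tilted t j).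
Proof.
elim: j => [|j IH]; first exact: v_int.
apply: (rtransfer_int (hA j)); apply: rintegrableZ.
exact: rintegrableM IH (exp_phi_bd t j).
Qed.

Lemma tilted_pairing t j b psi : bounded_mfun b psi ->
  \int[m]_x (tilted t j x * psi x) =
  (mgf t j)^-1 * initial_mean (fun x => expR (t * birkhoff_sum j x) * psi (orbit_map j x)).
Proof.
elim: j b psi => [|j IH] b psi bpsi.
  have -> : mgf t 0 = 1.
    rewrite -[RHS](density_mass dens) /mgf /initial_mean; apply: eq_Rintegral => x _.
    by rewrite /birkhoff_sum big_ord0 mulr0 expR0 mulr1.
  rewrite invr1 mul1r /initial_mean; apply: eq_Rintegral => x _.
  by rewrite /birkhoff_sum big_ord0 mulr0 expR0 mul1r.
have bT := bounded_mfun_comp (hA j).1 bpsi.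
have hi := rintegrableM (tilted_int t j) (exp_phi_bd t j).
have M0 := mgf_gt0 t j; have M1 := mgf_gt0 t j.+1.
rewrite (rtransfer_dual (hA j) (rintegrableZ _ hi) bpsi).
rewrite (Rintegral_mulZl _ hi bT).
have -> : \int[m]_x (tilted t j x * expR (t * phi j x) * (psi \o T j) x) =
   \int[m]_x (tilted t j x * (expR (t * phi j x) * (psi \o T j) x)).
  by apply: eq_Rintegral => x _; rewrite mulrA.
rewrite (IH _ _ (bounded_mfunM (exp_phi_bd t j) bT)) mulrA.
have -> : mgf t j / mgf t j.+1 / mgf t j = (mgf t j.+1)^-1.
  by field; rewrite !gt_eqF.
congr (_ * _); rewrite /initial_mean; apply: eq_Rintegral => x _ /=.
by rewrite birkhoff_sumS mulrDr expRD -!mulrA.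
Qed.

Lemma tilted_mean t j : \int[m]_x tilted t j x = 1.
Proof.
have := tilted_pairing t j (bounded_mfun_cst X 1).
under eq_Rintegral do rewrite mulr1; move=> ->.
rewrite (_ : initial_mean _ = mgf t j) ?mulVf ?gt_eqF ?mgf_gt0//.
by rewrite /mgf /initial_mean; apply: eq_Rintegral => x _; rewrite mulr1.
Qed.

Definition tilt_sub1 t j x := expR (t * phi j x) - 1.

(** The ratio of consecutive moment generating functions, minus one: it is
    computed from the tilted density at the current time. *)
Definition mgf_incr t j := \int[m]_x (tilted t j x * tilt_sub1 t j x).

Lemma tilt_sub1_bd t j : bounded_mfun (expR (`|t| * Q) + 1) (tilt_sub1 t j).
Proof.
have := bounded_mfunD (exp_phi_bd t j) (bounded_mfun_cst X (- 1)).
by rewrite normrN normr1.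
Qed.

Lemma mgfS t j : mgf t j.+1 = mgf t j * (1 + mgf_incr t j).
Proof.
have M0 := mgf_gt0 t j.
have -> : 1 + mgf_incr t j = \int[m]_x (tilted t j x * expR (t * phi j x)).
  rewrite -(tilted_mean t j) /mgf_incr -RintegralD//; last 2 first.
  - exact: tilted_int.
  - exact: rintegrableM (tilted_int t j) (tilt_sub1_bd t j).
  by apply: eq_Rintegral => x _; rewrite /tilt_sub1; ring.
rewrite (tilted_pairing t j (exp_phi_bd t j)) mulrA divff ?gt_eqF// mul1r.
rewrite /mgf /initial_mean; apply: eq_Rintegral => x _.
by rewrite birkhoff_sumS mulrDr expRD.
Qed.

Lemma mgf_incr_gtN1 t j : 0 < 1 + mgf_incr t j.
Proof.
have := mgf_gt0 t j.+1; rewrite mgfS pmulr_rgt0//; exact: mgf_gt0.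
Qed.

Context (V : R) (V1 : 1 <= V) (v_bd : forall j, bdB (v j) V).
Hypothesis phi_mul : forall j, multiplier m var Q (phi j).
Hypothesis tilt_sub1_mul : forall t j, `|t| <= 1 -> multiplier m var (Q * `|t|) (tilt_sub1 t j).
Hypothesis tilt_sub2_mul : forall t j, `|t| <= 1 ->
  multiplier m var (Q * t ^+ 2) (fun x => tilt_sub1 t j x - t * phi j x).
Hypothesis tilt_sub1_le : forall t j, `|t| <= 1 -> bounded_mfun (Q * `|t|) (tilt_sub1 t j).
Hypothesis tilt_sub2_le : forall t j, `|t| <= 1 ->
  bounded_mfun (Q * t ^+ 2) (fun x => tilt_sub1 t j x - t * phi j x).
Hypothesis tilt_sub3_le : forall t j, `|t| <= 1 -> bounded_mfun (Q * `|t| ^+ 3)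
  (fun x => tilt_sub1 t j x - t * phi j x - t ^+ 2 / 2 * phi j x ^+ 2).

Let Q0 : 0 <= Q. Proof. by case: (phi_mul 0). Qed.
Let V0 : 0 <= V. Proof. exact: le_trans V1. Qed.
Let K'0 := gap_cst gap.
Let K0 := gap_bound0 gap.
Let rho1 : 0 < 1 - rho. Proof. by rewrite subr_gt0; exact: gap_rho1 gap. Qed.

(* For [t] below [t0]: [W] bounds the tilted densities, [B1 * `|t|] one transported
   kick, [D * `|t|] the shift accumulated from the kicks as a geometric series, and
   [G * t ^+ 2] the increment of the moment generating function. The second-order
   analogues of [B1] and [D], for the part of the shift beyond its linear
   response, are [B2] and [D2]. *)
Let W := V + 1.
Let B1 := K * (2 * (Q * W + Q * W * W)).
Let D := K' * (B1 / (1 - rho)).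
Let G := Q * V + Q * D.
Let B2 := K * (2 * (Q * V + Q * D + G * W + G * Q * V)).
Let D2 := K' * (B2 / (1 - rho)).
Let t0 := (2 * (1 + Q * W + D))^-1.

Let W0 : 0 <= W. Proof. by rewrite addr_ge0. Qed.
Let B10 : 0 <= B1. Proof. by rewrite !mulr_ge0// addr_ge0// !mulr_ge0. Qed.
Let D0 : 0 <= D. Proof. by rewrite mulr_ge0// divr_ge0// ltW. Qed.
Let G0 : 0 <= G. Proof. by rewrite addr_ge0// mulr_ge0. Qed.
Let B20 : 0 <= B2. Proof. by rewrite /B2; nonneg. Qed.
Let D20 : 0 <= D2. Proof. by rewrite mulr_ge0// divr_ge0// ltW. Qed.
Let QW0 : 0 <= Q * W. Proof. by rewrite mulr_ge0. Qed.
Let t0_gt0 : 0 < t0.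
Proof. by rewrite invr_gt0 mulr_gt0// -addrA ltr_wpDr// addr_ge0. Qed.

Lemma t0_le t : `|t| <= t0 ->
  [/\ `|t| <= 1, Q * W * `|t| <= 2^-1 & D * `|t| <= 1].
Proof.
set z := 1 + Q * W + D; have z0 : 0 < z by rewrite /z -addrA ltr_wpDr// addr_ge0.
have Ht : t0 * z = 2^-1 by rewrite /t0 -/z; field; rewrite gt_eqF.
move=> tt0; have H : `|t| * z <= 2^-1 by rewrite -Ht ler_wpM2r// ltW.
have n0 := normr_ge0 t; have q0 : 0 <= `|t| * (Q * W) by rewrite mulr_ge0.
have d0 : 0 <= `|t| * D by rewrite mulr_ge0.
have {}H : `|t| + `|t| * (Q * W) + `|t| * D <= 2^-1.
  by rewrite (_ : _ + _ = `|t| * z)// /z; ring.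
rewrite (mulrC (Q * W)) (mulrC D).
move: (`|t| * (Q * W)) (`|t| * D) q0 d0 H => p q q0 d0 H.
by split; lra.
Qed.

Definition density_shift t j x := tilted t j x - v j x.

Lemma density_shift_int t j : rintegrable m (density_shift t j).
Proof.
have := rintegrableD (tilted_int t j) (rintegrableZ (-1) (v_int j)).
by under eq_fun do rewrite mulN1r.
Qed.

(** What one tilt and renormalisation add to the density, before it is
    transported by the next transfer operator. *)
Definition kick t j x :=
  (1 + mgf_incr t j)^-1 * (tilted t j x * tilt_sub1 t j x - mgf_incr t j * tilted t j x).

Lemma kick_int t j : rintegrable m (kick t j).
Proof.
apply: rintegrableZ.
have := rintegrableD (rintegrableM (tilted_int t j) (tilt_sub1_bd t j))
  (rintegrableZ (- mgf_incr t j) (tilted_int t j)).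
by under eq_fun do rewrite mulNr.
Qed.

Lemma kick_mean t j : \int[m]_x kick t j x = 0.
Proof.
have i1 := rintegrableM (tilted_int t j) (tilt_sub1_bd t j).
have i2 := rintegrableZ (mgf_incr t j) (tilted_int t j).
have i3 := rintegrableD i1 (rintegrableZ (-1) i2).
rewrite /kick RintegralZl//; last first.
  by move: i3; under eq_fun do rewrite mulN1r.
rewrite RintegralB// RintegralZl//; last exact: tilted_int.
by rewrite tilted_mean mulr1 subrr mulr0.
Qed.

(** Linearity almost everywhere turns the recursion for the tilted densities
    into transport of the previous shift plus transport of one kick. *)
Lemma density_shift_step t j : {ae m, forall x,
  density_shift t j.+1 x = A j (fun y => density_shift t j y + kick t j y) x}.
Proof.
have di := rintegrableD (density_shift_int t j) (kick_int t j).
have H1 := rtransferD (hA j) (v_int j) di.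
have H2 : {ae m, forall x, tilted t j.+1 x =
    A j (fun y => v j y + (density_shift t j y + kick t j y)) x}.
  apply: (rtransfer_ae (hA j)
    (f := fun x => mgf t j / mgf t j.+1 * (tilted t j x * expR (t * phi j x)))).
  - by apply: rintegrableZ; exact: rintegrableM (tilted_int t j) (exp_phi_bd t j).
  - exact: rintegrableD (v_int j) di.
  apply: nearW => x; rewrite mgfS /kick /density_shift /tilt_sub1.
  have e0 := mgf_incr_gtN1 t j; have M0 := mgf_gt0 t j.
  by field; rewrite !gt_eqF.
apply: filterS3 H1 H2 (density_step dens j) => x h1 h2 h3.
by rewrite {1}/density_shift h2 h1 h3 addrC addKr.
Qed.

Lemma mgf_incr_le_of_shift t j : `|t| <= t0 -> bdB (density_shift t j) 1 ->
  [/\ bdB (tilted t j) W, `|mgf_incr t j| <= Q * W * `|t| & `|mgf_incr t j| <= 2^-1].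
Proof.
move=> tt0 bd; have [t1 t2 _] := t0_le tt0.
have bh : bdB (tilted t j) W.
  apply: (bdB_ae hvar _ _ (bdBD hvar (v_bd j) bd)).
    exact: rintegrable_measurable (tilted_int t j).
  by apply: nearW => x; rewrite /density_shift addrC subrK.
have e1 : `|mgf_incr t j| <= Q * W * `|t|.
  by rewrite mulrAC; exact: (bdB_pairing hvar (tilt_sub1_le j t1) bh).
by split => //; exact: le_trans e1 t2.
Qed.

Let inv_mgf_incr t j : `|mgf_incr t j| <= 2^-1 -> `|(1 + mgf_incr t j)^-1| <= 2.
Proof.
rewrite ler_norml => /andP[e1 e2]; have p : 0 < 1 + mgf_incr t j by lra.
rewrite ger0_norm ?invr_ge0 ?(ltW p)//.
by rewrite -[leRHS]invrK lef_pV2 ?posrE ?invr_gt0//; lra.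
Qed.

(** Each kick has size $O(t)$ as long as the shift stays below 1, and the
    contraction keeps the accumulated shift of size $O(t)$; the choice of [t0]
    closes this bootstrap. *)
Lemma density_shift_bd t j : `|t| <= t0 -> bdB (density_shift t j) (D * `|t|).
Proof.
move=> tt0; have [t1 t2 t3] := t0_le tt0.
have E : D * `|t| = K' * ((B1 * `|t|) / (1 - rho)) by rewrite /D; ring.
rewrite E; apply: (forced_decay0 hvar gap (r := fun j => A j (kick t j))).
- by rewrite mulr_ge0.
- by apply/funext => x; rewrite /density_shift /= subrr.
move=> k; rewrite -E => bk.
have bk1 : bdB (density_shift t k) 1 by exact: bdB_le bk.
have [bh e1 e2] := mgf_incr_le_of_shift tt0 bk1.
have [_ _ mul] := tilt_sub1_mul k t1.
split.
- have := gap_bound gap k (bdBZ hvar (1 + mgf_incr t k)^-1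
    (bdBB hvar (mul _ _ bh) (bdBZ hvar (mgf_incr t k) bh))).
  apply: bdB_le; rewrite /B1 -[leRHS]mulrA ler_wpM2l// -[leRHS]mulrA.
  apply: ler_pM => //; [|exact: inv_mgf_incr|].
    by rewrite addr_ge0// !mulr_ge0.
  have -> : (Q * W + Q * W * W) * `|t| = Q * `|t| * W + Q * W * `|t| * W by ring.
  by rewrite lerD2l ler_wpM2r.
- by rewrite (rtransfer_mean (hA k) (kick_int t k)) kick_mean.
- exact: density_shift_int.
- apply: filterS2 (density_shift_step t k) (rtransferD (hA k) (density_shift_int t k) (kick_int t k)).
  by move=> x -> ->.
Qed.

Lemma density_shift_bd1 t j : `|t| <= t0 -> bdB (density_shift t j) 1.
Proof. by move=> tt0; have [_ _ t3] := t0_le tt0; exact: bdB_le t3 (density_shift_bd j tt0). Qed.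

Lemma mgf_incr_split t j : mgf_incr t j =
  \int[m]_x (v j x * tilt_sub1 t j x) + \int[m]_x (density_shift t j x * tilt_sub1 t j x).
Proof.
rewrite -(Rintegral_mulDl (v_int j) (density_shift_int t j) (tilt_sub1_bd t j)).
by apply: eq_Rintegral => x _; rewrite /density_shift addrC subrK.
Qed.

(** The first-order term vanishes because the observable is centred. *)
Lemma mgf_incr_le t j : `|t| <= t0 -> `|mgf_incr t j| <= G * t ^+ 2.
Proof.
move=> tt0; have [t1 t2 t3] := t0_le tt0.
rewrite mgf_incr_split.
have -> : \int[m]_x (v j x * tilt_sub1 t j x) = \int[m]_x (v j x * (tilt_sub1 t j x - t * phi j x)).
  have i1 := rintegrableM (v_int j) (tilt_sub2_le j t1).
  have i2 := rintegrableZ t (density_phi_int j).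
  have -> : \int[m]_x (v j x * tilt_sub1 t j x) =
     \int[m]_x (v j x * (tilt_sub1 t j x - t * phi j x) + t * (v j x * phi j x)).
    by apply: eq_Rintegral => x _; ring.
  by rewrite RintegralD// RintegralZl ?phi_centered ?mulr0 ?addr0//; exact: density_phi_int.
have p1 := bdB_pairing hvar (tilt_sub2_le j t1) (v_bd j).
have p2 := bdB_pairing hvar (tilt_sub1_le j t1) (density_shift_bd j tt0).
rewrite (le_trans (ler_normD _ _))//.
have -> : G * t ^+ 2 = Q * t ^+ 2 * V + Q * `|t| * (D * `|t|).
  by rewrite /G -(real_normK (num_real t)); ring.
exact: lerD.
Qed.

(** The shift of the density beyond its linear response. *)
Definition shift_rem t j x := density_shift t j x - t * response j x.

Lemma shift_rem_int t j : rintegrable m (shift_rem t j).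
Proof.
have := rintegrableD (density_shift_int t j) (rintegrableZ (- t) (response_int j)).
by under eq_fun do rewrite mulNr.
Qed.

Definition kick_rem t j x := kick t j x - t * (v j x * phi j x).

Lemma kick_rem_int t j : rintegrable m (kick_rem t j).
Proof.
have := rintegrableD (kick_int t j) (rintegrableZ (- t) (density_phi_int j)).
by under eq_fun do rewrite mulNr.
Qed.

Lemma kick_rem_bd t j : `|t| <= t0 ->
  bdB (kick_rem t j) (2 * (Q * V + Q * D + G * W + G * Q * V) * t ^+ 2).
Proof.
move=> tt0; have [t1 t2 t3] := t0_le tt0.
have [bh e1 e2] := mgf_incr_le_of_shift tt0 (density_shift_bd1 j tt0).
have e3 := mgf_incr_le j tt0.
have [_ _ mul0] := phi_mul j; have [_ _ mul1] := tilt_sub1_mul j t1.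
have [_ _ mul2] := tilt_sub2_mul j t1.
have b1 := mul2 _ _ (v_bd j).
have b2 := mul1 _ _ (density_shift_bd j tt0).
have b3 := bdBZ hvar (mgf_incr t j) bh.
have b4 := bdBZ hvar (mgf_incr t j * t) (mul0 _ _ (v_bd j)).
have := bdBZ hvar (1 + mgf_incr t j)^-1 (bdBB hvar (bdBD hvar b1 b2) (bdBD hvar b3 b4)).
move=> H; apply: (bdB_ae hvar _ _ (bdB_le _ H)).
- exact: rintegrable_measurable (kick_rem_int t j).
- apply: nearW => x; rewrite /kick_rem /kick /density_shift.
  have e0 := mgf_incr_gtN1 t j.
  by field; rewrite gt_eqF.
- rewrite -[leRHS]mulrA; apply: ler_pM => //; [|exact: inv_mgf_incr|].
    exact: (bdB_ge0 hvar (bdBB hvar (bdBD hvar b1 b2) (bdBD hvar b3 b4))).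
  have -> : (Q * V + Q * D + G * W + G * Q * V) * t ^+ 2 =
     Q * t ^+ 2 * V + Q * `|t| * (D * `|t|) + (G * t ^+ 2 * W + (G * t ^+ 2) * (Q * V)).
    by rewrite -(real_normK (num_real t)); ring.
  rewrite lerD2l; apply: lerD; first by rewrite ler_wpM2r.
  rewrite ler_wpM2r ?mulr_ge0// normrM; apply: le_trans e3.
  by rewrite ler_piMr.
Qed.

(** The response is driven by the first-order part of the kicks, so the remainder
    is driven by their second-order part. *)
Lemma shift_rem_bd t j : `|t| <= t0 -> bdB (shift_rem t j) (D2 * t ^+ 2).
Proof.
move=> tt0.
have E : D2 * t ^+ 2 = K' * ((B2 * t ^+ 2) / (1 - rho)) by rewrite /D2; ring.
rewrite E; apply: (forced_decay0 hvar gap (r := fun j => A j (kick_rem t j))).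
- by nonneg.
- by apply/funext => x; rewrite /shift_rem /density_shift /= subrr mulr0 subr0.
move=> k _; split.
- have := gap_bound gap k (kick_rem_bd k tt0); apply: bdB_le.
  by rewrite /B2 mulrA.
- rewrite (rtransfer_mean (hA k) (kick_rem_int t k)) /kick_rem RintegralB//; last 2 first.
  + exact: kick_int.
  + by apply: rintegrableZ; exact: density_phi_int.
  by rewrite kick_mean RintegralZl ?phi_centered ?mulr0 ?subr0//; exact: density_phi_int.
- exact: shift_rem_int.
have i1 := rintegrableD (response_int k) (density_phi_int k).
have i2 := rintegrableD (shift_rem_int t k) (kick_rem_int t k).
have H1 := rtransferD (hA k) (shift_rem_int t k) (kick_rem_int t k).
have H2 := rtransferZ (hA k) t i1.
have H3 := rtransferD (hA k) i2 (rintegrableZ t i1).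
have H4 : {ae m, forall x, A k (fun y => density_shift t k y + kick t k y) x =
   A k (fun y => (shift_rem t k y + kick_rem t k y) + t * (response k y + v k y * phi k y)) x}.
  apply: (rtransfer_ae (hA k)).
  - exact: rintegrableD (density_shift_int t k) (kick_int t k).
  - exact: rintegrableD i2 (rintegrableZ t i1).
  by apply: nearW => x; rewrite /shift_rem /kick_rem; ring.
have H5 := density_shift_step t k.
have H6 : {ae m, forall x, density_shift t k.+1 x =
    A k (fun y => shift_rem t k y + kick_rem t k y) x +
    A k (fun y => t * (response k y + v k y * phi k y)) x}.
  by apply: filterS3 H3 H4 H5 => x h3 h4 h5; rewrite h5 h4 h3.
apply: filterS3 H1 H2 H6 => x h1 h2 h6.
by rewrite {1}/shift_rem h6 h1 h2 /= addrK.
Qed.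

(** The contribution of one step to half the second moment. *)
Definition var_rate j :=
  2^-1 * \int[m]_x (v j x * phi j x ^+ 2) + \int[m]_x (response j x * phi j x).

(** Second-order expansion of the tilt on the equivariant density, and
    first-order expansion of the density times first-order tilt. *)
Lemma mgf_incr_expansion t j : `|t| <= t0 ->
  `|mgf_incr t j - t ^+ 2 * var_rate j| <= Q * (V + D + D2) * `|t| ^+ 3.
Proof.
move=> tt0; have [t1 t2 t3] := t0_le tt0.
have p1 := bdB_pairing hvar (tilt_sub3_le j t1) (v_bd j).
have p2 := bdB_pairing hvar (tilt_sub2_le j t1) (density_shift_bd j tt0).
have p3 := bdB_pairing hvar (phi_bd j) (shift_rem_bd j tt0).
set e1 := \int[m]_x _ in p1; set e2 := \int[m]_x _ in p2; set e3 := \int[m]_x _ in p3.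
have bphi2 := bounded_mfunM (phi_bd j) (phi_bd j).
have vphi2 : rintegrable m (fun x => v j x * phi j x ^+ 2) by exact: rintegrableM (v_int j) bphi2.
have I1 : \int[m]_x (v j x * tilt_sub1 t j x) = e1 + t ^+ 2 / 2 * \int[m]_x (v j x * phi j x ^+ 2).
  have -> : \int[m]_x (v j x * tilt_sub1 t j x) =
     \int[m]_x (v j x * (tilt_sub1 t j x - t * phi j x - t ^+ 2 / 2 * phi j x ^+ 2) +
       (t * (v j x * phi j x) + t ^+ 2 / 2 * (v j x * phi j x ^+ 2))).
    by apply: eq_Rintegral => x _; ring.
  rewrite RintegralD//; last 2 first.
  - exact: rintegrableM (v_int j) (tilt_sub3_le j t1).
  - by apply: rintegrableD; apply: rintegrableZ => //; exact: density_phi_int.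
  rewrite RintegralD//; last 2 first.
  - by apply: rintegrableZ; exact: density_phi_int.
  - exact: rintegrableZ.
  rewrite !RintegralZl//; last exact: density_phi_int.
  by rewrite phi_centered mulr0 add0r.
have dphi := rintegrableM (density_shift_int t j) (phi_bd j).
have I2 : \int[m]_x (density_shift t j x * tilt_sub1 t j x) = e2 + t * \int[m]_x (density_shift t j x * phi j x).
  rewrite -RintegralZl// -RintegralD//; last 2 first.
  - exact: rintegrableM (density_shift_int t j) (tilt_sub2_le j t1).
  - exact: rintegrableZ.
  by apply: eq_Rintegral => x _; ring.
have I3 : \int[m]_x (density_shift t j x * phi j x) = e3 + t * \int[m]_x (response j x * phi j x).
  have i4 := rintegrableM (response_int j) (phi_bd j).
  rewrite -RintegralZl// -RintegralD//; last 2 first.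
  - exact: rintegrableM (shift_rem_int t j) (phi_bd j).
  - exact: rintegrableZ.
  by apply: eq_Rintegral => x _; rewrite /shift_rem; ring.
rewrite mgf_incr_split I1 I2 I3 /var_rate.
set a := \int[m]_x _; set b := \int[m]_x _.
have -> : e1 + t ^+ 2 / 2 * a + (e2 + t * (e3 + t * b)) - t ^+ 2 * (2^-1 * a + b) =
  e1 + (e2 + t * e3) by field.
have -> : Q * (V + D + D2) * `|t| ^+ 3 =
   Q * `|t| ^+ 3 * V + (Q * t ^+ 2 * (D * `|t|) + `|t| * (Q * (D2 * t ^+ 2))).
  by rewrite -(real_normK (num_real t)); ring.
rewrite (le_trans (ler_normD _ _))// lerD// (le_trans (ler_normD _ _))// lerD//.
by rewrite normrM ler_wpM2l.
Qed.

(** The increments of the logarithm agree with those of half the second moment up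
    to $O(|t|^3)$ uniformly in time, so the error is linear in the number of
    steps. *)
Lemma ln_mgf_expansion_aux t j : `|t| <= t0 ->
  `|ln (mgf t j) - t ^+ 2 / 2 * initial_mean (fun x => birkhoff_sum j x ^+ 2)| <=
  j%:R * ((Q * (V + D + D2) + 2 * G ^+ 2) * `|t| ^+ 3).
Proof.
move=> tt0; have [t1 t2 t3] := t0_le tt0.
elim: j => [|j IH].
  have -> : mgf t 0 = 1.
    rewrite -[RHS](density_mass dens) /mgf /initial_mean; apply: eq_Rintegral => x _.
    by rewrite /birkhoff_sum big_ord0 mulr0 expR0 mulr1.
  have -> : initial_mean (fun x => birkhoff_sum 0 x ^+ 2) = 0.
    rewrite /initial_mean (eq_Rintegral _ (g := fun=> 0)); first by rewrite /Rintegral integral0.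
    by move=> x _; rewrite /birkhoff_sum big_ord0 expr0n mulr0.
  by rewrite ln1 mulr0 subr0 normr0 mul0r.
have e0 := mgf_incr_gtN1 t j; have M0 := mgf_gt0 t j.
have [bh e1 e2] := mgf_incr_le_of_shift tt0 (density_shift_bd1 j tt0).
have e3 := mgf_incr_le j tt0; have e4 := mgf_incr_expansion j tt0.
have e5 := ln_1D_approx e2.
have e6 : 2 * mgf_incr t j ^+ 2 <= 2 * G ^+ 2 * `|t| ^+ 3.
  rewrite -mulrA ler_wpM2l// -(real_normK (num_real (mgf_incr t j))).
  apply: (@le_trans _ _ ((G * t ^+ 2) ^+ 2)); first by rewrite ler_sqr ?nnegrE//; nonneg.
  rewrite exprMn ler_wpM2l ?sqr_ge0// -(real_normK (num_real t)) -exprM.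
  by rewrite [in leLHS](_ : (2 * 2 = 3.+1)%N)// exprS ler_piMl// exprn_ge0.
rewrite mgfS lnM ?posrE// initial_mean_birkhoff_sum_sqr.
rewrite (_ : j.+1%:R = j%:R + 1); last by rewrite natr1.
rewrite [leRHS]mulrDl mul1r.
set a := ln (mgf t j) in IH *; set b := initial_mean _ in IH *.
set c := \int[m]_x _; set f := \int[m]_x _; set N := _ * (_ * _) in IH *.
have -> : a + ln (1 + mgf_incr t j) - t ^+ 2 / 2 * (b + 2 * c + f) =
  (a - t ^+ 2 / 2 * b) + ((ln (1 + mgf_incr t j) - mgf_incr t j) + (mgf_incr t j - t ^+ 2 * var_rate j)).
  by rewrite /var_rate -/c -/f; field.
rewrite (le_trans (ler_normD _ _))// lerD// (le_trans (ler_normD _ _))//.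
by rewrite mulrDl addrC lerD// (le_trans e5).
Qed.

Lemma ln_mgf_expansion : exists t1 C : R, [/\ 0 < t1, 0 <= C &
  forall t j, `|t| <= t1 ->
    `|ln (mgf t j) - t ^+ 2 / 2 * initial_mean (fun x => birkhoff_sum j x ^+ 2)| <=
    j%:R * (C * `|t| ^+ 3)].
Proof.
exists t0, (Q * (V + D + D2) + 2 * G ^+ 2); split => //.
  by nonneg.
by move=> t j; exact: ln_mgf_expansion_aux.
Qed.

End expansion.

(** * Tilts as multipliers *)

Section taylor.
Context (R : realType).
Implicit Types (F f : R -> R) (x B r : R).

Lemma mean_value_bound F f x B : (forall u, is_derive u (1 : R) F (f u)) ->
  F 0 = 0 -> (forall u, `|u| <= `|x| -> `|f u| <= B) -> `|F x| <= B * `|x|.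
Proof.
move=> dF F0 fB.
have cF : continuous F.
  by move=> u; apply/differentiable_continuous/derivable1_diffP; have [] := dF u.
have [x0|x0] := leP 0 x.
- have [c] := MVT_segment x0 (fun u _ => dF u) (continuous_subspaceT cF).
  rewrite in_itv/= => /andP[c0 cx]; rewrite F0 !subr0 => ->.
  by rewrite normrM ler_wpM2r// fB// !ger0_norm.
- have [c] := MVT_segment (ltW x0) (fun u _ => dF u) (continuous_subspaceT cF).
  rewrite in_itv/= => /andP[cx c0]; rewrite F0 !sub0r => /eqP; rewrite eqr_oppLR => /eqP ->.
  by rewrite mulrN opprK normrM ler_wpM2r// fB// !ler0_norm// ?lerN2// ltW.
Qed.

Lemma expR_sub1_le r x : `|x| <= r -> `|expR x - 1| <= expR r * `|x|.
Proof.
move=> xr; apply: (@mean_value_bound (fun u => expR u - 1) expR).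
- by move=> u; apply: is_derive_eq; rewrite subr0.
- by rewrite expR0 subrr.
- move=> u ux; rewrite ger0_norm ?expR_ge0// ler_expR (le_trans (ler_norm _))//.
  exact: le_trans ux xr.
Qed.

Lemma expR_sub1x_le r x : `|x| <= r -> `|expR x - 1 - x| <= expR r * `|x| ^+ 2.
Proof.
move=> xr; rewrite expr2 mulrA.
apply: (@mean_value_bound (fun u => expR u - 1 - u) (fun u => expR u - 1)).
- by move=> u; apply: is_derive_eq; rewrite subr0.
- by rewrite expR0 subrr subr0.
- move=> u ux; apply: le_trans (expR_sub1_le (le_trans ux xr)) _.
  by rewrite ler_wpM2l ?expR_ge0.
Qed.

Lemma expR_sub1xx_le r x : `|x| <= r ->
  `|expR x - 1 - x - x ^+ 2 / 2| <= expR r * `|x| ^+ 3.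
Proof.
move=> xr; rewrite [leRHS](_ : _ = expR r * `|x| ^+ 2 * `|x|); last by ring.
apply: (@mean_value_bound (fun u => expR u - 1 - u - u ^+ 2 / 2) (fun u => expR u - 1 - u)).
- by move=> u; apply: is_derive_eq; rewrite subr0 /GRing.scale /=; field.
- by rewrite expR0 subrr expr0n mul0r !subr0.
- move=> u ux; apply: le_trans (expR_sub1x_le (le_trans ux xr)) _.
  by rewrite ler_wpM2l ?expR_ge0// lerXn2r ?nnegrE.
Qed.

End taylor.

Section linear_and_quadratic_forms.
Context (R : realType) (d : nat).
Implicit Types (theta x y z w : 'rV[R]_d) (S : 'M[R]_d).

Definition l1norm theta : R := \sum_i `|theta 0 i|.

Lemma rowdotE theta y : rowdot theta y = \sum_i theta 0 i * y 0 i.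
Proof. by rewrite /rowdot mxE; apply: eq_bigr => i _; rewrite mxE. Qed.

Lemma rowdotDr theta y z : rowdot theta (y + z) = rowdot theta y + rowdot theta z.
Proof. by rewrite /rowdot linearD mulmxDr mxE. Qed.

Lemma rowdotZr theta a y : rowdot theta (a *: y) = a * rowdot theta y.
Proof. by rewrite /rowdot linearZ -scalemxAr mxE. Qed.

Lemma rowdotC x y : rowdot x y = rowdot y x.
Proof. by rewrite !rowdotE; apply: eq_bigr => i _; rewrite mulrC. Qed.

Lemma rowdot_mulmx x y S : rowdot (x *m S) y = rowdot x (y *m S^T).
Proof. by rewrite /rowdot trmx_mul trmxK mulmxA. Qed.

Lemma quadZ S c x : quad S (c *: x) = c ^+ 2 * quad S x.
Proof. by rewrite /quad linearZ /= -!scalemxAl -scalemxAr !mxE mulrA. Qed.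

Lemma quad_dot S x : quad S x = rowdot (x *m S) x.
Proof. by []. Qed.

Lemma rowdotDl x y w : rowdot (x + y) w = rowdot x w + rowdot y w.
Proof. by rewrite /rowdot mulmxDl mxE. Qed.

Lemma rowdotZl c x w : rowdot (c *: x) w = c * rowdot x w.
Proof. by rewrite /rowdot -scalemxAl mxE. Qed.

Lemma quadE S theta :
  quad S theta = \sum_i \sum_j theta 0 i * theta 0 j * S i j.
Proof.
rewrite /quad mxE exchange_big; apply: eq_bigr => j _.
rewrite !mxE mulr_suml; apply: eq_bigr => i _.
by rewrite mulrAC.
Qed.

Lemma quad_line S c theta x : S^T = S ->
  quad S (theta + c *: x) =
  quad S theta + 2 * c * rowdot x (theta *m S) + c ^+ 2 * quad S x.
Proof.
move=> St; rewrite !quad_dot mulmxDl rowdotDr !rowdotDl -scalemxAl !rowdotZl.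
rewrite !rowdotZr !(rowdot_mulmx x theta) St (rowdotC (theta *m S) x); ring.
Qed.

Lemma l1norm_ge0 theta : 0 <= l1norm theta.
Proof. by apply: sumr_ge0. Qed.

Lemma rV_coord_le y i : `|y 0 i| <= `|y|.
Proof. by rewrite [leRHS]/Num.Def.normr /= mx_normrE; exact: (le_bigmax _ (fun ij => `|y ij.1 ij.2|) (0, i)). Qed.

Lemma rowdot_le theta y : `|rowdot theta y| <= l1norm theta * `|y|.
Proof.
rewrite rowdotE /l1norm mulr_suml; apply: le_trans (ler_norm_sum _ _ _) _.
by apply: ler_sum => i _; rewrite normrM ler_wpM2l// rV_coord_le.
Qed.

Lemma rowdot_is_linear theta : linear (rowdot theta : 'rV[R]_d -> R).
Proof. by move=> a y z; rewrite rowdotDr rowdotZr. Qed.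

HB.instance Definition _ theta :=
  GRing.isLinear.Build R 'rV[R]_d R _ (rowdot theta) (rowdot_is_linear theta).

Lemma continuous_rowdot theta : continuous (rowdot theta : 'rV[R]_d -> R).
Proof.
have -> : (rowdot theta : 'rV[R]_d -> R) = (fun y => \sum_i theta 0 i * y 0 i).
  by apply/funext => y; rewrite rowdotE.
move=> y; apply: differentiable_continuous.
rewrite (_ : (fun y => _) = \sum_(i < d) (fun y : 'rV[R]_d => theta 0 i * y 0 i)); last first.
  by apply/funext => z; rewrite fct_sumE.
apply: differentiable_sum => i; apply: differentiableM; last exact: differentiable_coord.
exact: differentiable_cst.
Qed.

Lemma differentiable_rowdot theta y : differentiable (rowdot theta : 'rV[R]_d -> R) y.
Proof. by apply: linear_differentiable; exact: continuous_rowdot. Qed.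

Lemma differentiable_ridge (k k' : R -> R) theta y :
  (forall u, is_derive u (1 : R) k (k' u)) ->
  differentiable (fun z : 'rV[R]_d => k (rowdot theta z) : R) y.
Proof.
move=> dk; apply: (@differentiable_comp _ _ _ _ (rowdot theta) k).
  exact: differentiable_rowdot.
by apply/derivable1_diffP; have [] := dk (rowdot theta y).
Qed.

Lemma diff_ridge (k k' : R -> R) theta y v :
  (forall u, is_derive u (1 : R) k (k' u)) ->
  'd (fun z : 'rV[R]_d => k (rowdot theta z) : R) y v = k' (rowdot theta y) * rowdot theta v.
Proof.
move=> dk; have dku : differentiable k (rowdot theta y).
  by apply/derivable1_diffP; have [] := dk (rowdot theta y).
have -> : (fun z : 'rV[R]_d => k (rowdot theta z) : R) = k \o rowdot theta by [].
rewrite (diff_comp (differentiable_rowdot theta y) dku) /=.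
rewrite (diff_lin _ (@continuous_rowdot theta)) diff1E// derive1E.
have [_ ->] := dk (rowdot theta y).
by rewrite mulrC.
Qed.

Lemma measurable_rowdot dX (X : measurableType dX) (f : X -> 'rV[R]_d) theta :
  (forall i, measurable_fun setT (fun t => f t 0 i)) ->
  measurable_fun setT (fun t => rowdot theta (f t)).
Proof.
move=> mf; rewrite (_ : (fun t => _) = (fun t => \sum_i theta 0 i * f t 0 i)).
  by apply: measurable_sum => i; apply: measurable_funM.
by apply/funext => t; rewrite rowdotE.
Qed.

End linear_and_quadratic_forms.

Section variation_of_ridge.
Context (R : realType) dX (X : measurableType dX) (m : probability X R).
Context (d : nat) (var : (X -> R[i]) -> \bar R) (hvar : is_variation m d var).
Local Notation normc := ComplexField.Normc.normc.

Lemma rvar_ge0 (f : X -> 'rV[R]_d) : (0 <= rvar var f)%E.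
Proof. by rewrite /rvar; exact: bigmax_ge_id. Qed.

(** The chain rule for the variation, applied to a function of one linear form;
    its derivative is bounded on the ball by that of [k] on an interval. *)
Lemma var_ridge (k k' : R -> R) (B M Vg : R) (theta : 'rV[R]_d) (f : X -> 'rV[R]_d) :
  0 < M -> (forall i, measurable_fun setT (fun x => f x 0 i)) ->
  (forall x, `|f x| <= M) -> (rvar var f <= Vg%:E)%E ->
  (forall u, is_derive u (1 : R) k (k' u)) -> continuous k' -> 0 <= B ->
  (forall u, `|u| <= l1norm theta * M -> `|k' u| <= B) ->
  (var (toC (fun x => k (rowdot theta (f x)))) <= (B * l1norm theta * Vg)%:E)%E.
Proof.
move=> M0 mf fM fV dk ck B0 kB.
pose h (z : 'rV[R]_d) : R[i] := (k (rowdot theta z))%:C.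
have dh y v : 'd (fun u => complex.Re (h u)) y v = k' (rowdot theta y) * rowdot theta v.
  exact: (diff_ridge theta y v dk).
have dI : (fun u => complex.Im (h u)) = (cst 0 : 'rV[R]_d -> R) by apply/funext.
have C1h : C1_on_rball M h.
  exists setT; split => // [|y _]; first exact: openT.
  split.
  - exact: (differentiable_ridge theta y dk).
  - by rewrite dI; exact: differentiable_cst.
  - move=> v; rewrite (_ : (fun z => _) = (fun z => k' (rowdot theta z) * rowdot theta v)); last first.
      by apply/funext => z; exact: dh.
    apply: (@continuousM _ _ (k' \o rowdot theta) (cst (rowdot theta v))); last exact: cst_continuous.
    by apply: continuous_comp; [exact: continuous_rowdot|exact: ck].
  - move=> v; rewrite dI (_ : (fun z => _) = cst 0); first exact: cst_continuous.
    by apply/funext => z; rewrite diff_cst.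
have := var_comp hvar M0 mf (fun x => fM x) C1h.
move=> /le_trans; apply.
apply: (@le_trans _ _ ((B * l1norm theta)%:E * rvar var f)%E); last first.
  by rewrite [leRHS]EFinM lee_wpmul2l// lee_fin mulr_ge0// l1norm_ge0.
rewrite lee_wpmul2r ?rvar_ge0//; apply: ge_ereal_sup => _ /= [y yM <-].
apply: ge_ereal_sup => _ /= [v v1 <-].
rewrite dI diff_cst dh lee_fin expr0n addr0 sqrtr_sqr normrM ler_pM//.
- apply: kB; apply: le_trans (rowdot_le _ _) _.
  by rewrite ler_wpM2l// l1norm_ge0.
- apply: le_trans (rowdot_le _ _) _.
  by rewrite ler_piMr// l1norm_ge0.
Qed.

Lemma multiplier_le q q' psi : q <= q' -> multiplier m var q psi -> multiplier m var q' psi.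
Proof.
move=> qq [q0 bpsi H]; split => //; first exact: le_trans qq.
move=> f c bf; apply: bdB_le (H _ _ bf).
by rewrite ler_wpM2r// (bdB_ge0 hvar bf).
Qed.

(** The tilts $e^{t\theta\cdot f}$ and their Taylor remainders have sup norm and
    variation of the order in [t] that the remainder suggests, uniformly over
    all observables with the same bounds. *)
Lemma tilt_multipliers (M Vg : R) (theta : 'rV[R]_d) : 0 < M -> 0 <= Vg ->
  exists Q : R, forall f : X -> 'rV[R]_d,
  (forall i, measurable_fun setT (fun x => f x 0 i)) ->
  (forall x, `|f x| <= M) -> (rvar var f <= Vg%:E)%E ->
  let phi x := rowdot theta (f x) in
  let e1 t x := expR (t * phi x) - 1 in
  [/\ bounded_mfun Q phi, multiplier m var Q phi &
    forall t : R, `|t| <= 1 ->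
     [/\ multiplier m var (Q * `|t|) (e1 t),
         multiplier m var (Q * t ^+ 2) (fun x => e1 t x - t * phi x),
         bounded_mfun (Q * `|t|) (e1 t),
         bounded_mfun (Q * t ^+ 2) (fun x => e1 t x - t * phi x) &
         bounded_mfun (Q * `|t| ^+ 3)
           (fun x => e1 t x - t * phi x - t ^+ 2 / 2 * phi x ^+ 2)]].
Proof.
move=> M0 Vg0; have [C C1 hC] := multiplier_of_var hvar.
have C0 : 0 <= C by exact: le_trans C1.
set l := l1norm theta; have l0 : 0 <= l := l1norm_ge0 theta.
set r := l * M; have r0 : 0 <= r by rewrite mulr_ge0// ltW.
have e0 := expR_ge0 r.
set w := C * (l * Vg); have w0 : 0 <= w by rewrite !mulr_ge0.
pose Q1 := r + w; pose Q2 := expR r * (r + w).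
pose Q3 := expR r * (r ^+ 2 + r * w); pose Q4 := expR r * r ^+ 3.
have Q10 : 0 <= Q1 by rewrite addr_ge0.
have Q20 : 0 <= Q2 by rewrite mulr_ge0// addr_ge0.
have Q30 : 0 <= Q3 by rewrite mulr_ge0// addr_ge0 ?sqr_ge0// mulr_ge0.
have Q40 : 0 <= Q4 by rewrite mulr_ge0// exprn_ge0.
exists (Q1 + Q2 + Q3 + Q4) => f mf fM fV phi e1.
have mphi : measurable_fun setT phi by exact: measurable_rowdot.
have phir x : `|phi x| <= r.
  by apply: le_trans (rowdot_le _ _) _; rewrite ler_wpM2l.
have bphi : bounded_mfun r phi by [].
have tphi t x : `|t| <= 1 -> `|t * phi x| <= r.
  by move=> t1; rewrite normrM -[leRHS]mul1r ler_pM.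
have me1 t : measurable_fun setT (e1 t).
  apply: measurable_funB; last exact: measurable_cst.
  by apply: measurableT_comp => //; apply: measurable_funM.
have me2 t : measurable_fun setT (fun x => e1 t x - t * phi x).
  by apply: measurable_funB => //; apply: measurable_funM.
have be1 t : `|t| <= 1 -> bounded_mfun (expR r * r * `|t|) (e1 t).
  move=> t1; split => // x; apply: le_trans (expR_sub1_le (tphi t x t1)) _.
  by rewrite -mulrA ler_wpM2l// normrM mulrC ler_wpM2r.
have be2 t : `|t| <= 1 -> bounded_mfun (expR r * r ^+ 2 * t ^+ 2) (fun x => e1 t x - t * phi x).
  move=> t1; split => // x; apply: le_trans (expR_sub1x_le (tphi t x t1)) _.
  rewrite -mulrA ler_wpM2l// normrM exprMn mulrC -(real_normK (num_real t)).
  by rewrite ler_wpM2r ?exprn_ge0// lerXn2r ?nnegrE.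
split.
- by apply: bounded_mfun_le bphi; rewrite /Q1; lra.
- apply: multiplier_le (hC r (1 * l * Vg) _ bphi _ _); last by rewrite !mulr_ge0.
    by rewrite mul1r -/w -/Q1; lra.
  apply: (var_ridge M0 mf fM fV (k := id) (k' := cst 1)) => //.
  + by move=> u; exact: cvg_cst.
  + by move=> u _; rewrite normr1.
move=> t t1.
have t0 := normr_ge0 t; have tt0 := sqr_ge0 t.
split.
- have B0 : 0 <= `|t| * expR r by rewrite mulr_ge0.
  apply: multiplier_le (hC _ (`|t| * expR r * l * Vg) _ (be1 _ t1) _ _); last by rewrite !mulr_ge0.
    have -> : expR r * r * `|t| + C * (`|t| * expR r * l * Vg) = Q2 * `|t|.
      by rewrite /Q2 /w; ring.
    by rewrite ler_wpM2r//; lra.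
  apply: (var_ridge M0 mf fM fV (k := fun u => expR (t * u) - 1) (k' := fun u => t * expR (t * u))) => //.
  + by move=> u; apply: is_derive_eq; rewrite subr0 /GRing.scale /=; ring.
  + move=> u; apply: cvgM; first exact: cvg_cst.
    apply: (continuous_comp (f := fun u => t * u)); last exact: continuous_expR.
    by apply: cvgM; [exact: cvg_cst|exact: cvg_id].
  + move=> u ur; rewrite normrM ler_wpM2l// ger0_norm ?expR_ge0// ler_expR.
    by rewrite (le_trans (ler_norm _))// normrM -[leRHS]mul1r ler_pM.
- have B0 : 0 <= `|t| * (expR r * (`|t| * r)) by nonneg.
  apply: multiplier_le (hC _ (`|t| * (expR r * (`|t| * r)) * l * Vg) _ (be2 _ t1) _ _);
     last by nonneg.
    have -> : expR r * r ^+ 2 * t ^+ 2 + C * (`|t| * (expR r * (`|t| * r)) * l * Vg) = Q3 * t ^+ 2.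
      by rewrite /Q3 /w -(real_normK (num_real t)); ring.
    by rewrite ler_wpM2r//; lra.
  apply: (var_ridge M0 mf fM fV (k := fun u => expR (t * u) - 1 - t * u)
     (k' := fun u => t * (expR (t * u) - 1))) => //.
  + by move=> u; apply: is_derive_eq; rewrite subr0 /GRing.scale /=; ring.
  + move=> u; apply: cvgM; first exact: cvg_cst.
    apply: cvgB; last exact: cvg_cst.
    apply: (continuous_comp (f := fun u => t * u)); last exact: continuous_expR.
    by apply: cvgM; [exact: cvg_cst|exact: cvg_id].
  + move=> u ur; rewrite normrM ler_wpM2l//.
    have tur : `|t * u| <= r by rewrite normrM -[leRHS]mul1r ler_pM.
    apply: le_trans (expR_sub1_le tur) _.
    by rewrite ler_wpM2l// normrM ler_wpM2l.
- apply: bounded_mfun_le (be1 _ t1); rewrite ler_wpM2r//.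
  have : 0 <= expR r * w by rewrite mulr_ge0.
  by rewrite /Q2 mulrDr; lra.
- apply: bounded_mfun_le (be2 _ t1); rewrite ler_wpM2r//.
  have : 0 <= expR r * (r * w) by nonneg.
  by rewrite /Q3 mulrDr; lra.
- split.
    apply: measurable_funB => //; apply: measurable_funM => //.
    exact: measurable_funX.
  move=> x; have := expR_sub1xx_le (tphi t x t1).
  have -> : expR (t * phi x) - 1 - t * phi x - (t * phi x) ^+ 2 / 2 =
     e1 t x - t * phi x - t ^+ 2 / 2 * phi x ^+ 2 by rewrite /e1; ring.
  move=> /le_trans; apply.
  apply: (@le_trans _ _ (Q4 * `|t| ^+ 3)); last by rewrite ler_wpM2r ?exprn_ge0//; lra.
  rewrite /Q4 -mulrA ler_wpM2l// normrM exprMn mulrC ler_wpM2r ?exprn_ge0//.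
  by rewrite lerXn2r ?nnegrE.
Qed.

End variation_of_ridge.

(** * Moderate scaling *)

Section moderate_scaling.
Context (R : realType).

(** With $t = a_n/n$ the cubic error $n|t|^3$, divided by the speed
    $a_n^2/n = n t^2$, is $|t|$, which tends to zero. *)
Lemma moderate_scaling (L : R -> nat -> R) (q : nat -> R) (a : nat -> R) (t1 C s : R) :
  0 < t1 -> 0 <= C ->
  (forall t n, `|t| <= t1 -> `|L t n - t ^+ 2 / 2 * q n| <= n%:R * (C * `|t| ^+ 3)) ->
  n%:R^-1 * q n @[n --> \oo] --> s ->
  (\forall n \near \oo, 0 < a n) ->
  a n / n%:R @[n --> \oo] --> (0 : R) ->
  (a n ^+ 2 / n%:R)^-1 * L (a n / n%:R) n @[n --> \oo] --> 2^-1 * s.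
Proof.
move=> t10 C0 LE qs apos a0.
have an0 : C * `|a n / n%:R| @[n --> \oo] --> (0 : R).
  rewrite -(mulr0 C); apply: cvgM; first exact: cvg_cst.
  by rewrite -(normr0 R); exact: cvg_norm.
have h : 2^-1 * (n%:R^-1 * q n) @[n --> \oo] --> 2^-1 * s.
  by apply: cvgM => //; exact: cvg_cst.
apply: (@squeeze_cvgr _ _ _ _
  (fun n => 2^-1 * (n%:R^-1 * q n) - C * `|a n / n%:R|)
  (fun n => 2^-1 * (n%:R^-1 * q n) + C * `|a n / n%:R|)); last 2 first.
- by rewrite -[X in _ --> X]subr0; apply: cvgB.
- by rewrite -[X in _ --> X]addr0; apply: cvgD.
have small : \forall n \near \oo, `|a n / n%:R| <= t1.
  have /cvgr0Pnorm_le := a0; exact.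
near=> n.
have n0 : 0 < n%:R :> R by rewrite ltr0n; near: n; exists 1%N.
have an : 0 < a n by near: n.
have tn : `|a n / n%:R| <= t1 by near: n.
have := LE _ n tn; set t := a n / n%:R in tn *.
have t0 : 0 < t by rewrite divr_gt0.
rewrite (gtr0_norm t0).
have -> : a n ^+ 2 / n%:R = n%:R * t ^+ 2 by rewrite /t; field; rewrite gt_eqF.
set b := n%:R * t ^+ 2; have b0 : 0 < b by rewrite mulr_gt0// exprn_gt0.
have -> : n%:R * (C * t ^+ 3) = b * (C * t) by rewrite /b; ring.
have -> : t ^+ 2 / 2 * q n = b * (2^-1 * (n%:R^-1 * q n)).
  by rewrite /b; field; rewrite gt_eqF.
set p := 2^-1 * _; set l := L _ _; move=> H.
have {}H : `|b^-1 * l - p| <= C * t.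
  rewrite -(ler_pM2l b0) -{1}(gtr0_norm b0) -normrM.
  by rewrite mulrBr mulrA divff ?gt_eqF// mul1r.
by move: H; rewrite ler_norml => /andP[h1 h2]; apply/andP; split; lra.
Unshelve. all: by end_near. Qed.

End moderate_scaling.

(** The cumulant expansion for each scalar observable $\theta\cdot f$, whose second
    moment is the covariance form at [theta]. *)
Section sequential_log_mgf.
Context (R : realType) dX (X : measurableType dX) (m : probability X R).
Context (d : nat) (var : (X -> R[i]) -> \bar R) (hvar : is_variation m d var).
Context (T : nat -> X -> X) (A : nat -> (X -> R) -> X -> R) (K' rho K : R).
Hypothesis gap : spectral_gap m var T A K' rho K.
Context (v : nat -> X -> R) (dens : equivariant_density m var A v).
Hypothesis v_ge0 : forall x, 0 <= v 0 x.
Context (f : nat -> X -> 'rV[R]_d) (M Vg : R).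
Hypotheses (M0 : 0 < M) (Vg0 : 0 <= Vg).
Hypothesis f_meas : forall j i, measurable_fun setT (fun x => f j x 0 i).
Hypothesis f_bd : forall j x, `|f j x| <= M.
Hypothesis f_var : forall j, (rvar var (f j) <= Vg%:E)%E.
Hypothesis f_centered : forall j i, \int[m]_x (v j x * f j x 0 i) = 0.

Definition vector_sum n x : 'rV[R]_d := \sum_(i < n) f i (orbit_map T i x).

Lemma birkhoff_sum_rowdot theta n x :
  birkhoff_sum T (fun j x => rowdot theta (f j x)) n x = rowdot theta (vector_sum n x).
Proof. by rewrite /birkhoff_sum /vector_sum linear_sum. Qed.

Lemma vector_sum_coordE n i x : vector_sum n x 0 i = \sum_(k < n) f k (orbit_map T k x) 0 i.
Proof. by rewrite /vector_sum summxE. Qed.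

Lemma f_coord_bd j i : bounded_mfun M (fun x => f j x 0 i).
Proof. by split => // x; exact: le_trans (rV_coord_le _ _) (f_bd j x). Qed.

Lemma vector_sum_coord_bd n i : bounded_mfun (n%:R * M) (fun x => vector_sum n x 0 i).
Proof.
have := birkhoff_sum_bd gap (fun j => f_coord_bd j i) n.
by rewrite (_ : birkhoff_sum _ _ n = (fun x => vector_sum n x 0 i))//; apply/funext => x; rewrite vector_sum_coordE.
Qed.

Lemma initial_mean_vector_sum_coord n i : initial_mean m v (fun x => vector_sum n x 0 i) = 0.
Proof.
rewrite -(initial_mean_birkhoff_sum gap dens (fun j => f_coord_bd j i) (fun j => f_centered j i) n).
by congr initial_mean; apply/funext => x; rewrite vector_sum_coordE.
Qed.

Lemma initial_mean_sum (I : Type) (r : seq I) (b : I -> R) (h : I -> X -> R) :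
  (forall i, bounded_mfun (b i) (h i)) ->
  initial_mean m v (fun x => \sum_(i <- r) h i x) = \sum_(i <- r) initial_mean m v (h i).
Proof.
move=> bh; elim: r => [|i r IH].
  rewrite big_nil /initial_mean (eq_Rintegral _ (g := fun=> 0)).
    by rewrite /Rintegral integral0.
  by move=> x _; rewrite big_nil mulr0.
have -> : (fun x => \sum_(i <- i :: r) h i x) = (fun x => h i x + \sum_(i <- r) h i x).
  by apply/funext => x; rewrite big_cons.
by rewrite (initial_meanD dens (bh i) (bounded_mfun_sum r bh)) IH big_cons.
Qed.

Lemma initial_mean_rowdot_sqr theta n : initial_mean m v (fun x => rowdot theta (vector_sum n x) ^+ 2) =
  \sum_i \sum_j theta 0 i * theta 0 j * initial_mean m v (fun x => vector_sum n x 0 i * vector_sum n x 0 j).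
Proof.
have b i j := bounded_mfunM (vector_sum_coord_bd n i) (vector_sum_coord_bd n j).
rewrite (_ : (fun x => _) = (fun x => \sum_i \sum_j
    theta 0 i * theta 0 j * (vector_sum n x 0 i * vector_sum n x 0 j))); last first.
  apply/funext => x; rewrite rowdotE expr2 mulr_suml; apply: eq_bigr => i _.
  by rewrite mulr_sumr; apply: eq_bigr => j _; ring.
have b2 i j := bounded_mfunZ (theta 0 i * theta 0 j) (b i j).
have b3 i := bounded_mfun_sum (index_enum _) (b2 i).
rewrite (initial_mean_sum _ b3); apply: eq_bigr => i _.
rewrite (initial_mean_sum _ (b2 i)); apply: eq_bigr => j _.
exact: (initial_meanZ dens _ (b i j)).
Qed.

(** The conclusion is the limit of the scaled cumulant generating functions
    along one orbit. *)
Lemma sequential_log_mgf (S : 'M[R]_d) (a : nat -> R) :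
  (forall i j, n%:R^-1 * initial_mean m v (fun x => vector_sum n x 0 i * vector_sum n x 0 j)
     @[n --> \oo] --> S i j) ->
  (\forall n \near \oo, 0 < a n) ->
  a n / n%:R @[n --> \oo] --> (0 : R) ->
  forall theta, (a n ^+ 2 / n%:R)^-1 *
      ln (initial_mean m v (fun x => expR (a n / n%:R * rowdot theta (vector_sum n x))))
    @[n --> \oo] --> 2^-1 * quad S theta.
Proof.
move=> cS apos a0 theta.
have [Q hQ] := tilt_multipliers hvar theta M0 Vg0.
have {}hQ j := hQ (f j) (f_meas j) (f_bd j) (f_var j).
pose phi j x := rowdot theta (f j x).
have phi_centered j : \int[m]_x (v j x * phi j x) = 0.
  rewrite (eq_Rintegral _ (g := fun x => \sum_i theta 0 i * (v j x * f j x 0 i))); last first.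
    by move=> x _; rewrite /phi rowdotE mulr_sumr; apply: eq_bigr => i _; rewrite mulrCA.
  have I i : rintegrable m (fun x => v j x * f j x 0 i).
    exact: rintegrableM (density_int dens j) (f_coord_bd j i).
  suff [_ ->] : rintegrable m (fun x => \sum_i theta 0 i * (v j x * f j x 0 i)) /\
     \int[m]_x (\sum_i theta 0 i * (v j x * f j x 0 i)) = 0 by [].
  elim: (index_enum _) => [|i s [IH1 IH2]].
    split.
      by under eq_fun do rewrite big_nil; exact: (rintegrable0 m).
    rewrite (eq_Rintegral _ (g := fun=> 0)); first by rewrite /Rintegral integral0.
    by move=> x _; rewrite big_nil.
  split.
    by under eq_fun do rewrite big_cons; apply: rintegrableD => //; exact: rintegrableZ.
  rewrite (eq_Rintegral _ (g := fun x => theta 0 i * (v j x * f j x 0 i) +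
      \sum_(i <- s) theta 0 i * (v j x * f j x 0 i))); last by move=> x _; rewrite big_cons.
  rewrite RintegralD// ?IH2; last exact: rintegrableZ.
  by rewrite RintegralZl ?f_centered ?mulr0 ?addr0//; exact: I.
have [V V1 v_bd] := density_bounded hvar gap dens.
have [t1 [C [t10 C0 exp]]] := ln_mgf_expansion hvar gap dens v_ge0
  (fun j => let: And3 h _ _ := hQ j in h) phi_centered V1 v_bd
  (fun j => let: And3 _ h _ := hQ j in h)
  (fun t j t1 => let: And3 _ _ h := hQ j in let: And5 h _ _ _ _ := h t t1 in h)
  (fun t j t1 => let: And3 _ _ h := hQ j in let: And5 _ h _ _ _ := h t t1 in h)
  (fun t j t1 => let: And3 _ _ h := hQ j in let: And5 _ _ h _ _ := h t t1 in h)
  (fun t j t1 => let: And3 _ _ h := hQ j in let: And5 _ _ _ h _ := h t t1 in h)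
  (fun t j t1 => let: And3 _ _ h := hQ j in let: And5 _ _ _ _ h := h t t1 in h).
have qs : n%:R^-1 * initial_mean m v (fun x => birkhoff_sum T phi n x ^+ 2) @[n --> \oo] --> quad S theta.
  rewrite quadE.
  have -> : (fun n => n%:R^-1 * initial_mean m v (fun x => birkhoff_sum T phi n x ^+ 2)) =
     (fun n => \sum_i \sum_j theta 0 i * theta 0 j *
        (n%:R^-1 * initial_mean m v (fun x => vector_sum n x 0 i * vector_sum n x 0 j))).
    apply/funext => n.
    have -> : (fun x => birkhoff_sum T phi n x ^+ 2) = (fun x => rowdot theta (vector_sum n x) ^+ 2).
      by apply/funext => x; rewrite birkhoff_sum_rowdot.
    rewrite initial_mean_rowdot_sqr mulr_sumr; apply: eq_bigr => k _.
    by rewrite mulr_sumr; apply: eq_bigr => l _; rewrite mulrCA.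
  apply: cvg_big => [|i _]; first exact: add_continuous.
  apply: cvg_big => [|j _]; first exact: add_continuous.
  by apply: cvgM; [exact: cvg_cst|exact: cS].
have := moderate_scaling t10 C0 exp qs apos a0.
rewrite /mgf.
by under eq_fun do under [X in initial_mean _ _ X]eq_fun do rewrite birkhoff_sum_rowdot.
Qed.

End sequential_log_mgf.

(** * Half-spaces covering the outside of an ellipsoid *)

Section quadratic_forms.
Context (R : realType) (d : nat).
Implicit Types (S P : 'M[R]_d) (x y w theta : 'rV[R]_d).

Lemma posdef_unit S : posdef S -> S \in unitmx.
Proof.
move=> [_ S0]; rewrite -row_free_unit; apply/row_freeP; apply/row_freeP.
rewrite -kermx_eq0; apply/eqP/row_matrixP => i; rewrite row0.
apply/eqP; apply: contraT => /S0; rewrite /quad -mulmxA.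
have -> : row i (kermx S) *m (S *m (row i (kermx S))^T) = 0.
  by rewrite mulmxA -row_mul mulmx_ker row0 mul0mx.
by rewrite mxE ltxx.
Qed.

Lemma posdef_inv S : posdef S -> posdef (invmx S).
Proof.
move=> pS; have uS := posdef_unit pS; have [St S0] := pS.
split; first by rewrite trmx_inv St.
move=> x x0; have -> : quad (invmx S) x = quad S (x *m invmx S).
  by rewrite /quad trmx_mul trmx_inv St !mulmxA mulmxKV.
apply: S0; apply: contra_neq x0 => /(congr1 (mulmx^~ S)).
by rewrite mulmxKV// mul0mx.
Qed.

Lemma continuous_quad S : continuous (quad S : 'rV[R]_d -> R).
Proof.
move=> y; apply: differentiable_continuous.
rewrite (_ : (quad S : 'rV[R]_d -> R) =
  \sum_(i < d) \sum_(j < d) (fun x : 'rV[R]_d => x 0 i * x 0 j * S i j)); last first.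
  apply/funext => x; rewrite quadE fct_sumE; apply: eq_bigr => i _.
  by rewrite fct_sumE.
apply: differentiable_sum => i; apply: differentiable_sum => j.
apply: differentiableM; last exact: differentiable_cst.
by apply: differentiableM; exact: differentiable_coord.
Qed.

(** Compactness of the sphere of directions: finitely many half-spaces, each
    tangent to a slightly smaller ellipsoid, cover the outside of an
    ellipsoid, including the part near infinity. *)
Lemma halfspace_cover S (kappa rho : R) : posdef S -> 0 < kappa -> kappa < 1 -> 0 < rho ->
  exists s : seq 'rV[R]_d,
    (forall theta, theta \in s -> quad S theta = kappa ^+ 2 * rho) /\
    (forall y, rho <= quad (invmx S) y ->
       exists2 theta, theta \in s & kappa ^+ 2 * rho <= rowdot theta y).
Proof.
move=> pS k0 k1 rho0; have pP := posdef_inv pS; have uS := posdef_unit pS.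
set P := invmx S in pP *; have [Pt P0] := pP.
pose q y := Num.sqrt (quad P y).
have q0 y : y != 0 -> 0 < q y by move=> /P0; rewrite sqrtr_gt0.
have q2 y : y != 0 -> q y ^+ 2 = quad P y by move=> /P0 /ltW; exact: sqr_sqrtr.
pose sph : set 'rV[R]_d := [set y | `|y| = 1].
have csph : compact sph.
  apply: bounded_closed_compact.
    by exists 1; split; [exact: num_real|move=> c c1 y /= ->; exact: ltW].
  apply: (@preimage_closed _ _ (fun y : 'rV[R]_d => `|y|) [set 1 : R]) => [y _|].
    exact: norm_continuous.
  exact: closed_eq.
pose U w : set 'rV[R]_d := [set y | 0 < rowdot (w *m P) y - kappa * (q y * q w)].
have oU w : open (U w).
  apply: (@open_comp _ _ (fun y : 'rV[R]_d => rowdot (w *m P) y - kappa * (q y * q w)) [set u | 0 < u]).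
    move=> y _; apply: (@continuousB _ _ _ (rowdot (w *m P)) (fun y => kappa * (q y * q w))).
      exact: continuous_rowdot.
    apply: (@continuousM _ _ (cst kappa) (fun y => q y * q w)); first exact: cst_continuous.
    apply: (@continuousM _ _ q (cst (q w))); last exact: cst_continuous.
    apply: (continuous_comp (f := quad P)); first exact: continuous_quad.
    exact: sqrt_continuous.
  exact: open_gt.
have cov : sph `<=` \bigcup_(w in sph) U w.
  move=> w w1; exists w => //; rewrite /U /=.
  have w0 : w != 0 by rewrite -normr_gt0 w1.
  rewrite -quad_dot -q2// -expr2.
  have : 0 < q w ^+ 2 by rewrite exprn_gt0// q0.
  by move=> h; rewrite subr_gt0 gtr_pMl.
move: csph; rewrite compact_cover => /(_ _ sph U (fun w _ => oU w) cov)[D DU covD].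
have sq0 := sqrtr_gt0 rho; rewrite rho0 in sq0.
pose c w := kappa * Num.sqrt rho / q w.
exists [seq c w *: (w *m P) | w <- finmap.enum_fset D]; split.
  move=> _ /mapP[w wD ->]; rewrite quadZ.
  have w1 : sph w by apply/set_mem/DU; exact: wD.
  have w0 : w != 0 by rewrite -normr_gt0 w1.
  have -> : quad S (w *m P) = quad P w.
    by rewrite /quad trmx_mul Pt !mulmxA mulmxKV.
  rewrite -(q2 w)// /c !exprMn exprVn sqr_sqrtr ?(ltW rho0)//.
  by rewrite mulfVK// expf_neq0// gt_eqF// q0.
move=> y Py.
have y0 : y != 0.
  apply: contraTneq Py => ->; rewrite -ltNge.
  by rewrite /quad mul0mx mul0mx mxE.
have ny0 : 0 < `|y| by rewrite normr_gt0.
have : sph (`|y|^-1 *: y).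
  by rewrite /sph /= normrZ normfV normr_id mulVf// gt_eqF.
move=> /covD[w wD]; rewrite /U /= => Uw.
have w1 : sph w by apply/set_mem/DU; exact: wD.
have w0 : w != 0 by rewrite -normr_gt0 w1.
exists (c w *: (w *m P)); first by apply/mapP; exists w.
have qZ : q (`|y|^-1 *: y) = `|y|^-1 * q y.
  by rewrite /q quadZ sqrtrM ?sqr_ge0// sqrtr_sqr gtr0_norm ?invr_gt0.
move: Uw; rewrite qZ rowdotZr => Uw.
have {}Uw : kappa * (q y * q w) < rowdot (w *m P) y.
  have : 0 < `|y|^-1 * (rowdot (w *m P) y - kappa * (q y * q w)).
    by apply: lt_le_trans Uw _; rewrite le_eqVlt; apply/orP; left; apply/eqP; ring.
  by rewrite pmulr_rgt0 ?invr_gt0// subr_gt0.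
have qy : Num.sqrt rho <= q y by rewrite ler_wsqrtr.
rewrite rowdotC rowdotZr (rowdotC y).
have c0 : 0 < c w by rewrite divr_gt0 ?mulr_gt0 ?q0.
apply: (@le_trans _ _ (c w * (kappa * (q y * q w)))); last by rewrite ler_wpM2l ?ltW.
have -> : c w * (kappa * (q y * q w)) = kappa ^+ 2 * (Num.sqrt rho * q y).
  by rewrite /c; field; rewrite gt_eqF// q0.
rewrite ler_wpM2l ?sqr_ge0// -{1}(sqr_sqrtr (ltW rho0)) expr2.
by rewrite ler_wpM2l// ltW.
Qed.

End quadratic_forms.

(** * Measurability of vector events *)

Section measurable_vectors.
Context (R : realType) dX (X : measurableType dX) (d : nat) (Y : X -> 'rV[R]_d).
Hypothesis Y_meas : forall i, measurable_fun setT (fun x => Y x 0 i).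

Lemma measurable_rV_ball y delta : 0 < delta -> measurable [set x | `|Y x - y| < delta].
Proof.
move=> delta0.
rewrite (_ : [set x | _] = \big[setI/setT]_(i < d) [set x | `|Y x 0 i - y 0 i| < delta]).
  apply: bigsetI_measurable => i _.
  have mf : measurable_fun setT (fun x => `|Y x 0 i - y 0 i|).
    by apply: measurableT_comp => //; apply: measurable_funB.
  rewrite -[X in measurable X]setTI.
  rewrite (_ : [set x | _] = (fun x => `|Y x 0 i - y 0 i|) @^-1` `]-oo, delta[%classic).
    by apply: mf => //; exact: measurable_itv.
  by apply/seteqP; split => x /=; rewrite in_itv.
rewrite -bigcap_seq; apply/seteqP; split => x /=.
  move=> h i _; apply: le_lt_trans h.
  by have := rV_coord_le (Y x - y) i; rewrite !mxE.
move=> h; rewrite [ltLHS]/Num.Def.normr /= mx_normrE; apply/bigmax_ltP; split => // -[j i] _ /=.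
rewrite ord1 !mxE; apply: h => /=; exact: mem_index_enum.
Qed.

(** An open set is the union of the countably many rational balls that it
    contains. *)
Lemma measurable_rV_open (A : set 'rV[R]_d) : open A -> measurable [set x | A (Y x)].
Proof.
move=> oA.
pose rad k : R := k.+1%:R^-1.
pose c (q : 'rV[rat]_d) : 'rV[R]_d := map_mx ratr q.
pose G k : set X := if unpickle k is Some (q, l) then
  [set x | `|Y x - c q| < rad l /\ (forall z, `|z - c q| < rad l -> A z)] else set0.
rewrite (_ : [set x | _] = \bigcup_k G k).
  apply: bigcupT_measurable => k; rewrite /G.
  case: (unpickle k) => [[q l]|]; last exact: measurable0.
  have r0 : 0 < rad l by rewrite invr_gt0.
  have [h|h] := pselect (forall z, `|z - c q| < rad l -> A z).
    rewrite (_ : [set x | _] = [set x | `|Y x - c q| < rad l]).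
      exact: measurable_rV_ball.
    by apply/seteqP; split => x /=; [case|].
  rewrite (_ : [set x | _] = set0); first exact: measurable0.
  by apply/seteqP; split => x //= [].
apply/seteqP; split => x /=; last first.
  move=> [k _]; rewrite /G; case: (unpickle k) => [[q l]|] //= [h1 h2]; exact: h2.
move=> Ax.
have /nbhs_ballP[e /= e0 eA] : nbhs (Y x) A by exact: open_nbhs_nbhs.
have [l hl] : exists l, rad l < e / 2.
  have e2 : 0 < e / 2 by rewrite divr_gt0.
  have [N _ HN] := near_infty_natSinv_lt (PosNum e2).
  by exists N; apply: HN => /=.
have r0 : 0 < rad l by rewrite invr_gt0.
have ex i : exists q : rat, `|Y x 0 i - ratr q| < rad l.
  have [q] := @rat_in_itvoo R (Y x 0 i - rad l) (Y x 0 i + rad l) ltac:(lra).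
  rewrite in_itv /= => /andP[q1 q2]; exists q.
  by rewrite ltr_norml; apply/andP; split; lra.
pose q : 'rV[rat]_d := \row_i projT1 (cid (ex i)).
have lt_norm (z : 'rV[R]_d) (r : R) : 0 < r -> (forall i, `|z 0 i| < r) -> `|z| < r.
  move=> rr h; rewrite [ltLHS]/Num.Def.normr /= mx_normrE; apply/bigmax_ltP; split => // -[j i] _ /=.
  by rewrite ord1.
have Yq : `|Y x - c q| < rad l.
  by apply: lt_norm => // i; rewrite !mxE; case: cid.
exists (pickle (q, l)) => //; rewrite /G pickleK /=; split => // z zq.
apply: eA; rewrite -ball_normE /ball_ /=.
have -> : Y x - z = (Y x - c q) - (z - c q) by rewrite opprB addrA subrK.
apply: le_lt_trans (ler_normB _ _) _; lra.
Qed.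

End measurable_vectors.

(** * Exponential bounds for Gaussian cumulants *)

Section gaussian_gartner_ellis.
Context (R : realType) dX (X : measurableType dX) (mu : probability X R).
Context (d : nat) (S : 'M[R]_d) (pS : posdef S).
Context (Y : nat -> X -> 'rV[R]_d) (b : nat -> R).
Hypothesis Y_meas : forall n i, measurable_fun setT (fun x => Y n x 0 i).
Hypothesis Y_bd : forall n, exists C, forall x, `|Y n x| <= C.
Implicit Types (theta u y : 'rV[R]_d) (h : X -> R).

(** The exponent carries the speed [b n], so that the logarithm divided by [b n] has
    the limit that a large deviation principle for [Y n] at this speed requires. *)
Definition Zmgf n theta := \int[mu]_x expR (b n * rowdot theta (Y n x)).

Hypothesis b_oo : b n @[n --> \oo] --> +oo.
Hypothesis Z_lim : forall theta,
  (b n)^-1 * ln (Zmgf n theta) @[n --> \oo] --> 2^-1 * quad S theta.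

Lemma rowdot_Y_bd n theta : exists C, bounded_mfun C (fun x => rowdot theta (Y n x)).
Proof.
have [C YC] := Y_bd n; exists (l1norm theta * C); split.
  exact: measurable_rowdot.
by move=> x; apply: le_trans (rowdot_le _ _) _; rewrite ler_wpM2l ?l1norm_ge0.
Qed.

Lemma exp_rowdot_bd n theta c : exists C, bounded_mfun C (fun x => expR (b n * (rowdot theta (Y n x) + c))).
Proof.
have [C bC] := rowdot_Y_bd n theta.
by exists (expR (`|b n| * (C + `|c|))); apply: bounded_mfun_expR; apply: bounded_mfunZ;
  apply: bounded_mfunD bC (bounded_mfun_cst X c).
Qed.

Lemma exp_rowdot0_bd n theta : exists C, bounded_mfun C (fun x => expR (b n * rowdot theta (Y n x))).
Proof.
have [C bC] := exp_rowdot_bd n theta 0; exists C; move: bC.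
rewrite (_ : (fun x => _) = (fun x => expR (b n * rowdot theta (Y n x))))//.
by apply/funext => x; rewrite addr0.
Qed.

Lemma Zmgf_gt0 n theta : 0 < Zmgf n theta.
Proof.
have [C bC] := rowdot_Y_bd n theta.
have := weighted_expR_gt0 (rintegrable1 mu) (fun=> ler01) (Rintegral1 mu 1)
  (bounded_mfunZ (b n) bC).
by under eq_Rintegral do rewrite mul1r.
Qed.

(** Exponential Markov inequality for a finite union of half-spaces. The weight is
    1 for the upper bound, and an exponential tilt for the lower bound. *)
Lemma weighted_union_bound n (I : eqType) (s : seq I) (th : I -> 'rV[R]_d) (c : I -> R)
    (E : set X) C h :
  measurable E -> bounded_mfun C h -> (forall x, 0 <= h x) -> 0 <= b n ->
  (forall x, E x -> exists2 i, i \in s & c i <= rowdot (th i) (Y n x)) ->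
  \int[mu]_x (h x * \1_E x) <=
  \sum_(i <- s) \int[mu]_x (h x * expR (b n * (rowdot (th i) (Y n x) - c i))).
Proof.
move=> mE bh h0 b0 cov.
have bE := bounded_mfun_indic R mE.
pose t i x := h x * expR (b n * (rowdot (th i) (Y n x) - c i)).
have ti i : rintegrable mu (t i).
  have [C' bC'] := exp_rowdot_bd n (th i) (- c i).
  exact: (rintegrable_bounded mu (bounded_mfunM bh bC')).
have H : forall r : seq I, rintegrable mu (fun x => \sum_(i <- r) t i x) /\
    \int[mu]_x (\sum_(i <- r) t i x) = \sum_(i <- r) \int[mu]_x t i x.
  elim=> [|i r [IH1 IH2]].
    rewrite (_ : (fun x => _) = fun=> 0); last by apply/funext => x; rewrite big_nil.
    split; first exact: (rintegrable_bounded mu (bounded_mfun_cst X 0)).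
    by rewrite big_nil /Rintegral integral0.
  rewrite (_ : (fun x => _) = fun x => t i x + \sum_(i <- r) t i x); last first.
    by apply/funext => x; rewrite big_cons.
  split; first exact: rintegrableD.
  by rewrite RintegralD//; [rewrite IH2 big_cons|exact: ti].
have [H1 <-] := H s.
apply: le_Rintegral => //.
  exact: (rintegrable_bounded mu (bounded_mfunM bh bE)).
move=> x _; have t0 i : 0 <= t i x by rewrite mulr_ge0 ?expR_ge0.
rewrite indicE; case: (boolP (x \in E)) => xE; last first.
  by rewrite mulr0; apply: sumr_ge0.
have [i si ci] := cov x (set_mem xE).
rewrite (big_rem i)//= ler_wpDr//; first by apply: sumr_ge0.
by rewrite ler_wpM2l// -expR0 ler_expR mulr_ge0// subr_ge0.
Qed.

Lemma Zmgf_shift n theta theta' c :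
  \int[mu]_x (expR (b n * rowdot theta (Y n x)) * expR (b n * (rowdot theta' (Y n x) - c))) =
  expR (- (b n * c)) * Zmgf n (theta + theta').
Proof.
have [C bC] := exp_rowdot0_bd n (theta + theta').
rewrite -RintegralZl//; last exact: (rintegrable_bounded mu bC).
apply: eq_Rintegral => x _; rewrite -!expRD; congr expR.
by rewrite rowdotDl; ring.
Qed.

Lemma b_gt0 : \forall n \near \oo, 0 < b n.
Proof. by move: b_oo => /cvgryPgt; exact. Qed.

Lemma Zmgf_le theta e : 0 < e ->
  \forall n \near \oo, Zmgf n theta <= expR (b n * (2^-1 * quad S theta + e)).
Proof.
move=> e0; have /cvgrPdist_le/(_ _ e0) := @Z_lim theta.
move=> H; near=> n.
have bn : 0 < b n by near: n; exact: b_gt0.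
have Hn : `|2^-1 * quad S theta - (b n)^-1 * ln (Zmgf n theta)| <= e by near: n.
rewrite -ler_ln ?posrE ?Zmgf_gt0 ?expR_gt0// expRK.
set z := ln _ in Hn *; set q := quad _ _ in Hn *.
move: Hn; rewrite ler_norml => /andP[h1 _].
rewrite -(ler_pM2l (x := (b n)^-1)) ?invr_gt0// mulrA mulVf ?gt_eqF// mul1r.
by lra.
Unshelve. all: by end_near. Qed.

Lemma Zmgf_ge theta e : 0 < e ->
  \forall n \near \oo, expR (b n * (2^-1 * quad S theta - e)) <= Zmgf n theta.
Proof.
move=> e0; have /cvgrPdist_le/(_ _ e0) := @Z_lim theta.
move=> H; near=> n.
have bn : 0 < b n by near: n; exact: b_gt0.
have Hn : `|2^-1 * quad S theta - (b n)^-1 * ln (Zmgf n theta)| <= e by near: n.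
rewrite -ler_ln ?posrE ?Zmgf_gt0 ?expR_gt0// expRK.
set z := ln _ in Hn *; set q := quad _ _ in Hn *.
move: Hn; rewrite ler_norml => /andP[_ h1].
rewrite -(ler_pM2l (x := (b n)^-1)) ?invr_gt0// mulrA mulVf ?gt_eqF// mul1r.
by lra.
Unshelve. all: by end_near. Qed.

Lemma expRN_small c e : 0 < c -> 0 < e -> \forall n \near \oo, expR (- (b n * e)) <= c.
Proof.
move=> c0 e0; have /cvgryPge/(_ (- ln c / e)) := b_oo.
apply: filterS => n; rewrite ler_pdivrMr// => h.
by rewrite -[leRHS]lnK ?posrE// ler_expR lerNl.
Qed.

Lemma near_all_seq (s : seq 'rV[R]_d) (Pr : 'rV[R]_d -> nat -> Prop) :
  (forall theta, theta \in s -> \forall n \near \oo, Pr theta n) ->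
  \forall n \near \oo, forall theta, theta \in s -> Pr theta n.
Proof.
elim: s => [|theta s IH] H; first by apply: nearW => n theta; rewrite in_nil.
have H1 := H theta (mem_head _ _).
have H2 := IH (fun t ts => H t (mem_behead (s := theta :: s) ts)).
apply: filterS2 H1 H2 => n h1 h2 t; rewrite in_cons => /orP[/eqP->//|]; exact: h2.
Qed.

(** The factor 1 is the trivial weight of [weighted_union_bound]. *)
Lemma prob_Rintegral (E : set X) : measurable E ->
  fine (mu E) = \int[mu]_x (1 * \1_E x).
Proof.
move=> mE; rewrite /Rintegral; congr fine.
under eq_integral do rewrite mul1r.
by rewrite integral_indic// setIT.
Qed.

(** Only the complement of an ellipsoid has to be estimated, whatever the closed
    set: it is covered by finitely many half-spaces, and on each of them the
    optimal exponent of the Markov inequality is explicit. *)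
Lemma upper_bound rho e : 0 < rho -> 0 < e -> \forall n \near \oo,
  forall E, measurable E -> (forall x, E x -> 2 * rho <= quad (invmx S) (Y n x)) ->
  fine (mu E) <= expR (- (b n * (rho - e))).
Proof.
move=> rho0 e0.
have [kappa [k0 k1 kr]] : exists kappa : R, [/\ 0 < kappa, kappa < 1 & rho - e / 4 <= kappa ^+ 2 * rho].
  pose z := Num.min (2^-1) (e / 8 / rho).
  have z0 : 0 < z by rewrite lt_min !divr_gt0// invr_gt0 ltr0n.
  have z1 : z <= 2^-1 by rewrite ge_min lexx.
  have z2 : z * rho <= e / 8 by rewrite -ler_pdivlMr// ge_min lexx orbT.
  exists (1 - z); split; [lra|lra|].
  have : 0 <= z ^+ 2 * rho by rewrite mulr_ge0 ?sqr_ge0// ltW.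
  have -> : (1 - z) ^+ 2 * rho = rho - 2 * (z * rho) + z ^+ 2 * rho by ring.
  by lra.
have r20 : 0 < 2 * rho by rewrite mulr_gt0.
have [s [sq scov]] := halfspace_cover pS k0 k1 r20.
set c := kappa ^+ 2 * (2 * rho) in sq scov.
have e4 : 0 < e / 4 by rewrite divr_gt0.
have e2 : 0 < e / 2 by rewrite divr_gt0.
have sz0 : 0 < (1 + (size s)%:R : R)^-1 by rewrite invr_gt0 ltr_wpDr.
have Hs := near_all_seq (fun theta (_ : theta \in s) => Zmgf_le theta e4).
near=> n => E mE Ecov.
have bn : 0 < b n by near: n; exact: b_gt0.
rewrite (prob_Rintegral mE).
have := @weighted_union_bound n _ s id (fun=> c) E `|1| (fun=> 1) mE (bounded_mfun_cst X 1) (fun=> ler01) (ltW bn).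
move=> /(_ (fun x xE => scov _ (Ecov x xE))) => /le_trans; apply.
apply: (@le_trans _ _ (\sum_(theta <- s) expR (b n * (- rho + e / 2)))).
  rewrite big_seq [leRHS]big_seq; apply: ler_sum => theta ts.
  have := Zmgf_shift n 0 theta c; rewrite add0r.
  rewrite (eq_Rintegral _ (g := fun x => 1 * expR (b n * (rowdot theta (Y n x) - c)))); last first.
    by move=> x _; rewrite {1}/rowdot mul0mx mxE mulr0 expR0.
  move=> ->.
  have Zle : Zmgf n theta <= expR (b n * (2^-1 * quad S theta + e / 4)).
    by apply: (near Hs n) => //.
  apply: (@le_trans _ _ (expR (- (b n * c)) * expR (b n * (2^-1 * quad S theta + e / 4)))).
    by rewrite ler_wpM2l ?expR_ge0.
  rewrite -expRD ler_expR sq//.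
  have -> : - (b n * c) + b n * (2^-1 * c + e / 4) = b n * (- (2^-1 * c) + e / 4) by field.
  rewrite ler_wpM2l ?(ltW bn)// /c; lra.
rewrite big_const_seq count_predT iter_addr_0.
have sm : expR (- (b n * (e / 2))) <= (1 + (size s)%:R)^-1.
  by near: n; exact: expRN_small.
have -> : - (b n * (rho - e)) = b n * (- rho + e / 2) + b n * (e / 2) by field.
rewrite expRD -[leLHS]mulr_natr ler_wpM2l ?expR_ge0//.
have p0 : 0 < 1 + (size s)%:R :> R by rewrite ltr_wpDr.
have : 1 + (size s)%:R <= expR (b n * (e / 2)).
  by rewrite -[leRHS]invrK -expRN -[leLHS]invrK lef_pV2 ?posrE ?invr_gt0 ?expR_gt0.
by apply: le_trans; rewrite lerDr.
Unshelve. all: by end_near. Qed.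

(** Under the measure tilted by [theta] the mean of [Y n] is close to
    $\theta\Sigma$; the gain [s * delta] is linear in the additional tilt [s], and
    its cost is quadratic. *)
Lemma tilted_tail theta u delta c : 0 < delta -> 0 < c ->
  exists2 s : R, 0 < s & \forall n \near \oo,
    \int[mu]_x (expR (b n * rowdot theta (Y n x)) *
       expR (b n * (rowdot (s *: u) (Y n x) - s * (rowdot u (theta *m S) + delta))))
    <= c * Zmgf n theta.
Proof.
move=> delta0 c0; have [St S0] := pS.
have qu : 0 <= quad S u.
  have [->|/S0/ltW//] := eqVneq u 0; by rewrite /quad mul0mx mul0mx mxE.
pose s := delta / (quad S u + 1); have s0 : 0 < s by rewrite divr_gt0// ltr_wpDl.
have sq : s * quad S u <= delta.
  by rewrite /s mulrAC ler_pdivrMr ?ltr_wpDl// ler_wpM2l ?(ltW delta0)// lerDl.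
exists s => //.
have e0 : 0 < s * delta / 8 by apply: divr_gt0; first exact: mulr_gt0.
have e1 : 0 < s * delta / 4 by apply: divr_gt0; first exact: mulr_gt0.
have H1 := Zmgf_le (theta + s *: u) e0; have H2 := Zmgf_ge theta e0.
have H3 := expRN_small c0 e1.
near=> n.
have bn : 0 < b n by near: n; exact: b_gt0.
rewrite Zmgf_shift.
have h1 : Zmgf n (theta + s *: u) <= expR (b n * (2^-1 * quad S (theta + s *: u) + s * delta / 8)) by near: n.
have h2 : expR (b n * (2^-1 * quad S theta - s * delta / 8)) <= Zmgf n theta by near: n.
have h3 : expR (- (b n * (s * delta / 4))) <= c by near: n.
apply: (@le_trans _ _ (expR (- (b n * (s * delta / 4))) * expR (b n * (2^-1 * quad S theta - s * delta / 8)))); last first.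
  by rewrite ler_pM ?expR_ge0.
apply: le_trans (ler_wpM2l (expR_ge0 _) h1) _.
rewrite -!expRD ler_expR quad_line//.
set p := rowdot _ _; set q := quad S theta.
have sq2 : s ^+ 2 * quad S u <= s * delta by rewrite expr2 -mulrA ler_wpM2l// ltW.
have -> : - (b n * (s * (p + delta))) +
   b n * (2^-1 * (q + 2 * s * p + s ^+ 2 * quad S u) + s * delta / 8) =
   b n * (2^-1 * q + 2^-1 * (s ^+ 2 * quad S u) - s * delta + s * delta / 8) by field.
have -> : - (b n * (s * delta / 4)) + b n * (2^-1 * q - s * delta / 8) =
   b n * (2^-1 * q - s * delta / 4 - s * delta / 8) by ring.
by rewrite ler_wpM2l ?(ltW bn)//; lra.
Unshelve. all: by end_near. Qed.

Definition signed_basis : seq 'rV[R]_d :=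
  [seq (-1) ^+ ib.2 *: delta_mx 0 ib.1 | ib : 'I_d * bool].

Lemma rowdot_signed i (t : bool) y : rowdot ((-1) ^+ t *: delta_mx 0 i) y = (-1) ^+ t * y 0 i.
Proof.
rewrite rowdotZl; congr (_ * _); rewrite rowdotE (bigD1 i)//= big1 => [|j ji].
  by rewrite mxE !eqxx mul1r addr0.
by rewrite mxE eqxx (negbTE ji) mul0r.
Qed.

Lemma norm_signed_basis y delta : 0 < delta -> delta <= `|y| ->
  exists2 u, u \in signed_basis & delta <= rowdot u y.
Proof.
move=> delta0 dy.
have [i iy] : exists i, delta <= `|y 0 i|.
  apply: contrapT => /forallNP H.
  have : `|y| < delta.
    rewrite [ltLHS]/Num.Def.normr /= mx_normrE; apply/bigmax_ltP; split => // -[j i] _ /=.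
    by rewrite ord1 ltNge; apply/negP; exact: H.
  by rewrite ltNge dy.
exists ((-1) ^+ (y 0 i < 0)%R *: delta_mx 0 i).
  by apply/mapP; exists (i, (y 0 i < 0)%R) => //; rewrite mem_enum.
by rewrite rowdot_signed -normrEsign.
Qed.

(** Tilt so that the mean moves to [y]. The tilted mass of the complement of the
    ball is at most half of the total, and on the ball the tilt is nearly
    constant. *)
Lemma lower_bound y delta e : 0 < delta -> 0 < e -> \forall n \near \oo,
  expR (- (b n * (2^-1 * quad (invmx S) y + l1norm (y *m invmx S) * delta + e)))
    <= fine (mu [set x | `|Y n x - y| < delta]).
Proof.
move=> delta0 e0; have uS := posdef_unit pS; have [St S0] := pS.
set theta := y *m invmx S.
have thS : theta *m S = y by rewrite /theta mulmxKV.
have qth : rowdot theta y = quad S theta by rewrite quad_dot thS rowdotC.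
have qy : quad (invmx S) y = quad S theta.
  by rewrite -qth /theta quad_dot.
pose N : R := (size signed_basis)%:R.
have N0 : 0 <= N by [].
pose c := (2 * (N + 1))^-1.
have c0 : 0 < c by rewrite invr_gt0 mulr_gt0// ltr_wpDl.
have cN : N * c <= 2^-1.
  rewrite /c invfM mulrCA -[leRHS]mulr1 ler_wpM2l// ler_pdivrMr ?ltr_wpDl//.
  by rewrite mul1r lerDl.
pose su u := projT1 (cid2 (tilted_tail theta u delta0 c0)).
have su0 u : 0 < su u by rewrite /su; case: cid2.
have suH u : \forall n \near \oo,
    \int[mu]_x (expR (b n * rowdot theta (Y n x)) *
       expR (b n * (rowdot (su u *: u) (Y n x) - su u * (rowdot u (theta *m S) + delta))))
    <= c * Zmgf n theta.
  by rewrite /su; case: cid2.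
have Hs := near_all_seq (fun u (_ : u \in signed_basis) => suH u).
have e2 : 0 < e / 2 by rewrite divr_gt0.
have H1 := Zmgf_ge theta e2.
have h20 : 0 < 2^-1 :> R by rewrite invr_gt0.
have H2 := expRN_small h20 e2.
near=> n.
have bn : 0 < b n by near: n; exact: b_gt0.
have hs : forall u, u \in signed_basis ->
   \int[mu]_x (expR (b n * rowdot theta (Y n x)) *
       expR (b n * (rowdot (su u *: u) (Y n x) - su u * (rowdot u (theta *m S) + delta))))
    <= c * Zmgf n theta by near: n.
have h1 : expR (b n * (2^-1 * quad S theta - e / 2)) <= Zmgf n theta by near: n.
have h2 : expR (- (b n * (e / 2))) <= 2^-1 by near: n.
have Z0 := Zmgf_gt0 n theta.
set E := [set x | _]; have mE : measurable E by exact: measurable_rV_ball.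
have mEc := measurableC mE.
pose W x := expR (b n * rowdot theta (Y n x)).
have [C bW] := exp_rowdot0_bd n theta; have W0 x : 0 <= W x by exact: expR_ge0.
have bE := bounded_mfun_indic R mE; have bEc := bounded_mfun_indic R mEc.
have tail : \int[mu]_x (W x * \1_(~` E) x) <= 2^-1 * Zmgf n theta.
  apply: le_trans (@weighted_union_bound n _ signed_basis (fun u => su u *: u)
    (fun u => su u * (rowdot u (theta *m S) + delta)) _ _ W mEc bW W0 (ltW bn) _) _.
    move=> x /negP; rewrite -leNgt => dx.
    have [u us du] := norm_signed_basis delta0 dx; exists u => //.
    rewrite rowdotZl ler_wpM2l ?(ltW (su0 u))// thS.
    by move: du; rewrite rowdotDr -scaleN1r rowdotZr mulN1r; lra.
  apply: (@le_trans _ _ (\sum_(u <- signed_basis) c * Zmgf n theta)).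
    by rewrite big_seq [leRHS]big_seq; apply: ler_sum => u us; exact: hs.
  rewrite big_const_seq count_predT iter_addr_0 -[leLHS]mulr_natl [leLHS]mulrA.
  by rewrite ler_wpM2r// ltW.
have split_Z : Zmgf n theta = \int[mu]_x (W x * \1_E x) + \int[mu]_x (W x * \1_(~` E) x).
  rewrite -RintegralD//; last 2 first.
  - exact: (rintegrable_bounded mu (bounded_mfunM bW bE)).
  - exact: (rintegrable_bounded mu (bounded_mfunM bW bEc)).
  apply: eq_Rintegral => x _; rewrite -mulrDr !indicE in_setC.
  by case: (x \in E); rewrite /= ?addr0 ?add0r mulr1.
pose k := b n * (rowdot theta y + l1norm theta * delta).
have main : \int[mu]_x (W x * \1_E x) <= expR k * fine (mu E).
  rewrite (prob_Rintegral mE).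
  have b1E := bounded_mfunM (bounded_mfun_cst X 1) bE.
  rewrite -RintegralZl//; last exact: (rintegrable_bounded mu b1E).
  apply: le_Rintegral => //.
  - exact: (rintegrable_bounded mu (bounded_mfunM bW bE)).
  - exact: rintegrableZ (rintegrable_bounded mu b1E).
  move=> x _; rewrite mul1r indicE; case: (boolP (x \in E)) => xE; last by rewrite !mulr0.
  rewrite !mulr1 ler_expR /k ler_wpM2l ?(ltW bn)//.
  have -> : rowdot theta (Y n x) = rowdot theta y + rowdot theta (Y n x - y).
    by rewrite -rowdotDr addrC subrK.
  rewrite lerD2l (le_trans (ler_norm _))// (le_trans (rowdot_le _ _))//.
  by rewrite ler_wpM2l ?l1norm_ge0// ltW//; exact: (set_mem xE).
rewrite -(ler_pM2l (expR_gt0 k)) (le_trans _ main)//.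
have half : 2^-1 * Zmgf n theta <= \int[mu]_x (W x * \1_E x) by lra.
apply: le_trans half; rewrite qy.
apply: (@le_trans _ _ (expR (- (b n * (e / 2))) * expR (b n * (2^-1 * quad S theta - e / 2)))); last first.
  by rewrite ler_pM ?expR_ge0.
rewrite -!expRD ler_expR /k qth.
rewrite le_eqVlt; apply/orP; left; apply/eqP; field.
Unshelve. all: by end_near. Qed.

End gaussian_gartner_ellis.

(** * Large deviation bounds *)

Section limsup_bounds.
Context (R : realType).
Implicit Types (u : nat -> \bar R) (c : \bar R).
Local Open Scope ereal_scope.

Lemma limn_esup_le_near u c : (\forall n \near \oo, u n <= c) -> limn_esup u <= c.
Proof.
move=> uc; rewrite /limn_esup limf_esupE; apply: ge_ereal_inf.
exists (ereal_sup (u @` [set n | u n <= c])); first by exists [set n | u n <= c].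
by apply: ge_ereal_sup => _ [n /= nc <-].
Qed.

Lemma limn_einf_ge_near u c : (\forall n \near \oo, c <= u n) -> c <= limn_einf u.
Proof.
move=> uc; rewrite /limn_einf leeNr; apply: limn_esup_le_near.
by apply: filterS uc => n; rewrite leeN2.
Qed.

Lemma scaled_lne_le (b p r : R) : (0 < b)%R -> (p <= expR (- (b * r)))%R ->
  b^-1%:E * lne p%:E <= (- r)%:E.
Proof.
move=> b0 pr; have [p0|p0] := leP p 0%R.
  by rewrite /= p0 gt0_muleNy ?leNye// lte_fin invr_gt0.
rewrite lne_EFin// -EFinM lee_fin -(ler_pM2l b0) mulrA divff ?gt_eqF// mul1r mulrN.
by rewrite -[leRHS]expRK ler_ln ?posrE ?expR_gt0.
Qed.

Lemma scaled_lne_ge (b p r : R) : (0 < b)%R -> (expR (- (b * r)) <= p)%R ->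
  (- r)%:E <= b^-1%:E * lne p%:E.
Proof.
move=> b0 pr; have p0 : (0 < p)%R by apply: lt_le_trans pr; exact: expR_gt0.
rewrite lne_EFin// -EFinM lee_fin -(ler_pM2l b0) mulrA divff ?gt_eqF// mul1r mulrN.
by rewrite -[leLHS]expRK ler_ln ?posrE ?expR_gt0.
Qed.

End limsup_bounds.

Section large_deviations.
Context (R : realType) dX (X : measurableType dX) (mu : probability X R).
Context (d : nat) (S : 'M[R]_d) (pS : posdef S).
Context (Y : nat -> X -> 'rV[R]_d) (b : nat -> R).
Hypothesis Y_meas : forall n i, measurable_fun setT (fun x => Y n x 0 i).
Hypothesis Y_bd : forall n, exists C, forall x, `|Y n x| <= C.
Hypothesis b_oo : b n @[n --> \oo] --> +oo.
Hypothesis Z_lim : forall theta : 'rV[R]_d,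
  (b n)^-1 * ln (Zmgf mu Y b n theta) @[n --> \oo] --> 2^-1 * quad S theta.
Implicit Types A : set 'rV[R]_d.
Local Open Scope ereal_scope.

Let rate A := ereal_inf [set (quad (invmx S) x)%:E | x in A].
Let term A n := (b n)^-1%:E * lne (mu [set x | A (Y n x)]).

Let quad_ge0 y : (0 <= quad (invmx S) y)%R.
Proof.
have [_ P0] := posdef_inv pS.
by have [->|/P0/ltW//] := eqVneq y 0%R; rewrite /quad mul0mx mul0mx mxE.
Qed.

Let rate_fin A y : A y -> exists2 r : R, rate A = r%:E & (0 <= r)%R.
Proof.
move=> Ay; have h0 : 0 <= rate A.
  by apply: le_ereal_inf_tmp => _ [z _ <-]; rewrite lee_fin.
have h1 : rate A <= (quad (invmx S) y)%:E by apply: ereal_inf_lbound; exists y.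
have f : rate A \is a fin_num by rewrite ge0_fin_numE// (le_lt_trans h1)// ltry.
exists (fine (rate A)); first by rewrite fineK.
exact: fine_ge0.
Qed.

Let prob_fin (E : set X) : measurable E -> (fine (mu E))%:E = mu E.
Proof. by move=> mE; rewrite fineK// fin_num_measure. Qed.

(** A set lies outside the largest open ellipsoid that it avoids, and has the same
    rate as the outside of that ellipsoid. The empty set has infinite rate, and for
    rate zero the ellipsoid degenerates; both are treated apart. *)
Lemma large_deviation_upper A : closed A ->
  limn_esup (term A) <= - (2^-1%:E * rate A).
Proof.
move=> cA.
have mA n : measurable [set x | A (Y n x)].
  rewrite (_ : [set x | _] = ~` [set x | (~` A) (Y n x)]).
    by apply: measurableC; apply: measurable_rV_open => //; exact: closed_openC.
  by apply/seteqP; split => x /=; [move=> Ax nA; exact: nA|exact: contrapT].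
have bpos := b_gt0 b_oo.
have [[y Ay]|nA] := pselect (exists y, A y); last first.
  apply: limn_esup_le_near; apply: filterS bpos => n bn.
  rewrite /term (_ : [set x | _] = set0); last first.
    by apply/seteqP; split => x //= Ax; apply: nA; exists (Y n x).
  by rewrite measure0 /= lexx gt0_muleNy ?leNye// lte_fin invr_gt0.
have [r ra r0] := rate_fin Ay; rewrite ra -EFinM -EFinN.
apply/lee_addgt0Pr => e e0; apply: limn_esup_le_near.
rewrite -EFinD.
have [r00|r00] := eqVneq r 0%R.
  apply: filterS bpos => n bn; rewrite /term -(prob_fin (mA n)).
  apply: le_trans (@scaled_lne_le _ (b n) _ 0 bn _) _.
    rewrite mulr0 oppr0 expR0 -lee_fin prob_fin//; exact: probability_le1.
  by rewrite lee_fin r00 mulr0 !oppr0 add0r ltW.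
have rr : (0 < 2^-1 * r)%R by rewrite mulr_gt0// lt_neqAle eq_sym r00.
have := upper_bound pS Y_meas Y_bd b_oo Z_lim rr e0.
apply: filterS2 bpos => n bn H; rewrite /term -(prob_fin (mA n)).
have -> : (- (2^-1 * r) + e)%:E = (- (2^-1 * r - e))%:E by rewrite opprB addrC.
apply: scaled_lne_le => //; apply: H => // x /= Ax.
rewrite mulrA divff// mul1r -lee_fin -ra; apply: ereal_inf_lbound.
by exists (Y n x).
Qed.

Lemma large_deviation_lower A : open A ->
  - (2^-1%:E * rate A) <= limn_einf (term A).
Proof.
move=> oA.
have mA n : measurable [set x | A (Y n x)] by exact: measurable_rV_open.
have bpos := b_gt0 b_oo.
have [[y0 Ay0]|nA] := pselect (exists y, A y); last first.
  have -> : rate A = +oo.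
    rewrite /rate (_ : [set _ | _ in _] = set0) ?ereal_inf0//.
    by apply/seteqP; split => z //= [y Ay _]; apply: nA; exists y.
  by rewrite gt0_muley ?lte_fin// leNye.
have [r ra r0] := rate_fin Ay0; rewrite ra -EFinM -EFinN.
apply/lee_subgt0Pr => e e0.
have [y Ay yr] : exists2 y, A y & (quad (invmx S) y < r + e)%R.
  have : rate A < (r + e)%:E by rewrite ra lte_fin ltrDl.
  by move=> /ereal_inf_lt[_ [y Ay <-]]; rewrite lte_fin => ?; exists y.
have /nbhs_ballP[delta /= delta0 dA] : nbhs y A by exact: open_nbhs_nbhs.
set l := l1norm (y *m invmx S); have l0 : (0 <= l)%R := l1norm_ge0 _.
pose dd : R := Num.min delta (e / 4 / (l + 1))%R.
have l10 : (0 < l + 1)%R by rewrite ltr_wpDl.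
have dd0 : (0 < dd)%R by rewrite lt_min delta0 !divr_gt0.
have ldd : (l * dd <= e / 4)%R.
  have : (dd <= e / 4 / (l + 1))%R by rewrite ge_min lexx orbT.
  rewrite ler_pdivlMr// mulrDr mulr1 => h.
  by rewrite mulrC; apply: le_trans h; rewrite lerDl ltW.
have e4 : (0 < e / 4)%R by rewrite divr_gt0.
have := lower_bound pS Y_meas Y_bd b_oo Z_lim y dd0 e4.
move=> H; apply: limn_einf_ge_near; apply: filterS2 bpos H => n bn H.
rewrite /term -(prob_fin (mA n)) -EFinB.
have mB : measurable [set x | `|Y n x - y| < dd]%R by exact: measurable_rV_ball.
have BA : (fine (mu [set x | `|Y n x - y| < dd]%R) <= fine (mu [set x | A (Y n x)]))%R.
  rewrite -lee_fin !prob_fin// le_measure ?inE// => x /= xd; apply: dA.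
  rewrite -ball_normE /ball_ /= distrC; apply: lt_le_trans xd _.
  by rewrite ge_min lexx.
apply: le_trans (scaled_lne_ge bn (le_trans H BA)).
rewrite lee_fin -/l; lra.
Qed.

End large_deviations.

(** * Null sets and densities *)

Section almost_everywhere_lemmas.
Context (R : realType) dX (X : measurableType dX).

Lemma ae_iff_measure (mu : probability X R) (E F : set X) :
  measurable E -> measurable F -> {ae mu, forall x, E x <-> F x} -> mu E = mu F.
Proof.
move=> mE mF EF.
have I (G : set X) : measurable G -> mu G = (\int[mu]_x (\1_G x)%:E)%E.
  by move=> mG; rewrite integral_indic// setIT.
rewrite !I//; apply: ae_eq_integral => //.
- by apply/measurable_EFinP; exact: measurable_indic.
- by apply/measurable_EFinP; exact: measurable_indic.
- apply: filterS EF => x EF _; rewrite !indicE; congr (_%:R%:E); congr nat_of_bool.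
  by apply/idP/idP => /set_mem /EF /mem_set.
Qed.

Lemma ae_comp_nonsingular (m : probability X R) (T : X -> X) (Q : X -> Prop) :
  nonsingular m T -> {ae m, forall x, Q x} -> {ae m, forall x, Q (T x)}.
Proof.
move=> [mT /null_content_dominatesP dT] [N [mN N0 QN]].
exists (T @^-1` N); split.
- by rewrite -[X in measurable X]setTI; exact: mT.
- exact: dT.
- by move=> x /= nQ; apply: QN.
Qed.

Section density.
Context (m nu : probability X R) (v : X -> R).
Hypothesis v_int : rintegrable m v.
Hypothesis nuE : forall A, measurable A -> (nu A = \int[m]_(x in A) (v x)%:E)%E.

Lemma density_dominated : nu `<< m.
Proof.
apply/null_content_dominatesP => A mA A0; rewrite nuE//.
apply: null_set_integral => //.
by apply/measurable_funTS/measurable_EFinP; exact: rintegrable_measurable v_int.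
Qed.

Lemma density_ae (Q : X -> Prop) : {ae m, forall x, Q x} -> {ae nu, forall x, Q x}.
Proof.
move=> [N [mN N0 QN]]; exists N; split => //.
by move/null_content_dominatesP : density_dominated; apply.
Qed.

(** The given density is the Radon-Nikodym derivative, by uniqueness. *)
Lemma density_Rintegral b psi : bounded_mfun b psi ->
  \int[nu]_x psi x = \int[m]_x (v x * psi x).
Proof.
move=> bpsi; rewrite /Rintegral; congr fine.
have pi : nu.-integrable setT (EFin \o psi) by exact: (rintegrable_bounded nu bpsi).
rewrite -(Radon_Nikodym_change_of_variables density_dominated measurableT pi).
have RNi : m.-integrable setT (Radon_Nikodym (charge_of_finite_measure nu) m).
  by apply: Radon_Nikodym_integrable; exact: density_dominated.
have E : ae_eq m setT (EFin \o v) (Radon_Nikodym (charge_of_finite_measure nu) m).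
  apply: integral_ae_eq => //; first exact: measurable_int RNi.
  move=> A _ mA; rewrite -(@Radon_Nikodym_integral _ _ _ (charge_of_finite_measure nu) m A density_dominated mA).
  by rewrite -[LHS]nuE.
apply: ae_eq_integral => //.
- apply: emeasurable_funM; last exact: measurable_int RNi.
  by apply/measurable_EFinP; exact: bpsi.1.
- apply/measurable_EFinP/measurable_funM; last exact: bpsi.1.
  exact: rintegrable_measurable v_int.
- by apply: filterS E => x /(_ I) <- _; rewrite /= -EFinM mulrC.
Qed.

End density.

End almost_everywhere_lemmas.

(** * The base and the fibres *)

Section base_dynamics.
Context (R : realType) dO (Omega : measurableType dO) (P : probability Omega R).
Context (s : Omega -> Omega) (erg : invertible_ergodic P s).

(** A countable union of preimages of null sets under the iterates of an
    invariant transformation. *)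
Lemma ae_forward_orbit (Q : Omega -> Prop) :
  {ae P, forall w, Q w} -> {ae P, forall w, forall j, Q (iter j s w)}.
Proof.
move=> Qae; apply/ae_foralln; elim=> [//|j [N [mN N0 QN]]].
have [[t [_ _ ms _]] inv _] := erg.
exists (s @^-1` N); split.
- by rewrite -[X in measurable X]setTI; exact: ms.
- exact: etrans (inv N mN) N0.
- by move=> w /= nQ; apply: QN; rewrite /= -iterSr.
Qed.

(** By Fubini, almost all sections of a null set are null. *)
Lemma ae_sections dX (X : measurableType dX) (m : probability X R)
    (Q : Omega * X -> Prop) :
  {ae (P \x m)%E, forall z, Q z} -> {ae P, forall w, {ae m, forall x, Q (w, x)}}.
Proof.
move=> [N [mN N0 QN]].
have mx := measurable_fun_xsection m mN.
have : ae_eq P setT (m \o xsection N) (cst 0%E).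
  apply/ae_eq_integral_abs => //.
  rewrite -[RHS]N0 /product_measure1; apply: eq_integral => w _ /=.
  by rewrite gee0_abs.
apply: filterS => w /(_ I) /= Nw.
exists (xsection N w); split => //; first exact: measurable_xsection.
by move=> x nQ; apply/mem_set/QN.
Qed.

End base_dynamics.

Section complex_norms.
Context (R : realType) dX (X : measurableType dX) (m : probability X R).
Context (d : nat) (var : (X -> R[i]) -> \bar R) (hvar : is_variation m d var).

Lemma normB_ae (f g : X -> R[i]) : L1 m f -> L1 m g ->
  {ae m, forall x, f x = g x} -> normB m var f = normB m var g.
Proof.
move=> f1 g1 fg; rewrite /normB (var_ae hvar f1 g1 fg); congr (_ + _)%E.
rewrite /norm1 !Lnorm1; apply: ae_eq_integral => //.
- by apply: measurableT_comp => //; apply/measurable_EFinP; exact: measurable_normc f1.1.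
- by apply: measurableT_comp => //; apply/measurable_EFinP; exact: measurable_normc g1.1.
- by apply: filterS fg => x -> _.
Qed.

End complex_norms.

Section fibre.
Context (R : realType) dO (Omega : measurableType dO) (s : Omega -> Omega).
Context dX (X : measurableType dX) (m : probability X R).
Context (d : nat) (var : (X -> R[i]) -> \bar R) (hvar : is_variation m d var).
Context (T : Omega -> X -> X) (L : Omega -> (X -> R[i]) -> (X -> R[i])).
Hypothesis hT : forall w, nonsingular m (T w).
Hypothesis hL : forall w, is_transfer m (T w) (L w).
Context (w : Omega).
Local Notation wj j := (iter j s w).

Definition fibre_map j := T (wj j).
Definition fibre_op j := real_part_op (L (wj j)).

Lemma cocycle_orbit_map n x : cocycle s T n w x = orbit_map fibre_map n x.
Proof. by elim: n => //= n ->. Qed.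

Lemma orbit_op_rcons n j f :
  orbit_op fibre_op n.+1 j f = fibre_op (j + n) (orbit_op fibre_op n j f).
Proof.
elim: n j f => [|n IH] j f; first by rewrite addn0.
by rewrite -addSnnS; exact: IH j.+1 (fibre_op j f).
Qed.

Lemma fibre_transfer j : rtransfer m (fibre_map j) (fibre_op j).
Proof. exact: real_part_transfer (hT _) (hL _). Qed.

Lemma cocycle_L1 n j f : L1 m f -> L1 m (cocycle s L n (wj j) f).
Proof. by move=> f1; elim: n => //= n IH; exact: (hL _ IH).1. Qed.

(** The iterates of the real parts are the iterates of the complex operators, one
    null set per step being discarded. *)
Lemma cocycle_orbit_op n j f : rintegrable m f ->
  {ae m, forall x, toC (orbit_op fibre_op n j f) x = cocycle s L n (wj j) (toC f) x}.
Proof.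
move=> fi; elim: n => [|n IH]; first exact: nearW.
have gi := orbit_op_int n j fibre_transfer fi.
have g1 : L1 m (toC (orbit_op fibre_op n j f)) by exact/L1_toCP.
have f1 : L1 m (toC f) by exact/L1_toCP.
rewrite orbit_op_rcons /=.
have H1 := transfer_real (hL (wj (j + n))) gi.
have H2 := transfer_ae (hT (wj (j + n))) (hL (wj (j + n))) g1 (cocycle_L1 n j f1) IH.
have E : wj (j + n) = iter n s (wj j) by rewrite addnC iterD.
by apply: filterS2 H1 H2 => x -> ->; rewrite E.
Qed.

Context (K Kd lambda : R).
Hypotheses (K0 : 0 < K) (Kd0 : 0 < Kd) (lambda0 : 0 < lambda).
Hypothesis L_bound : forall j f, inB m var f ->
  (normB m var (L (wj j) f) <= K%:E * normB m var f)%E.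
Hypothesis L_decay : forall j n f, inB m var f -> cintegral m f = 0 ->
  (normB m var (cocycle s L n (wj j) f) <=
     (Kd * expR (- lambda * n%:R))%:E * normB m var f)%E.

Lemma fibre_gap : spectral_gap m var fibre_map fibre_op Kd (expR (- lambda)) K.
Proof.
split.
- exact: fibre_transfer.
- exact: ltW.
- exact: expR_gt0.
- by rewrite expR_lt1 oppr_lt0.
- exact: ltW.
- move=> n j f c bf f0; have fi := bf.1.
  have gi := orbit_op_int n j fibre_transfer fi.
  split => //.
  rewrite (normB_ae hvar _ _ (cocycle_orbit_op n j fi)); last 2 first.
  + exact/L1_toCP.
  + by apply: cocycle_L1; exact/L1_toCP.
  apply: le_trans (L_decay j n (bdB_inB bf) _) _.
    rewrite /cintegral /toC /=.
    by rewrite f0 /Rintegral integral0.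
  by rewrite expRM_natr [leRHS]EFinM lee_wpmul2l ?lee_fin ?mulr_ge0 ?exprn_ge0 ?expR_ge0 ?(ltW Kd0)//; exact: bf.2.
- move=> j f c bf; have fi := bf.1.
  have gi := rtransfer_int (fibre_transfer j) fi.
  split => //.
  rewrite (normB_ae hvar _ _ (transfer_real (hL (wj j)) fi)); last 2 first.
  + exact/L1_toCP.
  + by apply: (hL _ _).1; exact/L1_toCP.
  apply: le_trans (L_bound j (bdB_inB bf)) _.
  by rewrite EFinM lee_wpmul2l ?lee_fin ?(ltW K0)//; exact: bf.2.
Qed.

End fibre.

(** * Moderate deviations on a fibre *)

Section quenched.
Context (R : realType) dO (Omega : measurableType dO) (s : Omega -> Omega).
Context dX (X : measurableType dX) (m : probability X R).
Context (d : nat) (var : (X -> R[i]) -> \bar R) (hvar : is_variation m d var).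
Context (T : Omega -> X -> X) (L : Omega -> (X -> R[i]) -> (X -> R[i])).
Hypothesis hT : forall w, nonsingular m (T w).
Hypothesis hL : forall w, is_transfer m (T w) (L w).
Context (w : Omega).
Local Notation wj j := (iter j s w).
Context (K Kd lambda : R).
Hypotheses (K0 : 0 < K) (Kd0 : 0 < Kd) (lambda0 : 0 < lambda).
Hypothesis L_bound : forall j f, inB m var f ->
  (normB m var (L (wj j) f) <= K%:E * normB m var f)%E.
Hypothesis L_decay : forall j n f, inB m var f -> cintegral m f = 0 ->
  (normB m var (cocycle s L n (wj j) f) <=
     (Kd * expR (- lambda * n%:R))%:E * normB m var f)%E.
Context (v0 : Omega * X -> R) (mu : Omega -> probability X R).
Hypothesis v0_ge0 : forall z, 0 <= v0 z.
Hypothesis v0_density : forall j,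
  [/\ inB m var (toC (fun x => v0 (wj j, x))),
      (\int[m]_x (v0 (wj j, x))%:E = 1)%E &
      {ae m, forall x, L (wj j) (toC (fun y => v0 (wj j, y))) x = (v0 (s (wj j), x))%:C}].
Hypothesis muE : forall j A, measurable A ->
  (mu (wj j) A = \int[m]_(x in A) (v0 (wj j, x))%:E)%E.
Context (g : Omega * X -> 'rV[R]_d) (M Vg : R).
Hypotheses (M0 : 0 <= M) (Vg0 : 0 <= Vg).
Hypothesis g_meas : forall i, measurable_fun setT (fun z => g z 0 i).
Hypothesis g_bd : forall j, {ae m, forall x, `|g (wj j, x)| <= M}.
Hypothesis g_var : forall j, (rvar var (fun x => g (wj j, x)) <= Vg%:E)%E.
Hypothesis g_centered : forall j i, (\int[mu (wj j)]_x (g (wj j, x) 0 i)%:E = 0)%E.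

Let Tw := fibre_map s T w.
Let Aw := fibre_op s L w.
Let v j x := v0 (wj j, x).
Let gap : spectral_gap m var Tw Aw Kd (expR (- lambda)) K.
Proof. exact: (fibre_gap hvar hT hL K0 Kd0 lambda0 L_bound L_decay). Qed.

Let v_int j : rintegrable m (v j).
Proof. by have [[/L1_toCP]] := v0_density j. Qed.

Lemma fibre_density : equivariant_density m var Aw v.
Proof.
split.
- by have [b _ _] := v0_density 0; exact: (inB_bdB hvar b).
- exact: v_int.
- move=> j; have [_ _] := v0_density j; apply: filterS => x.
  by rewrite /Aw /fibre_op /real_part_op => ->.
- by have [_ e _] := v0_density 0; rewrite /Rintegral e.
Qed.

(** The observable, set to zero where it exceeds its essential bound; this changes
    it on a null set of each fibre only, and makes it bounded everywhere as the
    chain rule for the variation requires. *)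
Definition truncation j x : 'rV[R]_d :=
  \1_[set x | `|g (wj j, x) - 0| < M + 1] x *: g (wj j, x).
Let f := truncation.

Let g_sec_meas j i : measurable_fun setT (fun x => g (wj j, x) 0 i).
Proof. exact: (measurable_fun_pair2 (f := fun z => g z 0 i)). Qed.

Let M1 : 0 < M + 1. Proof. by rewrite ltr_wpDl. Qed.

Let f_meas j i : measurable_fun setT (fun x => f j x 0 i).
Proof.
rewrite (_ : (fun x => _) =
  (fun x => \1_[set x | `|g (wj j, x) - 0| < M + 1] x * g (wj j, x) 0 i)); last first.
  by apply/funext => x; rewrite /f /truncation mxE.
apply: measurable_funM => //; apply: measurable_indic.
exact: measurable_rV_ball.
Qed.

Let f_bd j x : `|f j x| <= M + 1.
Proof.
rewrite /f /truncation normrZ indicE; case: (boolP (x \in _)) => [/set_mem /= h|_].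
  by rewrite normr1 mul1r ltW// -[X in `|X|]subr0.
by rewrite normr0 mul0r ltW.
Qed.

Let f_ae j : {ae m, forall x, f j x = g (wj j, x)}.
Proof.
apply: filterS (g_bd j) => x gx; rewrite /f /truncation indicE mem_set ?scale1r//=.
by rewrite subr0 (le_lt_trans gx)// ltrDl.
Qed.

Let f_coord_int j i : rintegrable m (fun x => f j x 0 i).
Proof.
apply: (@rintegrable_bounded _ _ _ _ (M + 1)); split => // x.
exact: le_trans (rV_coord_le _ _) (f_bd j x).
Qed.

Let f_var j : (rvar var (f j) <= Vg%:E)%E.
Proof.
apply: le_trans (g_var j); rewrite /rvar le_eqVlt; apply/orP; left; apply/eqP.
apply: eq_bigr => i _.
have ae : {ae m, forall x, f j x 0 i = g (wj j, x) 0 i}.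
  by apply: filterS (f_ae j) => x ->.
apply: (var_ae hvar); [exact/L1_toCP| |].
  by apply/L1_toCP; exact: ae_eq_rintegrable (f_coord_int j i) (g_sec_meas j i) ae.
by apply: filterS ae => x; rewrite /toC => ->.
Qed.

Let f_coord_bd' j i : bounded_mfun (M + 1) (fun x => f j x 0 i).
Proof. by split => // x; exact: le_trans (rV_coord_le _ _) (f_bd j x). Qed.

Let f_centered j i : \int[m]_x (v j x * f j x 0 i) = 0.
Proof.
rewrite -(density_Rintegral (v_int j) (muE j) (f_coord_bd' j i)).
rewrite /Rintegral -[RHS](congr1 fine (g_centered j i)); congr fine.
apply: ae_eq_integral => //; [exact/measurable_EFinP|exact/measurable_EFinP|].
apply: (density_ae (v_int j) (muE j)).
by apply: filterS (f_ae j) => x -> _.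
Qed.

Let S n x := vector_sum Tw f n x.

(** Nonsingularity of the maps transports the null sets of the later fibres back to
    the first one. *)
Lemma birkhoff_truncation n :
  {ae mu w, forall x, birkhoff s T g n w x = S n x}.
Proof.
apply: (density_ae (v_int 0) (muE 0)).
have H i : {ae m, forall x, f i (orbit_map Tw i x) = g (wj i, orbit_map Tw i x)}.
  have comp (Q : X -> Prop) k : {ae m, forall x, Q x} -> {ae m, forall x, Q (orbit_map Tw k x)}.
    elim: k Q => [//|k IH] Q hQ /=.
    exact: (IH (fun x => Q (Tw k x)) (ae_comp_nonsingular (hT (wj k)) hQ)).
  exact: comp (f_ae i).
have /ae_foralln := H; apply: filterS => x hx.
rewrite /birkhoff /S /vector_sum; apply: eq_bigr => i _.
by rewrite cocycle_orbit_map hx.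
Qed.

Lemma measurable_birkhoff n i : measurable_fun setT (fun x => birkhoff s T g n w x 0 i).
Proof.
rewrite (_ : (fun x => _) = (fun x => \sum_(k < n) g (wj k, orbit_map Tw k x) 0 i)); last first.
  by apply/funext => x; rewrite /birkhoff summxE; apply: eq_bigr => k _; rewrite cocycle_orbit_map.
apply: measurable_sum => k.
exact: measurableT_comp (g_sec_meas k i) (measurable_orbit gap k).
Qed.

Lemma integral_birkhoff n (F : 'rV[R]_d -> R) b :
  bounded_mfun b (fun x => F (S n x)) ->
  measurable_fun setT (fun x => F (birkhoff s T g n w x)) ->
  (\int[mu w]_x (F (birkhoff s T g n w x))%:E = (initial_mean m v (fun x => F (S n x)))%:E)%E.
Proof.
move=> bF mF.
rewrite /initial_mean -(density_Rintegral (v_int 0) (muE 0) bF).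
rewrite /Rintegral fineK; last first.
  by apply: integrable_fin_num => //; exact: (rintegrable_bounded (mu w) bF).
apply: ae_eq_integral => //.
- exact/measurable_EFinP.
- by apply/measurable_EFinP; exact: bF.1.
- by apply: filterS (birkhoff_truncation n) => x -> _.
Qed.

Let S_bd n i := vector_sum_coord_bd gap f_meas f_bd n i.

Lemma covariance_birkhoff n i k :
  covariance (mu w) (fun x => birkhoff s T g n w x 0 i) (fun x => birkhoff s T g n w x 0 k) =
  (initial_mean m v (fun x => S n x 0 i * S n x 0 k))%:E.
Proof.
have E0 l : fine ('E_(mu w)[(fun x => birkhoff s T g n w x 0 l)%R])%E = 0.
  rewrite expectation.unlock (integral_birkhoff (F := fun y => y 0 l) (S_bd n l)); last first.
    exact: measurable_birkhoff.
  exact: (initial_mean_vector_sum_coord gap fibre_density f_meas f_bd f_centered n l).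
rewrite covariance.unlock !E0 expectation.unlock.
rewrite -(integral_birkhoff (F := fun y => y 0 i * y 0 k) (bounded_mfunM (S_bd n i) (S_bd n k))).
  by apply: eq_integral => x _ /=; rewrite !fctE /= !subr0.
by apply: measurable_funM; exact: measurable_birkhoff.
Qed.

Context (Sigma2 : 'M[R]_d) (a : nat -> R).
Hypothesis cov_lim : forall i k,
  ((n%:R^-1)%:E * covariance (mu w) (fun x => birkhoff s T g n w x 0 i)%R
       (fun x => birkhoff s T g n w x 0 k)%R)%E @[n --> \oo] --> (Sigma2 i k)%:E.
Hypothesis a_large : a n / Num.sqrt n%:R @[n --> \oo] --> +oo.
Hypothesis a_small : a n / n%:R @[n --> \oo] --> 0.

Lemma a_gt0 : \forall n \near \oo, 0 < a n.
Proof.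
have /cvgryPgt/(_ 0) H := a_large.
have H2 : \forall n \near \oo, (0 < n)%N by exists 1%N.
apply: filterS2 H H2 => n h n0.
by move: h; rewrite pmulr_lgt0// invr_gt0 sqrtr_gt0 ltr0n.
Qed.

Lemma speed_oo : a n ^+ 2 / n%:R @[n --> \oo] --> +oo.
Proof.
apply/cvgryPge => A.
have /cvgryPge/(_ (Num.max 1 A)) := a_large; apply: filterS => n.
rewrite ge_max => /andP[h1 hA].
have -> : a n ^+ 2 / n%:R = (a n / Num.sqrt n%:R) ^+ 2.
  by rewrite exprMn exprVn sqr_sqrtr.
by apply: le_trans hA _; rewrite expr2 ler_peMl// (le_trans _ h1).
Qed.

Let cS i k : n%:R^-1 * initial_mean m v (fun x => S n x 0 i * S n x 0 k)
  @[n --> \oo] --> Sigma2 i k.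
Proof.
have := @cov_lim i k.
under eq_fun do rewrite covariance_birkhoff -EFinM.
by move=> /fine_cvg.
Qed.

Let log_mgf (theta : 'rV[R]_d) : (a n ^+ 2 / n%:R)^-1 *
      ln (initial_mean m v (fun x => expR (a n / n%:R * rowdot theta (S n x))))
    @[n --> \oo] --> 2^-1 * quad Sigma2 theta.
Proof.
have H := sequential_log_mgf hvar gap fibre_density (fun x => v0_ge0 _) M1 Vg0
  f_meas f_bd f_var f_centered.
exact: (H Sigma2 a (@cS) a_gt0 a_small).
Qed.

Let S_norm_bd n : exists C, forall x, `|S n x| <= C.
Proof.
exists (n%:R * (M + 1)) => x; rewrite /S /vector_sum.
apply: le_trans (ler_norm_sum _ _ _) _.
apply: (@le_trans _ _ (\sum_(i < n) (M + 1))); first by apply: ler_sum => i _; exact: f_bd.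
by rewrite sumr_const card_ord mulr_natl.
Qed.

Let rowdot_S_bd n theta : exists C, bounded_mfun C (fun x => rowdot theta (S n x)).
Proof. exact: (@rowdot_Y_bd _ _ _ _ (fun n => S n) (fun n i => (S_bd n i).1) S_norm_bd n theta). Qed.

Lemma initial_mean_exp_gt0 n theta c :
  0 < initial_mean m v (fun x => expR (c * rowdot theta (S n x))).
Proof.
have [C bC] := rowdot_S_bd n theta.
exact: weighted_expR_gt0 (v_int 0) (fun=> v0_ge0 _) (density_mass fibre_density)
  (bounded_mfunZ c bC).
Qed.

Lemma quenched_log_mgf theta :
  (((a n ^+ 2 / n%:R)^-1)%:E *
       lne (\int[mu w]_x
         (expR (rowdot theta (birkhoff s T g n w x) / (n%:R / a n)))%:E))%E
      @[n --> \oo] --> (2^-1 * quad Sigma2 theta)%:E.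
Proof.
have E n : (\int[mu w]_x (expR (rowdot theta (birkhoff s T g n w x) / (n%:R / a n)))%:E =
   (initial_mean m v (fun x => expR (a n / n%:R * rowdot theta (S n x))))%:E)%E.
  have [C bC] := rowdot_S_bd n theta.
  rewrite -(integral_birkhoff (F := fun y => expR (a n / n%:R * rowdot theta y))
    (bounded_mfun_expR (bounded_mfunZ (a n / n%:R) bC))).
    by apply: eq_integral => x _; rewrite invf_div mulrC.
  apply: measurableT_comp => //; apply: measurable_funM => //.
  by apply: measurable_rowdot => i; exact: measurable_birkhoff.
under eq_fun do rewrite E lne_EFin ?initial_mean_exp_gt0// -EFinM.
by apply: cvg_EFin; [exact: nearW|exact: log_mgf].
Qed.

Section posdef.
Hypothesis pS : posdef Sigma2.
Let Y n x : 'rV[R]_d := (a n)^-1 *: S n x.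
Let b n := a n ^+ 2 / n%:R.

Let Y_meas n i : measurable_fun setT (fun x => Y n x 0 i).
Proof.
rewrite (_ : (fun x => _) = (fun x => (a n)^-1 * S n x 0 i)); last first.
  by apply/funext => x; rewrite mxE.
by apply: measurable_funM => //; exact: (S_bd n i).1.
Qed.

Let Y_bd n : exists C, forall x, `|Y n x| <= C.
Proof.
have [C hC] := S_norm_bd n; exists (`|(a n)^-1| * C) => x.
by rewrite normrZ ler_wpM2l.
Qed.

Let Z_lim theta :
  (b n)^-1 * ln (Zmgf (mu w) Y b n theta) @[n --> \oo] --> 2^-1 * quad Sigma2 theta.
Proof.
apply: cvg_trans (@log_mgf theta); apply: near_eq_cvg.
apply: filterS a_gt0 => n an; congr (_ * ln _).
have [C bC] := rowdot_S_bd n theta.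
have bE := bounded_mfun_expR (bounded_mfunZ (a n / n%:R) bC).
rewrite /initial_mean -(density_Rintegral (v_int 0) (muE 0) bE) /Zmgf.
apply: eq_Rintegral => x _; rewrite rowdotZr /b mulrA; congr (expR (_ * _)).
by rewrite mulrAC expr2 mulfK// gt_eqF.
Qed.

Let event_eq (A : set 'rV[R]_d) n : (forall Z : X -> 'rV[R]_d,
    (forall i, measurable_fun setT (fun x => Z x 0 i)) -> measurable [set x | A (Z x)]) ->
  mu w [set x | A ((a n)^-1 *: birkhoff s T g n w x)] = mu w [set x | A (Y n x)].
Proof.
move=> mA; apply: ae_iff_measure.
- apply: mA => i; rewrite (_ : (fun x => _) = (fun x => (a n)^-1 * birkhoff s T g n w x 0 i)).
    by apply: measurable_funM => //; exact: measurable_birkhoff.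
  by apply/funext => x; rewrite mxE.
- exact: mA.
- by apply: filterS (birkhoff_truncation n) => x e /=; rewrite /Y -e.
Qed.

Lemma quenched_upper (A : set 'rV[R]_d) : closed A ->
  (limn_esup (fun n => ((a n ^+ 2 / n%:R)^-1)%:E *
      lne (mu w [set x | A ((a n)^-1 *: birkhoff s T g n w x)%R]))
    <= - ((2^-1)%:E * ereal_inf [set (quad (invmx Sigma2) x)%:E | x in A]))%E.
Proof.
move=> cA.
have mA (Z : X -> 'rV[R]_d) : (forall i, measurable_fun setT (fun x => Z x 0 i)) ->
    measurable [set x | A (Z x)].
  move=> mZ; rewrite (_ : [set x | _] = ~` [set x | (~` A) (Z x)]).
    by apply: measurableC; apply: measurable_rV_open => //; exact: closed_openC.
  by apply/seteqP; split => x /=; [move=> Ax nA; exact: nA|exact: contrapT].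
under eq_fun do rewrite (event_eq _ mA).
exact: (large_deviation_upper pS Y_meas Y_bd speed_oo (@Z_lim)).
Qed.

Lemma quenched_lower (A : set 'rV[R]_d) : open A ->
  (- ((2^-1)%:E * ereal_inf [set (quad (invmx Sigma2) x)%:E | x in A])
    <= limn_einf (fun n => ((a n ^+ 2 / n%:R)^-1)%:E *
      lne (mu w [set x | A ((a n)^-1 *: birkhoff s T g n w x)%R])))%E.
Proof.
move=> oA.
have mA (Z : X -> 'rV[R]_d) : (forall i, measurable_fun setT (fun x => Z x 0 i)) ->
    measurable [set x | A (Z x)].
  by move=> mZ; exact: measurable_rV_open.
under [X in limn_einf X]eq_fun do rewrite (event_eq _ mA).
exact: (large_deviation_lower pS Y_meas Y_bd speed_oo (@Z_lim)).
Qed.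

End posdef.
End quenched.

(** * Almost every fibre *)

Lemma ess_sup_bound (R : realType) dX (X : measurableType dX)
    (m : {measure set X -> \bar R}) (f : X -> \bar R) :
  (ess_sup m f < +oo)%E ->
  exists2 M : R, 0 <= M & {ae m, forall x, (f x <= M%:E)%E}.
Proof.
move=> foo; have := ess_sup_ge m f; case: (ess_sup m f) foo => [r|//|] _ H.
- exists (Num.max 0 r); first by rewrite le_max lexx.
  apply: filterS H => x fx; apply: le_trans fx _.
  by rewrite lee_fin le_max lexx orbT.
- exists 0 => //; apply: filterS H => x fx; apply: le_trans fx _.
  exact: leNye.
Qed.

Lemma Lnorm_oo_bound (R : realType) dX (X : measurableType dX)
    (m : {measure set X -> \bar R}) (f : X -> \bar R) :
  (0 < m setT)%E -> (Lnorm m +oo f < +oo)%E ->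
  exists2 M : R, 0 <= M & {ae m, forall x, (`|f x| <= M%:E)%E}.
Proof. by rewrite unlock /Lnorm => -> /ess_sup_bound. Qed.

Theorem theorem4p4 (R : realType)
    (dO : measure_display) (Omega : measurableType dO) (P : probability Omega R)
    (E : metricType R) (emb : Omega -> E) (s : Omega -> Omega)
    (dX : measure_display) (X : measurableType dX) (m : probability X R)
    (d : nat) (var : (X -> R[i]) -> \bar R)
    (T : Omega -> X -> X) (L : Omega -> (X -> R[i]) -> (X -> R[i]))
    (v0 : Omega * X -> R) (mu : Omega -> probability X R)
    (g : Omega * X -> 'rV[R]_d) (Sigma2 : 'M[R]_d) (a : nat -> R) :
  (0 < d)%N ->
  borel_subset_of_polish emb ->
  homeomorphism (s : initial_topology emb -> initial_topology emb) ->
  invertible_ergodic P s ->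
  is_variation m d var ->
  (forall w, nonsingular m (T w)) ->
  (forall w, is_transfer m (T w) (L w)) ->
  admissible m P emb s var L ->
  measurable_fun setT v0 ->
  (forall z, 0 <= v0 z) ->
  {ae P, forall w, [/\ inB m var (toC (fun x => v0 (w, x))),
    (\int[m]_x (v0 (w, x))%:E = 1)%E &
    {ae m, forall x, L w (toC (fun y => v0 (w, y))) x = (v0 (s w, x))%:C}]} ->
  {ae P, forall w, forall A, measurable A ->
    (mu w A = \int[m]_(x in A) (v0 (w, x))%:E)%E} ->
  (forall i, measurable_fun setT (fun z => g z 0 i)) ->
  (Lnorm (P \x m) +oo (fun z => `|g z|%:E) < +oo)%E ->
  (ess_sup P (fun w => rvar var (fun x => g (w, x))) < +oo)%E ->
  {ae P, forall w, forall i, (\int[mu w]_x (g (w, x) 0 i)%:E = 0)%E} ->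
  psd Sigma2 ->
  {ae P, forall w, forall i j,
    ((n%:R^-1)%:E * covariance (mu w)
       (fun x => birkhoff s T g n w x 0 i)%R
       (fun x => birkhoff s T g n w x 0 j)%R)%E
      @[n --> \oo] --> (Sigma2 i j)%:E} ->
  a n / Num.sqrt n%:R @[n --> \oo] --> +oo ->
  a n / n%:R @[n --> \oo] --> 0 ->
  {ae P, forall w, forall theta : 'rV[R]_d,
    (((a n ^+ 2 / n%:R)^-1)%:E *
       lne (\int[mu w]_x
         (expR (rowdot theta (birkhoff s T g n w x) / (n%:R / a n)))%:E))%E
      @[n --> \oo] --> (2^-1 * quad Sigma2 theta)%:E} /\
  (posdef Sigma2 ->
   {ae P, forall w,
     (forall A : set 'rV[R]_d, closed A ->
       (limn_esup (fun n => ((a n ^+ 2 / n%:R)^-1)%:E *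
          lne (mu w [set x | A ((a n)^-1 *: birkhoff s T g n w x)%R]))
        <= - ((2^-1)%:E *
              ereal_inf [set (quad (invmx Sigma2) x)%:E | x in A]))%E) /\
     (forall A : set 'rV[R]_d, open A ->
       (- ((2^-1)%:E *
           ereal_inf [set (quad (invmx Sigma2) x)%:E | x in A])
        <= limn_einf (fun n => ((a n ^+ 2 / n%:R)^-1)%:E *
             lne (mu w [set x | A ((a n)^-1 *: birkhoff s T g n w x)%R])))%E)}).

Proof.
move=> d0 _ _ erg hvar hT hL adm mv0 v0_ge0 hv0 hmu mg gM gV gc psdS hcov a_large a_small.
have [K K0 /(ae_forward_orbit erg) hK] := adm_uniform adm.
have [Kd [lambda [Kd0 lambda0 /(ae_forward_orbit erg) hD]]] := adm_decay adm.
have PmT : (0 < (P \x m)%E setT)%E.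
  rewrite -setXTT product_measure1E//.
  by rewrite [X in (X * _)%E]probability_setT [X in (_ * X)%E]probability_setT mule1 lte01.
have [M M0 /ae_sections/(ae_forward_orbit erg) hM] := Lnorm_oo_bound PmT gM.
have [Vg Vg0 /(ae_forward_orbit erg) hV] := ess_sup_bound gV.
have {}hv0 := ae_forward_orbit erg hv0.
have {}hmu := ae_forward_orbit erg hmu.
have {}gc := ae_forward_orbit erg gc.
pose good w := [/\ forall j f, inB m var f ->
     (normB m var (L (iter j s w) f) <= K%:E * normB m var f)%E,
   forall j n f, inB m var f -> cintegral m f = 0 ->
     (normB m var (cocycle s L n (iter j s w) f) <=
      (Kd * expR (- lambda * n%:R))%:E * normB m var f)%E,
   forall j, [/\ inB m var (toC (fun x => v0 (iter j s w, x))),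
      (\int[m]_x (v0 (iter j s w, x))%:E = 1)%E &
      {ae m, forall x, L (iter j s w) (toC (fun y => v0 (iter j s w, y))) x =
         (v0 (s (iter j s w), x))%:C}] &
   forall j A, measurable A ->
     (mu (iter j s w) A = \int[m]_(x in A) (v0 (iter j s w, x))%:E)%E].
have H1 : {ae P, forall w, good w}.
  have H12 : {ae P, forall w, (forall j f, inB m var f ->
       (normB m var (L (iter j s w) f) <= K%:E * normB m var f)%E) /\
     (forall j n f, inB m var f -> cintegral m f = 0 ->
       (normB m var (cocycle s L n (iter j s w) f) <=
        (Kd * expR (- lambda * n%:R))%:E * normB m var f)%E)}.
    by apply: filterS2 hK hD.
  by apply: filterS3 H12 hv0 hmu => w [? ?] ? ?.
pose good2 w := [/\ forall j, {ae m, forall x, `|g (iter j s w, x)| <= M},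
   forall j, (rvar var (fun x => g (iter j s w, x)) <= Vg%:E)%E &
   forall j i, (\int[mu (iter j s w)]_x (g (iter j s w, x) 0 i)%:E = 0)%E].
have H2 : {ae P, forall w, good2 w}.
  apply: filterS3 hM hV gc => w h1 h2 h3; split => // j.
  by apply: filterS (h1 j) => x; rewrite /= lee_fin normr_id.
split.
  apply: filterS3 H1 H2 hcov => w [g1 g2 g3 g4] [g5 g6 g7] g8 theta.
  exact: (quenched_log_mgf hvar hT hL K0 Kd0 lambda0 g1 g2 v0_ge0 g3 g4 M0 Vg0 mg
    g5 g6 g7 g8 a_large a_small).
move=> pS; apply: filterS3 H1 H2 hcov => w [g1 g2 g3 g4] [g5 g6 g7] g8; split => A.
  exact: (quenched_upper hvar hT hL K0 Kd0 lambda0 g1 g2 v0_ge0 g3 g4 M0 Vg0 mg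
    g5 g6 g7 g8 a_large a_small pS).
exact: (quenched_lower hvar hT hL K0 Kd0 lambda0 g1 g2 v0_ge0 g3 g4 M0 Vg0 mg
  g5 g6 g7 g8 a_large a_small pS).
Qed.
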